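(* Let $k\geq 2$ be a fixed even integer and $\delta\in\{1,-1\}$. Let $\xi$ be a primitive real Dirichlet character of conductor $\ell$. Let $Q$ be large. Then there are at least $Q^{1/3+o(1)}$ primitive Dirichlet characters $\chi$ of order $k$ and conductor $q\leq Q$ such that $\chi(-1)=\delta$ and $$|L(1,\chi\xi)|\geq\frac{\varphi(\ell)}{\ell}e^{\gamma}\log\log Q+O_{\ell}(1).$$
   Context: $\gamma$ is the Euler–Mascheroni constant, $\varphi$ is Euler's totient function, $L(s,\chi\xi)$ is the Dirichlet $L$-function of the product character $n\mapsto\chi(n)\xi(n)$. The trivial character (with $\ell=1$) is allowed as $\xi$. The order of $\chi$ is its order in the group of characters modulo $q$. The characters $\xi$ and the integer $k$ are fixed, $o(1)$ is a quantity tending to $0$ as $Q\to\infty$, and $O_\ell(1)$ denotes a quantity bounded by a constant depending on $\ell$ (with $k$ fixed). *)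

(* Defs.v *)
From HB Require Import structures.
From mathcomp Require Import all_boot all_order all_algebra.
From mathcomp Require Import all_classical all_reals all_analysis.
From mathcomp Require Import complex.
Set Implicit Arguments.
Unset Strict Implicit.
Unset Printing Implicit Defensive.
Import Order.TTheory GRing.Theory Num.Theory.
Import numFieldNormedType.Exports.
Local Open Scope classical_set_scope.
Local Open Scope ring_scope.
Local Open Scope complex_scope.

(* A Dirichlet character modulo q is represented by its extension by zero to
   all integers; chi 1 = 1 follows from the clauses below. *)
Definition dirichlet_char (R : realType) (q : nat) (chi : int -> R[i]) : Prop :=
  [/\ (0 < q)%N,
      forall m n : int, chi (m * n) = chi m * chi n,
      forall n : int, chi (n + q%:Z) = chi n &
      forall n : int, (chi n != 0) = coprimez n q%:Z].

Definition principal_char (R : realType) (q : nat) (n : int) : R[i] :=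
  if coprimez n q%:Z then 1 else 0.

Definition char_order (R : realType) (q : nat) (chi : int -> R[i]) (k : nat)
    : Prop :=
  [/\ (0 < k)%N,
      forall n : int, chi n ^+ k = principal_char R q n &
      forall j : nat, (0 < j)%N ->
        (forall n : int, chi n ^+ j = principal_char R q n) -> (k <= j)%N].

Definition induced_from (R : realType) (q : nat) (chi : int -> R[i]) (d : nat)
    : Prop :=
  (d %| q)%N /\
  exists psi : int -> R[i], dirichlet_char d psi /\
    forall n : int, coprimez n q%:Z -> chi n = psi n.

(* Primitive modulo q, i.e. of conductor exactly q; the function identically 1
   is the primitive character of conductor 1. *)
Definition primitive_char (R : realType) (q : nat) (chi : int -> R[i]) : Prop :=
  dirichlet_char q chi /\
  forall d : nat, induced_from q chi d -> d = q.

Definition real_char (R : realType) (chi : int -> R[i]) : Prop :=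
  forall n : int, chi n \is Num.real.

(* n ^ (- s) = exp (- s log n), for n > 0. *)
Definition nat_cpowN (R : realType) (n : nat) (s : R[i]) : R[i] :=
  let: a +i* b := s in
  let t := ln (n%:R : R) in
  (expR (- (a * t)))%:C * (cos (b * t) -i* sin (b * t)).

(* L(s, f) = z. The series defines the L-function of a nonprincipal character
   on the whole half-plane Re s > 0, with conditional convergence for
   Re s <= 1. At s = 1 the relation holds for no z when f is principal, where
   the L-function has a pole. *)
Definition is_dirichlet_L (R : realType) (f : int -> R[i]) (s z : R[i]) : Prop :=
  series (fun n : nat => f n.+1%:Z * nat_cpowN n.+1 s : R[i]^o) @ \oo
    --> (z : R[i]^o).

Definition euler_gamma (R : realType) : R :=
  lim ((fun n : nat => series (@harmonic R) n - ln n%:R) @ \oo).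

(* The primitive characters of order k and conductor q <= Q with
   chi (-1) = delta and |L(1, chi xi)| >= B. A primitive character, as a
   function on int, determines q, so these are counted as functions. *)
Definition large_L1_chars (R : realType) (k : nat) (delta : int)
    (xi : int -> R[i]) (Q B : R) : set (int -> R[i]) :=
  [set chi | exists q : nat,
     [/\ q%:R <= Q, primitive_char q chi, char_order q chi k,
         chi (-1) = delta%:~R &
         exists2 z : R[i], is_dirichlet_L (fun n => chi n * xi n) 1 z &
                           B%:C <= `|z|]].

(* Main.v *)
(** Take chi = xi psi chi_d.  Here psi = chi1 conj(chi2), where chi1 and chi2
    are characters of order k modulo primes q1 <> q2 that agree at every prime
    p <= y; they exist by pigeonhole, since more than k^pi(y) of the first
    primes = 1 mod k are available with only exponentially large size.  The
    quadratic character chi_d has |d| squarefree and d = 1 modulo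
    W = 8 q1 q2 prod_{p <= y} p, so that chi_d(p) = 1 for p <= y by reciprocity,
    and its sign is chosen to give chi(-1) = delta.

    As xi^2 is principal, L(1, chi xi) is the L-function of 1_{(n,l)=1} psi chi_d,
    which agrees with 1_{(n,l)=1} on the y-smooth integers.  Average its partial
    sum up to J over all d = 1 + sW(j+1), j < J, squarefree or not: smooth n give
    prod_{p <= y, p not dividing l} (1 - 1/p)^-1, up to a bounded error,
    which is at least phi(l)/l e^gamma log y - O(1) by Mertens; the other n
    cancel in the sum over j unless divisible by p^2 for some p > y.  The
    non-squarefree d contribute little, and every partial sum is at most
    1 + log J, so at least J / (1 + log J) of the d have a large partial sum.
    The rest of the L-series is O(1) by a bound for the autocorrelations
    sum_x f(x + h) conj(f(x)), which are small for primitive characters.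
    With y a constant multiple of log Q one may take J > Q^(4/5), so the
    exponent 1/3 is attained with e = 0. *)

Require Import Defs.
From HB Require Import structures.
From mathcomp Require Import all_boot all_order all_algebra.
From mathcomp Require Import all_field cyclic.
From mathcomp Require Import all_classical all_reals all_analysis.
From mathcomp Require Import complex.
From mathcomp Require Import ring lra zify.
Set Implicit Arguments.
Unset Strict Implicit.
Unset Printing Implicit Defensive.
Import Order.TTheory GRing.Theory Num.Theory.
Import numFieldNormedType.Exports.

(** * Chebyshev and Mertens estimates *)

(** A character of order k with small conductor cannot simply be prescribed at every prime p <= y,
    but the quotient of two that agree there is 1 at these primes whatever their common values are.
    So psi supplies the order, while chi_d supplies the parity and the number of characters; k being
    even, neither chi_d nor xi raises the order. The obstacle is the range of n. Averaging over J
    discriminants controls the L-series only up to about J, because a rough n may cost as much as n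
    against a gain of J. The conductor can exceed J by a factor exp(O(y)), and y has to be of size
    log Q for the main term log y to reach log log Q. A trivial bound between J and the conductor
    would then lose a multiple of y. Square-root cancellation in short windows, coming from the
    small autocorrelations, reduces this loss to a constant. The Euler constant enters through a
    Laplace transform in ln p: the sums over primes are compared with zeta near 1, and harmonic
    numbers are transformed by the same kernel. *)

Definition primorial (n : nat) : nat := \prod_(0 <= p < n.+1 | prime p) p.

Lemma primorial_gt0 n : 0 < primorial n.
Proof. by rewrite prodn_cond_gt0 // => p /prime_gt0. Qed.

Lemma primorialS n : primorial n.+1 = primorial n * (if prime n.+1 then n.+1 else 1).
Proof.
rewrite /primorial big_mkcond big_nat_recr //= -big_mkcond /=.
by case: ifP.
Qed.

Lemma prime_dvd_primorial p n : prime p -> (p %| primorial n) = (p <= n).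
Proof.
move=> pp; elim: n => [|n IH].
  by rewrite /primorial big_mkcond big_nat1 /= leqn0 dvdn1; case: p pp => [|[]].
rewrite primorialS Euclid_dvdM // IH [in RHS]leq_eqVlt ltnS orbC.
case: (boolP (prime n.+1)) => [pn|pn]; first by rewrite dvdn_prime2.
rewrite dvdn1; case: (p =P 1) => [p1|_]; first by move: pp; rewrite p1.
by case: eqP => // pe; rewrite -pe pp in pn.
Qed.

Lemma prod_primes_dvd (a b N : nat) :
  (forall p, a <= p < b -> prime p -> p %| N) ->
  \prod_(a <= p < b | prime p) p %| N.
Proof.
elim: b => [|b IH] H; first by rewrite big_geq.
case: (leqP a b) => ab; last by rewrite big_geq.
rewrite big_mkcond big_nat_recr //= -big_mkcond /=.
have H1 : \prod_(a <= p < b | prime p) p %| N.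
  by apply: IH => p /andP[h1 h2]; apply: H; rewrite h1 ltnS ltnW.
case: ifP => [pb|]; last by rewrite muln1.
rewrite Gauss_dvd ?H1 ?H ?ab /= //.
rewrite big_nat_cond; apply: (big_ind (fun x => coprime x b)) => [|x y|p].
- by rewrite /coprime gcd1n.
- by rewrite coprimeMl => -> ->.
by case/andP=> /andP[_ pb'] pp; rewrite prime_coprime // dvdn_prime2 // neq_ltn pb'.
Qed.

(** The coefficient occurs twice, at m and at m + 1, in the expansion of 2 ^ (2m + 1). *)
Lemma bin_mid_le m : 'C(m.*2.+1, m) <= 4 ^ m.
Proof.
have H : 'C(m.*2.+1, m) * 2 <= 2 ^ m.*2.+1.
  rewrite -[X in X ^ _.+1]/(1 + 1) expnDn (bigD1 (inord m)) //=.
  rewrite (bigD1 (inord m.+1)) /=; last first.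
    by rewrite -val_eqE /= !inordK; lia.
  rewrite !exp1n !muln1 !inordK; try lia.
  rewrite -[in X in _ + (X + _)]bin_sub; last by lia.
  rewrite (_ : m.*2.+1 - m.+1 = m); last by lia.
  by rewrite muln2 -addnn addnA leq_addr.
by move: H; rewrite expnS mulnC leq_pmul2l // -muln2 mulnC expnM.
Qed.

(** Erdős's argument: an even n > 2 reduces to n - 1, and for n = 2k + 1 the primes in (k + 1, 2k +
    1] all divide the binomial coefficient of 2k + 1 over k, which is at most 4 ^ k. *)
Lemma primorial_le n : primorial n <= 4 ^ n.
Proof.
have [m] := ubnP n; elim: m n => // m IH n lt.
case: n lt => [|[|[|n]]] lt; try by rewrite /primorial unlock.
case: (boolP (odd n)) => on.
  rewrite primorialS (_ : prime n.+3 = false) ?muln1; last first.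
    apply/negP => pn; have /(prime_nt_dvdP pn) : 2 %| n.+3 by rewrite dvdn2 /= on.
    by move=> /(_ isT) h; move: on; have -> : n = 0 by lia.
  apply: leq_trans (IH n.+2 _) _; first by lia.
  by rewrite leq_exp2l.
have [k nk] : exists k, n.+3 = k.*2.+1.
  by exists (n./2).+1; have := odd_double_half n; rewrite (negbTE on); lia.
rewrite nk {1}/primorial (big_cat_nat (n := k.+2)) //=; last by rewrite -addnn; lia.
rewrite -[\prod_(0 <= _ < _ | _) _]/(primorial k.+1).
have H1 : \prod_(k.+2 <= p < k.*2.+2 | prime p) p %| 'C(k.*2.+1, k).
  apply: prod_primes_dvd => p /andP[h1 h2] pp.
  have : p %| (k.*2.+1)`! by rewrite dvdn_fact //; lia.
  rewrite -(@bin_fact k.*2.+1 k); last by lia.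
  rewrite !Euclid_dvdM //; case/orP => // .
  have npf j : j < p -> ~~ (p %| j`!).
    elim: j => [|j IHj] jp; first by rewrite fact0 dvdn1; apply: contraL pp => /eqP->.
    rewrite factS Euclid_dvdM // negb_or IHj ?andbT; last exact: ltnW.
    by rewrite gtnNdvd.
  by case/orP => h; [have := npf k | have := npf (k.*2.+1 - k)];
    rewrite h /= => npf'; exfalso; suff: false by []; apply: npf'; lia.
have H2 := dvdn_leq (_ : 0 < 'C(k.*2.+1, k)) H1.
apply: leq_trans (leq_mul (IH k.+1 _) (leq_trans (H2 _) (bin_mid_le k))) _.
- by lia.
- by rewrite bin_gt0; lia.
by rewrite -expnD leq_exp2l //; lia.
Qed.

Local Open Scope ring_scope.

Section Mertens.
Variable R : realType.
Implicit Types n m p : nat.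

Lemma ln_prod (I : Type) (r : seq I) (P : pred I) (F : I -> R) :
  (forall i, P i -> 0 < F i) ->
  ln (\prod_(i <- r | P i) F i) = \sum_(i <- r | P i) ln (F i).
Proof.
move=> F0; suff [] : 0 < \prod_(i <- r | P i) F i /\
  ln (\prod_(i <- r | P i) F i) = \sum_(i <- r | P i) ln (F i) by [].
apply: (big_ind2 (fun x y => 0 < x /\ ln x = y)); first by rewrite ln1.
- move=> x1 x2 y1 y2 [x10 <-] [y10 <-]; split; first exact: mulr_gt0.
  by rewrite lnM.
by move=> i Pi; split=> //; exact: F0.
Qed.

Lemma logn_count p n (B : nat) : prime p -> (0 < n <= B)%N ->
  logn p n = (\sum_(1 <= j < B.+1) (p ^ j %| n)%N)%N.
Proof.
move=> pp /andP[n0 nB].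
under eq_bigr do rewrite pfactor_dvdn //.
have lB : (logn p n <= B)%N by apply: leq_trans nB; apply/ltnW/ltn_logl.
rewrite (@big_cat_nat _ _ _ (logn p n).+1) //=.
rewrite [X in (_ + X)%N]big1_seq ?addn0; last first.
  by move=> j; rewrite mem_index_iota /= => /andP[h _]; rewrite leqNgt h.
under eq_big_nat => j /andP[_ h] do rewrite -ltnS h.
by rewrite sum_nat_const_nat muln1 subSS subn0.
Qed.

Lemma prime_gt0R p : prime p -> 0 < p%:R :> R.
Proof. by move=> /prime_gt0; rewrite ltr0n. Qed.

Lemma ln_prime_gt0 p : prime p -> 0 < ln (p%:R : R).
Proof. by move=> /prime_gt1 p1; rewrite ln_gt0 // ltr1n. Qed.

Lemma ln_natE n (B : nat) : (0 < n <= B)%N ->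
  ln (n%:R : R) = \sum_(0 <= p < B.+1 | prime p)
     ln (p%:R) * (\sum_(1 <= j < B.+1) (p ^ j %| n)%N)%N%:R.
Proof.
move=> nB; have /andP[n0 nleB] := nB.
have E : n = (\prod_(0 <= p < B.+1 | prime p) p ^ logn p n)%N.
  rewrite -[LHS](partnT n0) /partn.
  rewrite (@big_cat_nat _ _ _ n.+1 0 B.+1) //=.
  rewrite [X in (_ * X)%N]big1_seq ?muln1; last first.
    move=> p /andP[pp]; rewrite mem_index_iota => /andP[h _].
    by rewrite lognE pp n0 /= gtnNdvd.
  rewrite [RHS]big_mkcond /=; apply: eq_bigr => p _.
  by case: ifPn => // np; rewrite lognE (negbTE np).
rewrite {1}E natr_prod ln_prod; last by move=> p pp; rewrite ltr0n expn_gt0 prime_gt0.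
apply: eq_bigr => p pp; rewrite -logn_count // natrX lnXn ?prime_gt0R //.
by rewrite mulr_natr.
Qed.

(** Legendre's formula for a finite family of integers, by exchanging summations. It is applied to
    1, ..., n and later to values of a cyclotomic polynomial. *)
Lemma sum_ln_natE (N B : nat) (a : nat -> nat) :
  (forall i, (i < N)%N -> (0 < a i <= B)%N) ->
  \sum_(0 <= i < N) ln ((a i)%:R : R) = \sum_(0 <= p < B.+1 | prime p)
     ln (p%:R) * (\sum_(1 <= j < B.+1) \sum_(0 <= i < N) (p ^ j %| a i)%N)%N%:R.
Proof.
move=> aB.
rewrite (@eq_big_nat _ _ _ 0 N _ (fun i => \sum_(0 <= p < B.+1 | prime p)
     ln (p%:R : R) * (\sum_(1 <= j < B.+1) (p ^ j %| a i)%N)%N%:R)); last first.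
  by move=> i /andP[_ iN]; apply: ln_natE; exact: aB.
rewrite exchange_big /=; apply: eq_bigr => p pp.
rewrite -mulr_sumr -natr_sum; congr (_ * _%:R).
by rewrite exchange_big.
Qed.

Lemma count_multiples (d n : nat) : (0 < d)%N ->
  (\sum_(0 <= i < n) (d %| i.+1)%N)%N = (n %/ d)%N.
Proof.
move=> d0; elim: n => [|n IH]; first by rewrite big_geq // div0n.
rewrite big_nat_recr //= IH.
by rewrite divnS // addnC.
Qed.

Definition lnfact n : R := \sum_(0 <= i < n) ln (i.+1%:R).

Lemma lnfactE n : lnfact n = \sum_(0 <= p < n.+1 | prime p)
  ln (p%:R) * (\sum_(1 <= j < n.+1) (n %/ p ^ j)%N)%N%:R.
Proof.
rewrite /lnfact (@sum_ln_natE n n); last by move=> i; rewrite ltnS.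
apply: eq_bigr => p pp; congr (_ * _%:R); apply: eq_bigr => j _.
by rewrite count_multiples // expn_gt0 prime_gt0.
Qed.

Lemma lnfact_le n : (0 < n)%N -> lnfact n <= n%:R * ln n%:R.
Proof.
move=> n0; rewrite /lnfact.
apply: (@le_trans _ _ (\sum_(0 <= i < n) ln (n%:R : R))).
  apply: ler_sum_nat => i /andP[_ iN].
  by rewrite ler_ln ?posrE ?ltr0n // ler_nat.
by rewrite sumr_const_nat subn0 mulr_natl.
Qed.

Lemma ln_sub_le (x y : R) : 0 < x -> 0 < y -> ln x - ln y <= (x - y) / y.
Proof.
move=> x0 y0; rewrite -ln_div //.
have -> : (x - y) / y = x / y - 1 by field; rewrite gt_eqF.
have := @le_ln1Dx R (x / y - 1); rewrite (addrC 1) subrK; apply.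
  by rewrite ltrBrDl subrr divr_gt0.
Qed.

Lemma lnfact_ge n : n%:R * ln n%:R - n%:R <= lnfact n.
Proof.
elim: n => [|n IH]; first by rewrite mul0r subr0 /lnfact big_geq.
rewrite /lnfact big_nat_recr //= -/(lnfact n).
case: n IH => [|n] IH.
  by rewrite ln1 mulr0 add0r /lnfact big_geq // addr0 lerN10.
have h := @ln_sub_le n.+2%:R n.+1%:R (ltr0Sn _ _) (ltr0Sn _ _).
have h2 : n.+1%:R * (ln n.+2%:R - ln n.+1%:R) <= 1 :> R.
  rewrite [leRHS](_ : 1 = n.+1%:R * ((n.+2%:R - n.+1%:R) / n.+1%:R)) ?ler_pM2l ?ltr0Sn //.
  by rewrite mulrCA mulfV ?pnatr_eq0 // mulr1 -natrB // subSnn.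
move: h2 IH; set F := lnfact _; rewrite -[n.+2%:R in X in _ -> _ -> X]natr1.
rewrite mulrBr mulrDl mul1r natr1; set B := ln _; set A := ln n.+1%:R.
set u := _ * A; set v := _ * B; lra.
Qed.

Lemma geom_sum_le (p M : nat) : (1 < p)%N ->
  \sum_(1 <= j < M.+1) (p%:R ^- j : R) <= (p%:R - 1)^-1.
Proof.
move=> p1; have p1R : 0 < p%:R - 1 :> R by rewrite subr_gt0 ltr1n.
have p0R : 0 < p%:R :> R by rewrite ltr0n ltnW.
suff -> : \sum_(1 <= j < M.+1) (p%:R ^- j : R) = (1 - p%:R ^- M) / (p%:R - 1).
  by rewrite ler_pdivrMr // mulVf ?gt_eqF // lerBlDr lerDl invr_ge0 exprn_ge0 ?ler0n.
elim: M => [|M IH]; first by rewrite big_geq // expr0 invr1 subrr mul0r.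
rewrite big_nat_recr //= IH exprS; field.
by rewrite expf_neq0 ?gt_eqF // (_ : p%:R + -1 = p%:R - 1 :> R).
Qed.

Lemma natr_divn_le (n d : nat) : (n %/ d)%N%:R <= n%:R / d%:R :> R.
Proof.
case: d => [|d]; first by rewrite divn0 invr0 mulr0.
by rewrite ler_pdivlMr ?ltr0Sn // -natrM ler_nat leq_trunc_div.
Qed.

Lemma natr_divn_ge (n d : nat) : (0 < d)%N -> n%:R / d%:R - 1 <= (n %/ d)%N%:R :> R.
Proof.
move=> d0; rewrite lerBlDr ler_pdivrMr ?ltr0n // natr1 -natrM ler_nat.
by rewrite ltnW // ltn_ceil.
Qed.

(** The weight 1 / (p - 1) is the sum of p ^- j over all j >= 1, which is what Legendre's formula
    produces; it also dominates - ln (1 - 1 / p). *)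
Definition mertens_sum n : R := \sum_(0 <= p < n.+1 | prime p) ln (p%:R) / (p%:R - 1).

(** Dropping the floors in Legendre's formula gives ln n! <= n * [mertens_sum n], to be compared
    with ln n! >= n ln n - n. *)
Lemma mertens_sum_ge n : (0 < n)%N -> ln n%:R - 1 <= mertens_sum n.
Proof.
move=> n0; have nR : 0 < n%:R :> R by rewrite ltr0n.
suff : n%:R * (ln n%:R - 1) <= n%:R * mertens_sum n by rewrite ler_pM2l.
rewrite mulrBr mulr1; apply: le_trans (lnfact_ge n) _.
rewrite lnfactE /mertens_sum mulr_sumr; apply: ler_sum => p pp.
rewrite mulrCA ler_pM2l ?ln_prime_gt0 // natr_sum.
apply: (@le_trans _ _ (\sum_(1 <= j < n.+1) n%:R * (p%:R ^- j : R))).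
  by apply: ler_sum => j _; rewrite -natrX natr_divn_le.
by rewrite -mulr_sumr ler_pM2l // geom_sum_le // prime_gt1.
Qed.

Lemma sum_ln_sq n : \sum_(2 <= m < n.+1) ln (m%:R : R) / (m%:R * (m%:R - 1)) <= 2.
Proof.
(* The explicit remainder is what lets the induction close; at n = 0 both sides vanish. *)
suff H : \sum_(2 <= m < n.+2) ln (m%:R : R) / (m%:R * (m%:R - 1)) <=
   2 - (ln n.+1%:R + 2) / n.+1%:R.
  case: n H => [|n] H; first by rewrite big_geq.
  have H' := H; move: H'; rewrite [X in X <= _ -> _]big_nat_recr //=.
  move=> H'; apply: le_trans (_ : _ <= 2 - (ln n.+2%:R + 2) / n.+2%:R) _; last first.
    by rewrite lerBlDr lerDl divr_ge0 ?ler0n // addr_ge0 ?ln_ge0 ?ler1n.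
  apply: le_trans H'; rewrite lerDl.
  by rewrite divr_ge0 ?ln_ge0 ?ler1n // mulr_ge0 // ?ler0n // subr_ge0 ler1n.
elim: n => [|n IH]; first by rewrite big_geq // ln1 add0r divr1 subrr.
rewrite big_nat_recr //=; apply: le_trans (lerD IH (lexx _)) _.
have h := @ln_sub_le n.+2%:R n.+1%:R (ltr0Sn _ _) (ltr0Sn _ _).
have n1 : 1 <= n.+1%:R :> R by rewrite ler1n.
move: h n1; rewrite -[n.+2%:R]natr1; set x : R := n.+1%:R; set a := ln (x + 1); set b := ln x.
move=> h x1; rewrite addrK.
have x0 : 0 < x by lra.
rewrite -subr_ge0.
have -> : 2 - (a + 2) / (x + 1) - (2 - (b + 2) / x + a / ((x + 1) * x)) =
  (2 / (x+1) - (a - b)) / x.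
  by field; rewrite ?gt_eqF //; lra.
apply: divr_ge0; last by lra.
rewrite subr_ge0; apply: le_trans h _.
rewrite (_ : (x + 1 - x) = 1); last by ring.
rewrite ler_pdivrMr // mulrAC ler_pdivlMr; nra.
Qed.

Lemma ln_primorial n : \sum_(0 <= p < n.+1 | prime p) ln (p%:R : R) = ln (primorial n)%:R.
Proof. by rewrite natr_prod ln_prod // => p; exact: prime_gt0R. Qed.

(** Restoring the floors costs ln p for each prime, in total at most n ln 4 <= 4 n by
    [primorial_le]. Passing from 1 / p to 1 / (p - 1) costs the other 2, by [sum_ln_sq]. *)
Lemma mertens_sum_le n : (0 < n)%N -> mertens_sum n <= ln n%:R + 6.
Proof.
move=> n0; have nR : 0 < n%:R :> R by rewrite ltr0n.
have H1 : \sum_(0 <= p < n.+1 | prime p) ln (p%:R : R) / p%:R <= ln n%:R + 4.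
  suff : n%:R * \sum_(0 <= p < n.+1 | prime p) ln (p%:R : R) / p%:R <= n%:R * (ln n%:R + 4).
    by rewrite ler_pM2l.
  rewrite mulrDr; apply: le_trans (lerD (lnfact_le n0) (lexx _)).
  have H2 : \sum_(0 <= p < n.+1 | prime p) ln (p%:R : R) <= n%:R * 4.
    rewrite ln_primorial.
    apply: le_trans (_ : _ <= ln ((4 ^ n)%:R)) _.
      by rewrite ler_ln ?posrE ?ltr0n ?primorial_gt0 ?expn_gt0 // ler_nat primorial_le.
    by rewrite natrX lnXn ?ltr0n // -[leLHS]mulr_natl ler_pM2l // ltW // ln_sublinear.
  apply: le_trans (lerD (lexx _) H2).
  rewrite lnfactE -big_split /= mulr_sumr; apply: ler_sum => p pp.
  have l0 := ln_prime_gt0 pp.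
  rewrite mulrCA -{3}[ln _]mulr1 -mulrDr ler_pM2l // -lerBlDr.
  apply: le_trans (natr_divn_ge _ (prime_gt0 pp)) _.
  by rewrite ler_nat big_ltn // expn1 leq_addr.
have H3 : \sum_(0 <= p < n.+1 | prime p) ln (p%:R : R) / (p%:R * (p%:R - 1)) <= 2.
  apply: le_trans (sum_ln_sq n).
  case: n {H1 nR} n0 => // n _.
  rewrite big_ltn_cond // big_ltn_cond //= big_mkcond.
  apply: ler_sum_nat => m /andP[m2 _]; case: ifP => // _.
  by rewrite divr_ge0 ?ln_ge0 ?ler1n ?(ltnW m2) // mulr_ge0 ?ler0n // subr_ge0 ler1n ltnW.
rewrite (_ : 6 = 4 + 2); last by ring.
rewrite addrA; apply: le_trans (lerD H1 H3); rewrite -big_split /=.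
apply: ler_sum => p pp; have p1 : 1 < p%:R :> R by rewrite ltr1n prime_gt1.
rewrite le_eqVlt; apply/orP; left; apply/eqP; field.
by rewrite !gt_eqF //; lra.
Qed.

Lemma ln_concave_step (x y : R) : 0 < x -> 0 < y -> (y - x) / y <= ln y - ln x.
Proof.
move=> x0 y0; have := ln_sub_le x0 y0.
by rewrite -(opprB y x) mulNr -(opprB (ln y) (ln x)) lerN2.
Qed.

(* Partial summation with weight 1 / ln, written as an induction whose potential carries the error terms. *)
Lemma sum_inv_primes_le (y n : nat) : (2 <= y)%N -> (y <= n)%N ->
  \sum_(y.+1 <= p < n.+1 | prime p) (p%:R - 1 : R)^-1 <=
    ln (ln n%:R) - ln (ln y%:R) + (mertens_sum n - ln n%:R + 1) / ln n%:R
    + 7 * ((ln y%:R)^-1 - (ln n%:R)^-1).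
Proof.
move=> y2; elim: n => [|n IH] yn; first by move: y2 yn; case: y.
have lny0 m : (2 <= m)%N -> 0 < ln m%:R :> R by move=> ?; rewrite ln_gt0 ?ltr1n.
move: yn; rewrite leq_eqVlt => /orP[/eqP <-|yn].
  rewrite big_geq // !subrr add0r mulr0 addr0 divr_ge0 ?(ltW (lny0 _ y2)) //.
  by have := @mertens_sum_ge y (ltnW y2); lra.
have n2 : (2 <= n)%N by apply: leq_trans y2 yn.
rewrite big_mkcond big_nat_recr //= -big_mkcond /=.
apply: le_trans (lerD (IH yn) (lexx _)) _.
have a0 := lny0 _ n2; have b0 : 0 < ln n.+1%:R :> R by apply: lny0; rewrite ltnW.
have ab : ln n%:R <= ln n.+1%:R :> R by rewrite ler_ln ?posrE ?ltr0n ?(ltnW n2) // ler_nat.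
have h1 := @mertens_sum_le n (ltnW n2); have h2 := @mertens_sum_ge n (ltnW n2).
have h3 := ln_concave_step a0 b0.
have E : mertens_sum n.+1 = mertens_sum n + (if prime n.+1 then (n.+1%:R - 1)^-1 else 0) * ln n.+1%:R.
  rewrite /mertens_sum big_mkcond big_nat_recr //= -big_mkcond /=.
  by case: ifP; rewrite ?mul0r // mulrC.
move: E h1 h2 h3 a0 b0 ab; set t := (if _ then _ else _) => ->.
set a := ln n%:R; set b := ln n.+1%:R; set M := mertens_sum n; set c := ln y%:R => h1 h2 h3 a0 b0 ab.
(* By the two Mertens bounds [M - a + 1] lies between 0 and 7, whence the constant 7. *)
have h4 : (M - a + 1) * (a^-1 - b^-1) <= 7 * (a^-1 - b^-1).
  by rewrite ler_wpM2r ?subr_ge0 ?lef_pV2 ?posrE //; lra.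
have -> : ln a - ln c + (M - a + 1) / a + 7 * (c^-1 - a^-1) + t =
  ln a - ln c + (M - a + 1) * (a^-1 - b^-1) + (M - a + 1)/ b + 7 * (c^-1 - a^-1) + t by ring.
have -> : (M + t * b - b + 1) / b = (M - a + 1)/b + t - (b - a) / b.
  by field; rewrite gt_eqF.
by move: h3 h4; set u := (_ - _) / _; set u2 := _ * (_ - _); set u3 := _ / _; set u4 := ln a; set u5 := ln b; set u6 := ln c;
  set u7 := a^-1; set u8 := b^-1; set u9 := c^-1; lra.
Qed.

Lemma sum_inv_primes_ln_le (y n : nat) : (2 <= y)%N -> (y <= n)%N ->
  \sum_(y.+1 <= p < n.+1 | prime p) (p%:R - 1 : R)^-1 <=
    ln (ln n%:R) - ln (ln y%:R) + 7 / ln y%:R.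
Proof.
move=> y2 yn; apply: le_trans (sum_inv_primes_le y2 yn) _.
have n2 : (2 <= n)%N by apply: leq_trans yn.
have b0 : 0 < ln n%:R :> R by rewrite ln_gt0 ?ltr1n.
have h1 := @mertens_sum_le n (ltnW n2).
have : (mertens_sum n - ln n%:R + 1) / ln n%:R <= 7 / ln n%:R.
  by rewrite ler_wpM2r ?invr_ge0 ?(ltW b0) //; lra.
set c := (ln n%:R)^-1; set d := (ln y%:R)^-1.
set a := ln (ln n%:R); set b := ln (ln y%:R).
by clearbody c d a b; lra.
Qed.

End Mertens.

(** * Sums over smooth numbers *)

Definition smooth (q n : nat) : bool := all (fun p => (p <= q)%N) (primes n).

Lemma smoothP q n : (0 < n)%N ->
  reflect (forall p, prime p -> (p %| n)%N -> (p <= q)%N) (smooth q n).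
Proof.
move=> n0; apply: (iffP allP) => H p.
  by move=> pp pn; apply: H; rewrite mem_primes pp n0 pn.
by rewrite mem_primes => /and3P[pp _ pn]; apply: H.
Qed.

Lemma smooth_self n Z : (0 < n <= Z)%N -> smooth Z n.
Proof.
case/andP=> n0 nZ; apply/(smoothP _ n0) => p _ pn.
exact: leq_trans (dvdn_leq n0 pn) nZ.
Qed.

Lemma smooth0 n : (0 < n)%N -> smooth 0 n = (n == 1%N).
Proof.
move=> n0; apply/(smoothP _ n0)/eqP => [H|-> p pp]; last first.
  by rewrite dvdn1 => /eqP p1; rewrite p1 in pp.
apply/eqP; case: (ltngtP n 1%N) => // [|n1]; first by rewrite ltnS leqNgt n0.
have := H _ (pdiv_prime n1) (pdiv_dvd n).
by rewrite leqn0 => /eqP h; have := pdiv_prime n1; rewrite h.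
Qed.

Lemma smoothS_nprime q n : (0 < n)%N -> ~~ prime q.+1 -> smooth q.+1 n = smooth q n.
Proof.
move=> n0 nq; apply/(smoothP _ n0)/(smoothP _ n0) => H p pp pn.
  have := H _ pp pn; rewrite leq_eqVlt => /orP[/eqP pq|//].
  by rewrite -pq pp in nq.
by apply: leqW; apply: H.
Qed.

Lemma smoothS_prime q n : (0 < n)%N -> prime q.+1 ->
  smooth q n = smooth q.+1 n && ~~ (q.+1 %| n)%N.
Proof.
move=> n0 pq; apply/(smoothP _ n0)/andP => [H|[/(smoothP _ n0) H nq] p pp pn].
  split; first by apply/(smoothP _ n0) => p pp pn; apply: leqW; apply: H.
  by apply/negP => /(H _ pq); rewrite ltnn.
have := H _ pp pn; rewrite leq_eqVlt => /orP[/eqP e|//].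
by rewrite -e pn in nq.
Qed.

Lemma smooth_mul q m : (0 < m)%N -> prime q -> smooth q (q * m) = smooth q m.
Proof.
move=> m0 pq; have q0 := prime_gt0 pq.
have qm0 : (0 < q * m)%N by rewrite muln_gt0 q0.
apply/(smoothP _ qm0)/(smoothP _ m0) => H p pp pn.
  by apply: H => //; apply: dvdn_mull.
move: pn; rewrite Euclid_dvdM // => /orP[|]; last exact: H.
by move/dvdn_leq; apply.
Qed.

Section Smooth.
Variable R : realType.
Implicit Types (f : nat -> R).

Definition smsum f q Z : R := \sum_(1 <= n < Z.+1 | smooth q n) f n.

Lemma sum_multiples (F : nat -> R) (q Z : nat) (P : pred nat) : (0 < q)%N ->
  \sum_(1 <= n < Z.+1 | P n && (q %| n)%N) F n =
  \sum_(1 <= m < (Z %/ q).+1 | P (q * m)%N) F (q * m)%N.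
Proof.
move=> q0; elim: Z => [|Z IH]; first by rewrite div0n !big_geq.
rewrite big_mkcond big_nat_recr //= -big_mkcond /= IH divnS //.
case: (boolP (q %| Z.+1)%N) => qZ; last by rewrite andbF addr0 add0n.
rewrite andbT add1n [RHS]big_mkcond big_nat_recr //= -big_mkcond /=.
have -> // : (q * (Z %/ q).+1)%N = Z.+1.
have := divnS Z q0; rewrite qZ add1n => <-.
by rewrite mulnC divnK.
Qed.

Variable f : nat -> R.
Hypothesis fM : forall m n, (0 < m)%N -> (0 < n)%N -> f (m * n)%N = f m * f n.
Hypothesis f0 : forall n, 0 <= f n.

Lemma smsum_ge0 q Z : 0 <= smsum f q Z.
Proof. by apply: sumr_ge0 => i _; exact: f0. Qed.

Lemma smsum_le q Z Z' : (Z <= Z')%N -> smsum f q Z <= smsum f q Z'.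
Proof.
move=> h; rewrite /smsum (@big_cat_nat _ _ _ Z.+1 1 Z'.+1) //= lerDl.
by apply: sumr_ge0 => i _; exact: f0.
Qed.

Lemma smsum_nprime q Z : ~~ prime q.+1 -> smsum f q.+1 Z = smsum f q Z.
Proof.
move=> nq; rewrite /smsum big_nat_cond [RHS]big_nat_cond; apply: eq_bigl => n.
by case: (ltnP 0 n) => n0 //=; rewrite smoothS_nprime.
Qed.

(** The terms divisible by the new prime are divided by it once. Both product bounds below are
    inductions on this recursion. *)
Lemma smsum_prime q Z : prime q.+1 ->
  smsum f q.+1 Z = smsum f q Z + f q.+1 * smsum f q.+1 (Z %/ q.+1).
Proof.
move=> pq; rewrite {1}/smsum (bigID (fun n => q.+1 %| n)%N) /= addrC; congr (_ + _).
  rewrite /smsum big_nat_cond [RHS]big_nat_cond; apply: eq_bigl => n.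
  by case: (ltnP 0 n) => n0 //=; rewrite -smoothS_prime.
rewrite sum_multiples // /smsum mulr_sumr big_nat_cond [RHS]big_nat_cond.
apply: eq_big => n; first by case: (ltnP 0 n) => n0 //=; rewrite smooth_mul.
by case/andP=> /andP[n0 _] _; rewrite fM.
Qed.

Lemma smsum0 Z : (0 < Z)%N -> smsum f 0 Z = f 1%N.
Proof.
move=> Z0; rewrite /smsum big_ltn_cond // smooth0 //= big_nat_cond big_pred0 ?addr0 //.
by move=> [|[|n]] //=; rewrite smooth0 // andbF.
Qed.

Hypothesis f1 : f 1%N = 1.

Lemma smsum_le_prod q Z : (forall p, prime p -> f p < 1) ->
  smsum f q Z <= \prod_(0 <= p < q.+1 | prime p) (1 - f p)^-1.
Proof.
move=> fp; elim: q Z => [|q IH] Z.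
  rewrite big_mkcond big_nat1 /=.
  case: Z => [|Z]; first by rewrite /smsum big_geq.
  by rewrite smsum0 // f1.
rewrite big_mkcond big_nat_recr //= -big_mkcond /=.
case: ifPn => pq; last by rewrite mulr1 smsum_nprime.
have h := fp _ pq.
rewrite ler_pdivlMr ?subr_gt0 // mulrBr mulr1 lerBlDr.
rewrite {1}smsum_prime //; apply: lerD => //.
by rewrite mulrC; apply: ler_wpM2r => //; apply: smsum_le; exact: leq_div.
Qed.

(** Multiplied out, the product runs over the smooth n whose exponent at each p is at most [E p],
    and all of these are at most Z. *)
Lemma smsum_ge_prod (E : nat -> nat) q Z :
  (\prod_(0 <= p < q.+1 | prime p) p ^ E p <= Z)%N ->
  \prod_(0 <= p < q.+1 | prime p) (\sum_(0 <= e < (E p).+1) f p ^+ e) <= smsum f q Z.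
Proof.
elim: q Z => [|q IH] Z.
  rewrite big_mkcond big_nat1 /= => Z0.
  by rewrite big_mkcond big_nat1 /= smsum0 // f1.
rewrite big_mkcond big_nat_recr //= -big_mkcond /=.
rewrite [X in _ -> X <= _]big_mkcond big_nat_recr //= -big_mkcond /=.
case: ifPn => pq; last by rewrite !mulr1 muln1 smsum_nprime //; exact: IH.
set N := (\prod_(_ <= _ < _ | _) _)%N; move=> NZ.
apply: le_trans (smsum_le _ NZ).
have sN := IH N (leqnn N).
elim: (E q.+1) => [|e IHe].
  by rewrite big_nat1 !mulr1 muln1 smsum_prime // ler_wpDr // mulr_ge0 // smsum_ge0.
rewrite big_nat_recl //= expr0 mulrDr mulr1 smsum_prime //.
apply: lerD.
  by apply: le_trans sN _; apply: smsum_le; rewrite leq_pmulr // expn_gt0.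
rewrite expnS mulnCA mulKn //.
rewrite [X in _ * X](eq_bigr (fun i => f q.+1 * f q.+1 ^+ i)) => [|i _]; last by rewrite exprS.
by rewrite -mulr_sumr mulrCA ler_wpM2l.
Qed.

End Smooth.

(** * Mertens' third theorem *)

Section Mertens3.
Variable R : realType.
Implicit Types (x t u e : R).

Definition harm (m : nat) : R := \sum_(0 <= i < m) i.+1%:R^-1.

Lemma harm_ge0 m : 0 <= harm m.
Proof. by apply: sumr_ge0 => i _; rewrite invr_ge0. Qed.

Lemma ln_le_harm m : ln m.+1%:R <= harm m.
Proof.
elim: m => [|m IH]; first by rewrite ln1 /harm big_geq.
rewrite /harm big_nat_recr //= -/(harm m).
have h := @ln_sub_le R m.+2%:R m.+1%:R (ltr0Sn _ _) (ltr0Sn _ _).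
have : (m.+2%:R - m.+1%:R) / m.+1%:R = m.+1%:R^-1 :> R.
  by rewrite -natrB // subSnn mul1r.
move=> E; rewrite E lerBlDl in h.
by apply: le_trans h _; rewrite lerD2r.
Qed.

(** The sequence harm m - ln m decreases to its limit, hence stays above it. *)
Lemma euler_gamma_le m : (0 < m)%N -> euler_gamma R + ln m%:R <= harm m.
Proof.
pose u n := series (@harmonic R) n - ln n%:R.
have uE n : u n = harm n - ln n%:R by rewrite /u /series /harm /=.
pose v n := u n.+1.
(* The shift to [v] removes the index 0, where ln 0 = 0 breaks monotonicity. *)
have vdec : nonincreasing_seq v.
  apply/nonincreasing_seqP => n; rewrite /v !uE.
  have -> : harm n.+2 = harm n.+1 + n.+2%:R^-1 by rewrite /harm big_nat_recr.
  have h := @ln_concave_step R n.+1%:R n.+2%:R (ltr0Sn _ _) (ltr0Sn _ _).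
  have E : (n.+2%:R - n.+1%:R) / n.+2%:R = n.+2%:R^-1 :> R.
    by rewrite -natrB // subSnn mul1r.
  rewrite E in h.
  move: h; set a := ln _; set b := ln _; set c := _^-1; set d := harm _; lra.
have vge n : 0 <= v n.
  rewrite /v uE subr_ge0; apply: le_trans (ln_le_harm n.+1).
  by rewrite ler_ln ?posrE ?ltr0n // ler_nat.
have vcv : cvgn v.
  by apply: nonincreasing_is_cvgn => //; exists 0 => _ [n _ <-].
have limE : euler_gamma R = limn v.
  apply: cvg_lim => //.
  by rewrite -cvg_shiftS.
case: m => // m _.
have := nonincreasing_cvgn_ge vdec vcv m.
by rewrite -limE /v uE lerBrDr.
Qed.

Definition neglog_prod n : R := \sum_(0 <= p < n.+1 | prime p) - ln (1 - p%:R^-1 : R).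

Lemma ln1_inv_bounds p : prime p ->
  0 <= - ln (1 - p%:R^-1 : R) <= (p%:R - 1)^-1.
Proof.
move=> pp; have p1 : 1 < p%:R :> R by rewrite ltr1n prime_gt1.
have q0 : 0 < p%:R^-1 :> R by rewrite invr_gt0; lra.
have q1 : p%:R^-1 < 1 :> R by rewrite invf_lt1; lra.
apply/andP; split; first by rewrite oppr_ge0 ln_le0 //; lra.
have := @ln_sub_le R 1 (1 - p%:R^-1) ltr01; rewrite ln1 sub0r.
have -> : (1 - (1 - p%:R^-1)) / (1 - p%:R^-1) = (p%:R - 1 : R)^-1.
  by field; rewrite !gt_eqF //; lra.
by apply; lra.
Qed.

Lemma neglog_prod_incr (y z : nat) : (2 <= y)%N -> (y <= z)%N ->
  neglog_prod z - neglog_prod y <= ln (ln z%:R) - ln (ln y%:R) + 7 / ln y%:R.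
Proof.
move=> y2 yz; apply: le_trans (sum_inv_primes_ln_le _ y2 yz).
rewrite /neglog_prod (@big_cat_nat _ _ _ y.+1 0 z.+1) //= addrAC subrr add0r.
by apply: ler_sum => p /ln1_inv_bounds/andP[].
Qed.

(** Concavity of ln on [1 - u, 1]. With t = p ^ (- e) and u = 1 / p it compares the Euler factor at
    1 + e with a weighted Euler factor at 1. *)
Lemma ln_bernoulli t u : 0 <= t <= 1 -> 0 <= u < 1 ->
  - ln (1 - t * u) <= t * - ln (1 - u).
Proof.
move=> /andP[t0 t1] /andP[u0 u1].
have a0 : 0 < 1 - u by lra.
have := @concave_ln _ (Itv01 t0 t1) _ _ a0 ltr01.
rewrite !convRE /= ln1 mulr0 addr0 mulr1.
have -> : t * (1 - u) + (1 - t) = 1 - t * u by ring.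
by rewrite mulrN lerN2.
Qed.

(** The bracket telescopes to the power of [expR (- e)] whose exponent is a rounded up, and rounding
    costs at most the factor [expR e]. Keeping it as a sum over m allows a later exchange that
    leaves sums over the primes up to exp m. *)
Lemma bucket_bound e a K : 0 <= e -> 0 <= a -> a <= K%:R ->
  expR (- (e * a)) <= expR e *
   (\sum_(0 <= m < K | a <= m%:R) (expR (- e) ^+ m - expR (- e) ^+ m.+1) + expR (- e) ^+ K).
Proof.
move=> e0 a0; set x := expR (- e).
have xE m : x ^+ m = expR (- (e * m%:R)) by rewrite /x -expRM_natr mulNr.
have x1 m : 0 <= x ^+ m - x ^+ m.+1.
  by rewrite !xE subr_ge0 ler_expR lerN2 ler_wpM2l // ler_nat.
elim: K => [|K IH] aK.
  rewrite big_geq // add0r expr0 mulr1 ler_expR.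
  by have := mulr_ge0 e0 a0; lra.
case: (lerP a K%:R) => [aK'|Ka].
  apply: le_trans (IH aK') _; rewrite [in leRHS]big_mkcond big_nat_recr //= -big_mkcond /=.
  by rewrite aK' -addrA subrK.
apply: le_trans (_ : _ <= expR e * x ^+ K.+1) _.
  rewrite xE -expRD ler_expR -[in leRHS]natr1 mulrDr mulr1 opprD addrCA subrr addr0.
  by rewrite lerN2 ler_wpM2l // ltW.
rewrite ler_wpM2l ?expR_ge0 // lerDr; apply: sumr_ge0 => m _; exact: x1.
Qed.

(** Each term dominates the integral of t ^ (- 1 - e) over [n, n + 1], and these integrals
    telescope. *)
Lemma sum_zeta_ge e (Z : nat) : 0 < e ->
  1 - Z.+1%:R `^ (- e) <= e * \sum_(1 <= n < Z.+1) n%:R `^ (- (1 + e)).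
Proof.
move=> e0; elim: Z => [|Z IH].
  by rewrite powR1 subrr big_geq // mulr0.
rewrite big_nat_recr //= mulrDr.
apply: (le_trans _ (lerD IH (lexx _))).
set n : R := Z.+1%:R.
have n0 : 0 < n by rewrite /n ltr0Sn.
have -> : Z.+2%:R = n + 1 :> R by rewrite /n natr1.
suff : n `^ (- e) - (n + 1) `^ (- e) <= e * n `^ (- (1 + e)).
  by move: (n `^ _) ((n + 1) `^ _) (e * _) => a b c; lra.
have -> : n `^ (- (1 + e)) = n `^ (- e) / n.
  rewrite opprD addrC powRD; last by rewrite (gt_eqF n0) implybT.
  by rewrite powR_inv1 // ltW.
have -> : (n + 1) `^ (- e) = n `^ (- e) * (1 + n^-1) `^ (- e).
  rewrite -powRM ?ltW // ?addr_gt0 ?invr_gt0 //.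
  by rewrite mulrDr mulr1 mulfV // gt_eqF.
have h : 1 - e / n <= (1 + n^-1) `^ (- e).
  rewrite /powR gt_eqF ?addr_gt0 ?invr_gt0 //.
  apply: le_trans (expR_ge1Dx _); rewrite mulNr lerD2l lerN2 ler_pM2l //.
  by apply: le_ln1Dx; apply: lt_trans (_ : 0 < _); rewrite ?invr_gt0 ?ltrN10.
have p0 : 0 < n `^ (- e) by rewrite powR_gt0.
rewrite mulrCA.
suff : n `^ (- e) * (1 - (1 + n^-1) `^ (- e)) <= n `^ (- e) * (e / n) by rewrite mulrBr mulr1.
by rewrite ler_pM2l // lerBlDr addrC -lerBlDr.
Qed.

(** Every n <= Z is Z-smooth, so the truncated zeta sum at 1 + e is at most the Euler product over p
    <= Z; [ln_bernoulli] then moves each factor to the point 1. *)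
Lemma euler_prod_ge e (Z : nat) : 0 < e -> Z.+1%:R `^ (- e) < 1 ->
  ln ((1 - Z.+1%:R `^ (- e)) / e) <=
   \sum_(0 <= p < Z.+1 | prime p) expR (- (e * ln p%:R)) * - ln (1 - p%:R^-1).
Proof.
move=> e0 h.
pose f (n : nat) : R := n%:R `^ (- (1 + e)).
have fM m n : (0 < m)%N -> (0 < n)%N -> f (m * n)%N = f m * f n.
  by move=> _ _; rewrite /f natrM powRM.
have f0 n : 0 <= f n by rewrite powR_ge0.
have f1 : f 1%N = 1 by rewrite /f powR1.
have fE p : prime p -> f p = expR (- (e * ln p%:R)) * p%:R^-1.
  move=> pp; rewrite /f opprD addrC powRD; last first.
    by rewrite pnatr_eq0 -lt0n prime_gt0 ?implybT.
  rewrite powR_inv1 ?ler0n // /powR pnatr_eq0 gtn_eqF ?prime_gt0 // mulNr //.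
have ep p : prime p -> 0 <= expR (- (e * ln p%:R)) <= 1.
  move=> pp; rewrite expR_ge0 expR_le1 oppr_le0 mulr_ge0 ?(ltW e0) //.
  by rewrite ltW // ln_prime_gt0.
have ip p : prime p -> 0 <= (p%:R^-1 : R) < 1.
  by move=> pp; rewrite invr_ge0 ler0n invf_lt1 ?ltr0n ?ltr1n ?prime_gt0 ?prime_gt1.
have fp p : prime p -> f p < 1.
  move=> pp; rewrite fE //; have /andP[a b] := ep _ pp; have /andP[c d] := ip _ pp.
  by apply: le_lt_trans d; rewrite -[leRHS]mul1r ler_wpM2r.
have H := smsum_le_prod fM f0 f1 Z Z fp.
have H2 : (1 - Z.+1%:R `^ (- e)) / e <= \prod_(0 <= p < Z.+1 | prime p) (1 - f p)^-1.
  apply: le_trans H; rewrite ler_pdivrMr // mulrC.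
  apply: le_trans (sum_zeta_ge Z e0) _; rewrite ler_pM2l //.
  rewrite le_eqVlt; apply/orP; left; apply/eqP; rewrite /smsum big_mkcond /= [RHS]big_mkcond /=.
  by apply: eq_big_nat => n nZ; rewrite smooth_self.
apply: le_trans (_ : _ <= ln (\prod_(0 <= p < Z.+1 | prime p) (1 - f p)^-1)) _.
  have a0 : 0 < (1 - Z.+1%:R `^ (- e)) / e by rewrite divr_gt0 ?subr_gt0.
  by rewrite ler_ln ?posrE //; apply: lt_le_trans H2.
rewrite ln_prod; last by move=> p pp; rewrite invr_gt0 subr_gt0 fp.
apply: ler_sum => p pp; rewrite lnV ?posrE ?subr_gt0 ?fp // fE //.
exact: ln_bernoulli (ep _ pp) (ip _ pp).
Qed.

(** Summation by parts turns the left side into a partial Taylor sum of - ln (1 - x). That this is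
    at most - ln (1 - x) follows because the sum of ln (1 - y) and the Taylor polynomial is
    nonincreasing in y. *)
Lemma harm_sum_le x K : 0 <= x < 1 ->
  \sum_(0 <= m < K) (x ^+ m - x ^+ m.+1) * harm m + x ^+ K * harm K <= - ln (1 - x).
Proof.
case/andP=> x0 x1.
have -> : \sum_(0 <= m < K) (x ^+ m - x ^+ m.+1) * harm m + x ^+ K * harm K =
   \sum_(0 <= i < K) x ^+ i.+1 / i.+1%:R.
  elim: K => [|K IH]; first by rewrite !big_geq // /harm big_geq // mulr0 addr0.
  rewrite !big_nat_recr //= -IH /harm big_nat_recr //= -/(harm K).
  by ring.
pose p : {poly R} := \sum_(0 <= i < K) (i.+1%:R^-1)%:P * 'X^(i.+1).
have pE y : p.[y] = \sum_(0 <= i < K) y ^+ i.+1 / i.+1%:R.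
  rewrite /p horner_sum; apply: eq_bigr => i _.
  by rewrite hornerM hornerC hornerXn mulrC.
have dpE y : p^`().[y] = \sum_(0 <= i < K) y ^+ i.
  rewrite /p raddf_sum /= horner_sum; apply: eq_bigr => i _.
  rewrite derivM derivC mul0r add0r derivXn /= hornerM hornerC hornerMn hornerXn.
  by rewrite mulrnAr -mulrnAl -[_^-1 *+ _]mulr_natr mulVf ?pnatr_eq0 // mul1r.
have geo (y : R) : 0 <= y < 1 -> \sum_(0 <= i < K) y ^+ i <= (1 - y)^-1.
  case/andP=> y0 y1; have y1' : 0 < 1 - y by rewrite subr_gt0.
  rewrite -[(1 - y)^-1]mul1r ler_pdivlMr // big_mkord mulrC.
  rewrite -[leLHS]opprK -mulNr opprB -subrX1 opprB.
  by rewrite lerBlDr lerDl exprn_ge0.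
pose f (y : R) := ln (1 - y) + p.[y].
have df (y : R) : 0 <= y < 1 -> is_derive y 1 f (- (1 - y)^-1 + p^`().[y]).
  case/andP=> y0 y1; have y1' : 0 < 1 - y by rewrite subr_gt0.
  have h1 := is_derive1_ln y1'.
  have h2 : is_derive y 1 ((cst 1 : R -> R) - id) (0 - 1).
    by apply: is_deriveB; exact: is_derive_cst.
  have h3 : is_derive y 1 (@ln R \o ((cst 1 : R -> R) - id)) ((1 - y)^-1 * (0 - 1)).
    exact: is_derive1_comp.
  have := is_deriveD h3 (is_derive_poly p y).
  by rewrite sub0r mulrN1.
have dfx (y : R) : 0 <= y < 1 -> derivable f y 1.
  by move=> /df h; apply: ex_derive.
have : f x <= f 0.
  apply: (@ler0_derive1_nincr R f 0 x) => //.
  - by move=> y; rewrite in_itv /= => /andP[a b]; apply: dfx; rewrite (ltW a) (lt_trans b).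
  - move=> y; rewrite in_itv /= => /andP[a b].
    have yy : 0 <= y < 1 by rewrite (ltW a) (lt_trans b).
    have h := df _ yy; rewrite derive1E derive_val addrC subr_le0 dpE; exact: geo.
  - apply: derivable_within_continuous => y; rewrite in_itv /= => /andP[a b]; apply: dfx.
    by rewrite a (le_lt_trans b).
rewrite /f !pE subr0 ln1 add0r [in leRHS]big1 => [|i _]; last by rewrite expr0n mul0r.
by rewrite addrC -lerBrDr sub0r.
Qed.


Lemma neglog_prod_le m n : (m <= n)%N -> neglog_prod m <= neglog_prod n.
Proof.
move=> mn; rewrite /neglog_prod (@big_cat_nat _ _ _ m.+1 0 n.+1) //= lerDl.
by apply: sumr_ge0 => p /ln1_inv_bounds/andP[].
Qed.

Lemma ln_le_truncn (p m : nat) : (0 < p)%N ->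
  (ln p%:R <= m%:R :> R) = (p <= Num.truncn (expR m%:R : R))%N.
Proof.
move=> p0; rewrite truncn_ge_nat ?expR_ge0 //.
by rewrite -ler_expR lnK // posrE ltr0n.
Qed.

Lemma neglog_prod_truncn (m K : nat) : (m <= K)%N ->
  neglog_prod (Num.truncn (expR m%:R : R)) =
  \sum_(0 <= p < (Num.truncn (expR K%:R : R)).+1 | prime p && (ln p%:R <= m%:R :> R)) - ln (1 - p%:R^-1 : R).
Proof.
move=> mK; rewrite /neglog_prod (@big_nat_widen _ _ _ _ _ (Num.truncn (expR K%:R : R)).+1); last first.
  rewrite ltnS truncn_ge_nat ?expR_ge0 //.
  apply: le_trans (_ : _ <= expR m%:R) _; first by rewrite truncn_le expR_ge0.
  by rewrite ler_expR ler_nat.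
apply: eq_bigl => p; case: (boolP (prime p)) => //= pp.
by rewrite ln_le_truncn ?prime_gt0 // ltnS.
Qed.

(* The hypothesis on neglog_prod is integrated against the Laplace kernel in the variable ln p; the same kernel
   integrates harm to - ln (1 - exp (- e)), which is where the Euler constant enters. *)
Lemma laplace_bound eta c e (z0 m0 K : nat) : 0 <= eta -> 0 < e -> e <= 2^-1 -> 0 <= c ->
  (z0 <= m0)%N -> (2 <= m0)%N -> (m0 <= K)%N -> expR (- e) ^+ K <= e ->
  (forall z, (z0 <= z)%N -> neglog_prod z <= ln (ln z%:R) + euler_gamma R - eta) ->
  neglog_prod (Num.truncn (expR m0%:R : R)) + eta <= c ->
  eta <= 2 * e * - ln e + e * (4 + 2 * (c * m0%:R)).
Proof.
move=> eta0 e0 e1 c0 zm0 m02 m0K; set x := expR (- e) => xK hyp hc.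
have xE m : x ^+ m = expR (- (e * m%:R)) by rewrite /x -expRM_natr mulNr.
have x0 : 0 < x by exact: expR_gt0.
have x1 : x < 1 by rewrite expR_lt1; lra.
have dx m : 0 <= x ^+ m - x ^+ m.+1.
  by rewrite exprS subr_ge0 -[leRHS]mul1r ler_wpM2r ?exprn_ge0 ?ltW.
(* [Z.+1] exceeds exp K, so the truncation error of the zeta sum is at most [x ^+ K], hence at most
   [e]. *)
pose Z := Num.truncn (expR K%:R : R).
have Zpow : Z.+1%:R `^ (- e) <= x ^+ K.
  rewrite xE /powR pnatr_eq0 /= ler_expR mulNr lerN2 ler_pM2l //.
  rewrite -ler_expR lnK ?posrE ?ltr0Sn // ltW //; exact: truncnS_gt.
have Tge m : (m.+1 <= Num.truncn (expR m%:R : R))%N.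
  rewrite truncn_ge_nat ?expR_ge0 //; apply: le_trans (expR_ge1Dx _).
  by rewrite addrC natr1.
pose w (p : nat) : R := - ln (1 - p%:R^-1).
have w0 p : prime p -> 0 <= w p by move=> /ln1_inv_bounds/andP[].
pose Pi (m : nat) : R := \sum_(0 <= p < Z.+1 | prime p && (ln p%:R <= m%:R :> R)) w p.
have PiE m : (m <= K)%N -> Pi m = neglog_prod (Num.truncn (expR m%:R : R)).
  by move=> mK; rewrite (neglog_prod_truncn mK).
(* At exp m the hypothesis reads ln m + gamma - eta, and ln m + gamma <= harm m by [euler_gamma_le].
   The finitely many m < m0 get the crude bound [c]. *)
have Pib m : (m <= K)%N -> Pi m <= harm m - eta + (if (m < m0)%N then c else 0).
  move=> mK; rewrite PiE //; case: ltnP => mm0.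
    have h : neglog_prod (Num.truncn (expR m%:R : R)) <= neglog_prod (Num.truncn (expR m0%:R : R)).
      by apply: neglog_prod_le; apply: le_truncn; rewrite ler_expR ler_nat ltnW.
    by have := harm_ge0 m; lra.
  set T := Num.truncn _.
  have Tm : (m.+1 <= T)%N by exact: Tge.
  rewrite addr0; apply: le_trans (hyp T _) _.
    by apply: leq_trans zm0 _; apply: leq_trans mm0 _; exact: ltnW.
  rewrite lerD2r; have m1 : (0 < m)%N by apply: leq_trans mm0; apply: ltnW.
  apply: le_trans (_ : _ <= euler_gamma R + ln m%:R) (euler_gamma_le m1).
  rewrite addrC lerD2l ler_ln ?posrE ?ltr0n //; last first.
    by rewrite ln_gt0 // ltr1n; apply: leq_trans Tm; rewrite ltnS.
  rewrite ln_le_truncn //; exact: leq_trans Tm.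
have H : ln ((1 - e) / e) <= expR e *
   (\sum_(0 <= m < K) (x ^+ m - x ^+ m.+1) * Pi m + x ^+ K * Pi K).
  have ze : Z.+1%:R `^ (- e) <= e by exact: le_trans xK.
  apply: le_trans (_ : _ <= ln ((1 - Z.+1%:R `^ (- e)) / e)) _.
    rewrite ler_ln ?posrE ?divr_gt0 ?ler_pM2r ?invr_gt0 //; lra.
  apply: le_trans (euler_prod_ge e0 _) _; first by lra.
  apply: (@le_trans _ _ (\sum_(0 <= p < Z.+1 | prime p) expR e *
     (\sum_(0 <= m < K | ln p%:R <= m%:R :> R) (x ^+ m - x ^+ m.+1) + x ^+ K) * w p)).
    rewrite big_nat_cond [in leRHS]big_nat_cond.
    apply: ler_sum => p /andP[/andP[_ pZ] pp].
    apply: ler_wpM2r; first exact: w0.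
    apply: bucket_bound; [exact: ltW|by rewrite ltW // ln_prime_gt0|].
    by rewrite ln_le_truncn ?prime_gt0.
  rewrite (eq_bigr (fun p => expR e * ((\sum_(0 <= m < K | ln p%:R <= m%:R :> R)
      (x ^+ m - x ^+ m.+1) + x ^+ K) * w p))); last by move=> p _; rewrite mulrA.
  rewrite -mulr_sumr ler_pM2l ?expR_gt0 //.
  under eq_bigr do rewrite mulrDl.
  rewrite big_split /=; apply: lerD; last first.
    rewrite -mulr_sumr ler_pM2l ?exprn_gt0 // le_eqVlt; apply/orP; left; apply/eqP.
    rewrite /Pi big_nat_cond [RHS]big_nat_cond; apply: eq_bigl => p.
    case: (boolP (prime p)) => pp; last by rewrite !andbF.
    by rewrite /= andbT ln_le_truncn ?prime_gt0 //= -/Z -ltnS andbb.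
  under eq_bigr => p pp do rewrite mulr_suml big_mkcond.
  rewrite exchange_big /=; apply: ler_sum => m _.
  rewrite /Pi mulr_sumr -big_mkcondr; exact: lexx.
have H2 : \sum_(0 <= m < K) (x ^+ m - x ^+ m.+1) * Pi m + x ^+ K * Pi K <=
   - ln (1 - x) - eta + c * (1 - x ^+ m0).
  have x01 : 0 <= x < 1 by rewrite ltW.
  apply: (@le_trans _ _ (\sum_(0 <= m < K) (x ^+ m - x ^+ m.+1) *
     (harm m - eta + (if (m < m0)%N then c else 0)) + x ^+ K * (harm K - eta))).
    apply: lerD.
      by apply: ler_sum_nat => m /andP[_ mK]; apply: ler_wpM2l => //; apply: Pib; exact: ltnW.
    apply: ler_wpM2l; first by rewrite exprn_ge0 ?ltW.
    apply: le_trans (Pib K (leqnn K)) _.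
    by rewrite ltnNge m0K addr0.
  have -> : \sum_(0 <= m < K) (x ^+ m - x ^+ m.+1) *
     (harm m - eta + (if (m < m0)%N then c else 0)) =
     \sum_(0 <= m < K) (x ^+ m - x ^+ m.+1) * harm m - (1 - x ^+ K) * eta + c * (1 - x ^+ m0).
    have tel j n : (j <= n)%N -> \sum_(j <= m < n) (x ^+ m - x ^+ m.+1) = x ^+ j - x ^+ n.
      move=> jn; rewrite (@telescope_sumr_eq _ _ _ (fun i => - x ^+ i)) //; first by ring.
      by move=> i _; ring.
    have -> : (1 - x ^+ K) * eta = \sum_(0 <= m < K) (x ^+ m - x ^+ m.+1) * eta.
      by rewrite -mulr_suml tel.
    have -> : c * (1 - x ^+ m0) =
      \sum_(0 <= m < K) (x ^+ m - x ^+ m.+1) * (if (m < m0)%N then c else 0).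
      rewrite (@big_cat_nat _ _ _ m0 0 K) //= [\sum_(m0 <= _ < K) _]big1_seq ?addr0; last first.
        by move=> m; rewrite mem_index_iota => /andP[_ /andP[h _]]; rewrite ltnNge h mulr0.
      rewrite mulrC -[1](expr0 x) -(tel 0%N m0) // mulr_suml.
      by apply: eq_big_nat => m /andP[_ ->].
    rewrite -sumrB -big_split /=; apply: eq_bigr => m _; ring.
  have := harm_sum_le K x01; set S := \sum_(_ <= _ < _) _; set X := x ^+ K; set h := harm K.
  by move: (ln _) (c * _) => l d; lra.
have lnx : - ln (1 - x) <= - ln e + e.
  have : ln (e * x) <= ln (1 - x).
    rewrite ler_ln ?posrE ?mulr_gt0 ?subr_gt0 //.
    have : (1 + e) * x <= expR e * expR (- e).
      by rewrite ler_wpM2r ?expR_ge0 // expR_ge1Dx.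
    by rewrite expRxMexpNx_1; lra.
  by rewrite lnM ?posrE // /x expRK -/x; lra.
have xm0 : 1 - x ^+ m0 <= e * m0%:R.
  by have := expR_ge1Dx (- (e * m0%:R)); rewrite xE; lra.
have lne : - 2 * e <= ln (1 - e).
  have := @ln_sub_le R 1 (1 - e) ltr01; rewrite ln1 sub0r => h.
  have : (1 - (1 - e)) / (1 - e) <= 2 * e by rewrite ler_pdivrMr; nra.
  by have := h _; lra.
have e2 : expR e <= 1 + 2 * e.
  have : (1 + 2 * e) * (1 - e) >= 1 by nra.
  have := expR_ge1Dx (- e); rewrite -/x => h1 h2.
  have : 1 <= (1 + 2 * e) * x by nra.
  rewrite -ler_pdivrMr // div1r /x expRN invrK //.
have e3 : 1 <= expR e by have := expR_ge1Dx e; lra.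
have L0 : 0 <= - ln e by rewrite oppr_ge0 ln_le0; lra.
(* The leading term [- ln e] appears on both sides, so that what survives bounds [eta] by a multiple
   of [e * - ln e] and [e]. *)
have HB : - ln e - 2 * e <= expR e * (- ln e + e - eta + c * (e * m0%:R)).
  have : ln ((1 - e) / e) = ln (1 - e) - ln e by rewrite ln_div ?posrE //; lra.
  move=> E; rewrite E in H.
  apply: le_trans (_ : _ <= expR e * (- ln (1 - x) - eta + c * (1 - x ^+ m0))) _.
    apply: (@le_trans _ _ (ln (1 - e) - ln e)); first lra.
    by apply: le_trans H _; rewrite ler_pM2l ?expR_gt0.
  rewrite ler_pM2l ?expR_gt0 //; apply: lerD; first by lra.
  by rewrite ler_wpM2l.
have cm0 : 0 <= c * m0%:R by rewrite mulr_ge0.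
move: HB; rewrite mulrCA; set D := c * _ in cm0 *.
set L := - ln e in L0 *; set B := L + e - eta + e * D; set E := expR e in e2 e3 *.
move=> HB; case: (lerP 0 B) => B0.
  have : L - 2 * e <= (1 + 2 * e) * B by apply: le_trans HB _; rewrite ler_wpM2r.
  rewrite /B; nra.
have : L - 2 * e <= B.
  by apply: le_trans HB _; rewrite -[leRHS]mul1r ler_wnM2r // ltW.
rewrite /B; nra.
Qed.

End Mertens3.

Section MertensLower.
Variable R : realType.

(** A shortfall [eta] at y would persist at all z >= y by [neglog_prod_incr], up to the allowance 7
    / ln y; [laplace_bound] with e tending to 0 then contradicts [eta > 0]. *)
Lemma mertens3_lower (y : nat) : (2 <= y)%N ->
  ln (ln y%:R) + euler_gamma R - 7 / ln y%:R <= neglog_prod R y.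
Proof.
move=> y2; rewrite leNgt; apply/negP => hlt.
set eta := ln (ln y%:R) + euler_gamma R - 7 / ln y%:R - neglog_prod R y.
have eta0 : 0 < eta by rewrite /eta subr_gt0.
have hyp z : (y <= z)%N -> neglog_prod R z <= ln (ln z%:R) + euler_gamma R - eta.
  move=> yz; have := neglog_prod_incr R y2 yz; rewrite /eta.
  by move: (7 / _) => q; lra.
pose c := neglog_prod R (Num.truncn (expR y%:R : R)) + eta.
have c0 : 0 <= c.
  rewrite addr_ge0 ?(ltW eta0) //.
  by apply: sumr_ge0 => p /(ln1_inv_bounds R)/andP[].
pose D := c * y%:R; have D0 : 0 <= D by rewrite mulr_ge0.
(* With e = d ^ 2, d ln (1 / d) <= 1 and d <= 1 / 2, the bound of [laplace_bound] is at most 4 d + d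
   (2 + D) = d (6 + D), and this [den] makes it smaller than [eta]. *)
pose den := 2 * (6 + D) + 2 * eta; have den0 : 0 < den by rewrite /den; lra.
pose d := eta / den; have d0 : 0 < d by rewrite divr_gt0.
have dden : d * den = eta by rewrite /d mulfVK // gt_eqF.
have d1 : d <= 2^-1 by rewrite /d ler_pdivrMr // /den; lra.
have d2 : d * (6 + D) < eta.
  by have := mulr_gt0 d0 eta0; move: dden; rewrite /den; lra.
pose e := d ^+ 2; have e0 : 0 < e by rewrite exprn_gt0.
have ed : e <= d / 2 by rewrite /e expr2 ler_pM2l.
have e1 : e <= 2^-1 by lra.
pose K := maxn y (Num.truncn (- ln e / e)).+1.
have xK : expR (- e) ^+ K <= e.
  rewrite -expRM_natr -[leRHS]lnK ?posrE // ler_expR mulNr lerNl.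
  have : (Num.truncn (- ln e / e)).+1%:R <= K%:R :> R by rewrite ler_nat leq_maxr.
  have := truncnS_gt (- ln e / e); set k : R := _%:R => h1 h2.
  rewrite mulrC -ler_pdivrMr //; apply: le_trans h2; exact: ltW.
have := @laplace_bound R eta c e y y K (ltW eta0) e0 e1 c0 (leqnn y) y2 (leq_maxl _ _) xK hyp (lexx _).
rewrite -/D => {xK K} H.
have hl : d * - ln e <= 2.
  have := ln_sublinear (_ : 0 < d^-1); rewrite invr_gt0 => /(_ d0).
  rewrite lnV ?posrE // => h.
  have : d * - ln d <= d * d^-1 by rewrite ler_pM2l // ltW.
  by rewrite mulfV ?gt_eqF // /e lnXn // mulr2n; lra.
have h2 : e * - ln e <= d * 2.
  by rewrite /e expr2 -mulrA ler_pM2l.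
have h3 : e * (4 + 2 * D) <= d / 2 * (4 + 2 * D) by rewrite ler_wpM2r //; lra.
move: H h2 h3 d2; clear -d0; move: (ln e) => u; clearbody e d D eta; lra.
Qed.

End MertensLower.

(** * The main term: reciprocals of smooth numbers prime to l *)

Section MainTerm.
Variable R : realType.

Definition cop_inv (l n : nat) : R := if coprime n l then n%:R^-1 else 0.

Lemma cop_invM l m n : cop_inv l (m * n) = cop_inv l m * cop_inv l n.
Proof.
rewrite /cop_inv coprimeMl; case: (coprime m l) => /=; last by rewrite mul0r.
by case: (coprime n l); rewrite ?mulr0 // natrM invfM.
Qed.

Lemma cop_inv_ge0 l n : 0 <= cop_inv l n.
Proof. by rewrite /cop_inv; case: ifP => // _; rewrite invr_ge0. Qed.

Lemma totient_prod l : (0 < l)%N ->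
  (totient l)%:R / l%:R = \prod_(0 <= p < l.+1 | prime p && (p %| l)%N) (1 - p%:R^-1) :> R.
Proof.
move=> l0.
have E1 : (totient l)%:R = \prod_(p <- primes l) ((p.-1)%:R * p%:R ^+ (logn p l).-1) :> R.
  rewrite totientE // natr_prod; apply: eq_bigr => p _.
  by rewrite natrM natrX.
have E2 : l%:R = \prod_(p <- primes l) p%:R ^+ (logn p l) :> R.
  rewrite {1}(prod_prime_decomp l0) prime_decompE big_map natr_prod.
  by apply: eq_bigr => p _; rewrite natrX.
rewrite E1 [in X in _ / X]E2 -prodf_div.
rewrite -[RHS]big_filter.
rewrite [RHS](perm_big (primes l)); last first.
  apply: uniq_perm; [exact: filter_uniq (iota_uniq _ _)|exact: primes_uniq|].
  move=> p; rewrite mem_filter mem_primes mem_index_iota l0 /=.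
  case: (boolP (prime p)) => //= pp; case: (boolP (p %| l)%N) => //= pl.
  by rewrite ltnS dvdn_leq.
apply: eq_big_seq => p; rewrite mem_primes => /and3P[pp _ pl].
have p0 : p%:R != 0 :> R by rewrite pnatr_eq0 -lt0n prime_gt0.
have : (0 < logn p l)%N by rewrite logn_gt0 mem_primes pp l0.
case: (logn p l) => // k _ /=; rewrite exprS -subn1 natrB ?prime_gt0 //.
by field; rewrite p0 expf_neq0.
Qed.

Lemma prod_one_sub_ge (I : Type) (r : seq I) (P : pred I) (a : I -> R) :
  (forall i, P i -> 0 <= a i <= 1) ->
  1 - \sum_(i <- r | P i) a i <= \prod_(i <- r | P i) (1 - a i).
Proof.
move=> a01; suff : 1 - \sum_(i <- r | P i) a i <= \prod_(i <- r | P i) (1 - a i) /\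
   0 <= \prod_(i <- r | P i) (1 - a i) <= 1 by case.
elim: r => [|i r [IH1 /andP[IH2 IH3]]]; first by rewrite !big_nil subr0 lexx ler01.
rewrite !big_cons; case: ifP => Pi; last by rewrite IH1 IH2 IH3.
have /andP[] := a01 _ Pi; move: IH1 IH2 IH3.
move: (\sum_(_ <- _ | _) _) (\prod_(_ <- _ | _) _) (a i) => S Q b.
by split; [nra|apply/andP; split; nra].
Qed.

Lemma sum_inv_sq_le (z n : nat) : (0 < z)%N ->
  \sum_(z.+1 <= p < n) p%:R ^- 2 <= z%:R^-1 :> R.
Proof.
move=> z0; case: (leqP z.+1 n) => zn; last by rewrite big_geq ?invr_ge0 // ltnW.
suff : \sum_(z.+1 <= p < n) p%:R ^- 2 <= z%:R^-1 - n.-1%:R^-1 :> R.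
  by move=> h; apply: le_trans h _; rewrite lerBlDr lerDl invr_ge0.
elim: n zn => // n IH; rewrite leq_eqVlt => /orP[/eqP[<-]|zn].
  by rewrite big_geq // subrr.
rewrite big_nat_recr //=; apply: le_trans (lerD (IH zn) (lexx _)) _.
case: n zn {IH} => // n zn /=.
have n0 : 0 < n%:R :> R by rewrite ltr0n (leq_trans z0).
rewrite -natr1; set x : R := n%:R in n0 *.
have zR : 0 < z%:R :> R by rewrite ltr0n.
rewrite -subr_ge0 (_ : _ - _ = (x * (x + 1)^+2)^-1).
  by rewrite invr_ge0 mulr_ge0 ?exprn_ge0 //; lra.
by field; rewrite !gt_eqF //; lra.
Qed.

(** These are the relative errors in cutting the geometric series of 1 / p at exponent z + 1 for p
    <= z and at exponent 1 for larger p. The small primes contribute at most 2 ^- z, the large ones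
    at most 1 / z. *)
Lemma sum_pow_le (z y : nat) : (2 <= z)%N ->
  \sum_(0 <= p < y.+1 | prime p) p%:R ^- (if (p <= z)%N then z.+2 else 2) <= 2 / z%:R :> R.
Proof.
move=> z2; have z0 : (0 < z)%N by rewrite ltnW.
have Hs : \sum_(0 <= p < y.+1 | prime p && (p <= z)%N) p%:R ^- z.+2 <= z%:R^-1 :> R.
  apply: (@le_trans _ _ (\sum_(2 <= p < y.+1) (2 ^- z * p%:R ^- 2 : R))).
    case: y => [|y]; first by rewrite big_mkcond big_nat1 /= big_geq.
    rewrite big_ltn_cond // big_ltn_cond //= big_mkcond; apply: ler_sum_nat => p /andP[p2 _].
    case: ifP => _; last by rewrite mulr_ge0 // invr_ge0 exprn_ge0.
    have p0 : 0 < p%:R :> R by rewrite ltr0n; apply: leq_trans p2.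
    rewrite (_ : z.+2 = z + 2)%N; last by rewrite addn2.
    rewrite exprD invfM ler_wpM2r ?invr_ge0 ?exprn_ge0 ?(ltW p0) //.
    rewrite lef_pV2 ?posrE ?exprn_gt0 //; apply: lerXn2r; rewrite ?nnegrE ?(ltW p0) //.
    by rewrite ler_nat.
  rewrite -mulr_sumr -[leRHS]mulr1; apply: ler_pM.
  - by rewrite invr_ge0 exprn_ge0.
  - by apply: sumr_ge0 => i _; rewrite invr_ge0 exprn_ge0.
  - rewrite lef_pV2 ?posrE ?exprn_gt0 ?ltr0n // -natrX ler_nat.
    exact: ltnW (ltn_expl _ _).
  - by apply: le_trans (@sum_inv_sq_le 1 y.+1 _) _; rewrite // invr1.
rewrite (bigID (fun p => p <= z)%N) /= mulr_natl mulr2n; apply: lerD.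
  apply: le_trans Hs; rewrite le_eqVlt; apply/orP; left; apply/eqP.
  by apply: eq_bigr => p /andP[_ ->].
apply: le_trans (@sum_inv_sq_le z y.+1 z0).
rewrite [leRHS](@big_nat_widenl _ _ _ z.+1 0) //= big_mkcond [leRHS]big_mkcond.
apply: ler_sum => p _; case: (leqP p z) => pz; first by rewrite andbF.
by rewrite andbT; case: ifP => // _; rewrite invr_ge0 exprn_ge0.
Qed.

(** The largest integer with the exponents just described is the primorial of z ^ 2 times the z-th
    power of the primorial of z. Taking y = z ^ 2 balances the two factors. *)
Lemma prod_pow_le (z : nat) :
  (\prod_(0 <= p < (z ^ 2).+1 | prime p) p ^ (if (p <= z)%N then z.+1 else 1) <= 4 ^ (2 * z ^ 2))%N.
Proof.
have -> : (\prod_(0 <= p < (z ^ 2).+1 | prime p) p ^ (if (p <= z)%N then z.+1 else 1) =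
   primorial (z ^ 2) * primorial z ^ z)%N.
  rewrite (_ : primorial z ^ z = \prod_(0 <= p < (z ^ 2).+1 | prime p) (if (p <= z)%N then p ^ z else 1))%N.
    rewrite /primorial -big_split /=; apply: eq_bigr => p _.
    by case: ifP => _; rewrite ?muln1 ?expn1 // expnS.
  rewrite -big_mkcondr /= /primorial.
  rewrite (@big_nat_widen _ _ _ _ _ (z ^ 2).+1); last by rewrite ltnS; case: z => // z; rewrite -mulnn leq_pmulr.
  rewrite (big_morph (fun x => x ^ z)%N (id1 := 1%N) (op1 := muln)) ?exp1n // => x y.
  by rewrite expnMn.
rewrite mul2n -addnn expnD leq_mul ?primorial_le //.
rewrite -mulnn expnM; case: z => // z.
by rewrite leq_exp2r // primorial_le.
Qed.

(** The constant 11 is 7 + 4: 7 from the error 7 / ln y in [mertens3_lower], and 4 from (2 / z) ln y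
    = (4 / z) ln z <= 4. As l <= z ^ 2, every prime factor of l lies in the range of the product,
    which yields exactly phi(l) / l. *)
Lemma main_term (l z N : nat) : (0 < l)%N -> (l <= z ^ 2)%N -> (2 <= z)%N ->
  (4 ^ (2 * z ^ 2) <= N)%N ->
  (totient l)%:R / l%:R * expR (euler_gamma R) * (ln (z ^ 2)%:R - 11) <=
    smsum (cop_inv l) (z ^ 2) N.
Proof.
move=> l0 lz z2 zN; set y := (z ^ 2)%N in lz *.
have y2 : (2 <= y)%N by rewrite /y; apply: leq_trans (leq_pexp2l _ (leqnSn 1)); rewrite ?expn1 // ltnW.
have H := smsum_ge_prod (fun m n _ _ => @cop_invM l m n) (@cop_inv_ge0 l) _
  (leq_trans (prod_pow_le z) zN).
apply: le_trans (H _); last by rewrite /cop_inv /coprime gcd1n invr1.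
pose a (p : nat) : R := p%:R ^- (if (p <= z)%N then z.+2 else 2).
have step p : prime p ->
  (1 - p%:R^-1)^-1 * (if (p %| l)%N then 1 - p%:R^-1 else 1) * (1 - a p) <=
  \sum_(0 <= e < (if (p <= z)%N then z.+1 else 1).+1) cop_inv l p ^+ e.
  move=> pp; have p0 : 0 < p%:R^-1 :> R by rewrite invr_gt0 prime_gt0R.
  have p1 : p%:R^-1 < 1 :> R by rewrite invf_lt1 ?prime_gt0R // ltr1n prime_gt1.
  rewrite /cop_inv prime_coprime //; case: (boolP (p %| l)%N) => pl /=.
    rewrite mulVf ?gt_eqF ?subr_gt0 // mul1r big_nat_recl // expr0.
    rewrite big1 ?addr0 => [|i _]; last by rewrite expr0n.
    by rewrite lerBlDr lerDl invr_ge0 exprn_ge0.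
  rewrite mulr1 /a -exprVn big_mkord.
  rewrite (_ : (if (p <= z)%N then z.+2 else 2%N) = (if (p <= z)%N then z.+1 else 1).+1); last by case: ifP.
  rewrite mulrC ler_pdivrMr ?subr_gt0 // mulrC -[leRHS]opprK -mulNr opprB -subrX1 opprB //.
apply: (@le_trans _ _ (\prod_(0 <= p < y.+1 | prime p)
  ((1 - p%:R^-1)^-1 * (if (p %| l)%N then 1 - p%:R^-1 else 1) * (1 - a p)))); last first.
  apply: ler_prod => p pp; rewrite step // andbT.
  have p1 : p%:R^-1 < 1 :> R by rewrite invf_lt1 ?prime_gt0R // ltr1n prime_gt1.
  rewrite !mulr_ge0 ?invr_ge0 ?subr_ge0 ?(ltW p1) //; first by case: ifP => // _; rewrite subr_ge0 ltW.
  by rewrite /a -exprVn exprn_ile1 ?invr_ge0 // ltW.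
rewrite !big_split /=.
have -> : \prod_(0 <= p < y.+1 | prime p) (1 - p%:R^-1)^-1 = expR (neglog_prod R y).
  rewrite /neglog_prod expR_sum; apply: eq_bigr => p pp; rewrite expRN lnK // posrE subr_gt0.
  by rewrite invf_lt1 ?prime_gt0R // ltr1n prime_gt1.
have -> : \prod_(0 <= p < y.+1 | prime p) (if (p %| l)%N then 1 - p%:R^-1 else 1) =
   (totient l)%:R / l%:R :> R.
  rewrite totient_prod // -big_mkcondr /=.
  rewrite (@big_cat_nat _ _ _ l.+1 0 y.+1) //= [X in _ * X]big1_seq ?mulr1 //.
  move=> p /andP[/andP[_ pl]]; rewrite mem_index_iota => /andP[lp _].
  by have := dvdn_leq l0 pl; rewrite leqNgt lp.
have h1 : 1 - 2 / z%:R <= \prod_(0 <= p < y.+1 | prime p) (1 - a p).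
  apply: le_trans (prod_one_sub_ge _ _) => [|p pp].
    by rewrite lerD2l lerN2; apply: sum_pow_le.
  by rewrite /a -exprVn exprn_ge0 ?invr_ge0 // exprn_ile1 ?invr_ge0 // invf_le1 ?prime_gt0R // ler1n prime_gt0.
set P := \prod_(_ <= _ < _ | _) _ in h1 *.
set t : R := _ / l%:R.
have t0 : 0 <= t by rewrite divr_ge0.
rewrite -mulrA [leRHS]mulrAC [leRHS]mulrC; apply: ler_wpM2l => //.
have lny : 0 < ln y%:R :> R by rewrite ln_gt0 // ltr1n.
have z0 : 0 < z%:R :> R by rewrite ltr0n ltnW.
have z1 : 2 <= z%:R :> R by rewrite ler_nat.
have h2 : expR (euler_gamma R) * (ln y%:R - 7) <= expR (neglog_prod R y).
  apply: (@le_trans _ _ (expR (ln (ln y%:R) + euler_gamma R - 7 / ln y%:R))); last first.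
    by rewrite ler_expR mertens3_lower.
  rewrite addrAC expRD mulrC ler_pM2r ?expR_gt0 // expRD lnK ?posrE //.
  apply: (@le_trans _ _ (ln y%:R * (1 + - (7 / ln y%:R)))); last by rewrite ler_pM2l // expR_ge1Dx.
  by rewrite mulrDr mulr1 mulrN mulrCA mulfV ?gt_eqF // mulr1.
have h3 : ln y%:R * (2 / z%:R) <= 4 :> R.
  rewrite mulrA ler_pdivrMr // /y natrX lnXn // mulr2n.
  have := ln_sublinear z0; lra.
have P0 : 0 <= 1 - 2 / z%:R :> R by rewrite subr_ge0 ler_pdivrMr ?mul1r.
apply: (@le_trans _ _ (expR (neglog_prod R y) * (1 - 2 / z%:R))); last by rewrite ler_wpM2l ?expR_ge0.
apply: (@le_trans _ _ (expR (euler_gamma R) * (ln y%:R - 7) * (1 - 2 / z%:R))); last by rewrite ler_wpM2r.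
rewrite -mulrA ler_pM2l ?expR_gt0 //.
have : 0 <= 2 / z%:R :> R by rewrite divr_ge0.
by move: h3; set q := 2 / _; set v := ln _; lra.
Qed.

End MainTerm.

(** * Legendre symbols and reciprocity *)

(** A splitting field of X ^ n - 1 over F_q. Gauss sums are formed there, so that the q-th power is
    the Frobenius map. *)
Lemma prim_root_in_pchar (q n : nat) : prime q -> (0 < n)%N -> ~~ (q %| n)%N ->
  exists (L : fieldType) (z : L), (q \in [pchar L]) /\ n.-primitive_root z.
Proof.
move=> pq n0 qn.
have Xn : ('X^n - 1 : {poly 'F_q}) != 0 by rewrite -size_poly_eq0 size_XnsubC.
have [L [rs hrs _]] := FinSplittingFieldFor Xn.
have cL : q \in [pchar L] by apply: (rmorph_pchar (in_alg L)); exact: pchar_Fp.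
have pE : map_poly (in_alg L) ('X^n - 1 : {poly 'F_q}) = 'X^n - 1.
  by rewrite rmorphB /= map_polyXn rmorph1.
exists L; rewrite pE in hrs.
have eqp : 'X^n - 1 = \prod_(z <- rs) ('X - z%:P) :> {poly L}.
  by apply/eqP; rewrite -eqp_monic // ?monicXnsubC // monic_prod_XsubC.
have rn1 : all n.-unity_root rs.
  by apply/allP => z; rewrite -root_prod_XsubC -eqp.
have sz : (n < (size rs).+1)%N by rewrite -(size_prod_XsubC rs id) -eqp size_XnsubC.
have [|z hz] := hasP (has_prim_root n0 rn1 _ sz); last by exists z.
rewrite -separable_prod_XsubC -eqp separable_Xn_sub_1 //.
by rewrite -(dvdn_pcharf cL).
Qed.

(** The Legendre symbol, defined by Euler's criterion: its image in characteristic q is then the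
    power of exponent (q - 1) / 2, which gives multiplicativity and fits Frobenius computations. *)
Definition leg (q : nat) (a : int) : int :=
  if (q%:Z %| a)%Z then 0 else if (q%:Z %| a ^+ (q.-1)./2 - 1)%Z then 1 else -1.

Section Legendre.
Variable p : nat.
Hypothesis pp : prime p.
Hypothesis op : odd p.

Let p2 : (2 < p)%N. Proof. by case: p pp op => [|[|[|]]]. Qed.

Lemma oddprimeE : p = ((p.-1)./2.*2).+1.
Proof.
case: p pp op => // n _ /= on; have := odd_double_half n.
by rewrite (negbTE on) add0n => ->.
Qed.

Lemma legE (L : idomainType) (a : int) : p \in [pchar L] ->
  (leg p a)%:~R = (a%:~R : L) ^+ (p.-1)./2.
Proof.
move=> cL; rewrite /leg !(dvdz_pcharf cL) rmorphB rmorphXn rmorph1 /=.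
set x : L := a%:~R; set h := (p.-1)./2.
have h0 : (0 < h)%N by rewrite half_gt0; case: p p2 => [|[|[|]]].
case: eqP => [->|/eqP x0]; first by rewrite expr0n gtn_eqF.
rewrite subr_eq0; case: eqP => [->//|/eqP x1].
have : x ^+ p = x by rewrite -(pFrobenius_autE cL) pFrobenius_aut_int.
rewrite {1}oddprimeE -/h exprSr -{3}[x]mul1r => /(mulIf x0).
rewrite -mul2n mulnC exprM => /eqP; rewrite sqrf_eq1 (negbTE x1) /= => /eqP ->.
by rewrite mulrNz.
Qed.

Lemma leg_cases a : leg p a \in [:: 0; 1; -1].
Proof. by rewrite /leg; case: ifP => // _; case: ifP. Qed.

Lemma leg_inj (L : nzRingType) (u v : int) : p \in [pchar L] ->
  u \in [:: 0; 1; -1] -> v \in [:: 0; 1; -1] -> u%:~R = v%:~R :> L -> u = v.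
Proof.
move=> cL hu hv /eqP; rewrite -subr_eq0 -rmorphB /= -(dvdz_pcharf cL).
rewrite /dvdz /=.
have h : (`|u - v| < 3)%N.
  by move: hu hv; rewrite !inE => /or3P[]/eqP-> /or3P[]/eqP->.
case: (posnP `|u - v|) => [/eqP|k0 /dvdn_leq]; first by rewrite absz_eq0 subr_eq0 => /eqP.
by move/(_ k0) => k1; move: (leq_ltn_trans k1 h); rewrite ltnS leqNgt p2.
Qed.

Lemma leg_eq0 a : (leg p a == 0) = (p%:Z %| a)%Z.
Proof. by rewrite /leg; case: ifP => // _; case: ifP. Qed.

Lemma legM a b : leg p (a * b) = leg p a * leg p b.
Proof.
apply: (leg_inj (pchar_Fp pp)); rewrite ?leg_cases //.
  by have := leg_cases a; have := leg_cases b; rewrite !inE => /or3P[]/eqP-> /or3P[]/eqP->.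
by rewrite rmorphM /= !legE ?pchar_Fp // rmorphM exprMn.
Qed.

Lemma leg_mod a b : (p%:Z %| a - b)%Z -> leg p a = leg p b.
Proof.
move=> h; apply: (leg_inj (pchar_Fp pp)); rewrite ?leg_cases //.
rewrite !legE ?pchar_Fp //; congr (_ ^+ _); apply/eqP.
by rewrite -subr_eq0 -rmorphB /= -(dvdz_pcharf (pchar_Fp pp)).
Qed.

Lemma leg1 : leg p 1 = 1.
Proof.
rewrite /leg expr1n subrr dvdz0 dvdz1 /=; case: eqP => // p1.
by move: pp; rewrite -[p]/`|p%:Z|%N p1.
Qed.

Lemma leg_sqr a : ~~ (p%:Z %| a)%Z -> leg p a * leg p a = 1.
Proof.
rewrite -leg_eq0; have := leg_cases a; rewrite !inE => /or3P[]/eqP-> //.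
Qed.

(** X ^ h - 1 with h = (p - 1) / 2 has fewer roots than there are nonzero residues. *)
Lemma leg_nonres : exists a, leg p a = -1.
Proof.
pose h := (p.-1)./2.
have h0 : (0 < h)%N by rewrite half_gt0; case: p p2 => [|[|[|]]].
have [x /andP[x0 hx]] : exists x : 'F_p, (x != 0) && (x ^+ h != 1).
  apply/existsP; rewrite -[X in is_true X]negbK negb_exists; apply/negP => /forallP H.
  pose P : {poly 'F_p} := 'X^h - 1.
  have P0 : P != 0 by rewrite -size_poly_eq0 size_XnsubC.
  have := max_poly_roots P0 (rs := [seq x <- enum 'F_p | x != 0]) _ _.
  rewrite size_XnsubC // filter_uniq ?enum_uniq //.
  have -> : all (root P) [seq x <- enum 'F_p | x != 0].
    apply/allP => x; rewrite mem_filter => /andP[x0 _].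
    have := H x; rewrite x0 /= negbK => /eqP xh.
    by rewrite /root /P hornerD hornerN hornerC hornerXn xh subrr.
  have -> : size [seq x <- enum 'F_p | x != 0] = p.-1.
    have /card_uniqP <- : uniq [seq x <- enum 'F_p | x != 0] by rewrite filter_uniq ?enum_uniq.
    have <- : #|predC1 (0 : 'F_p)| = p.-1 by rewrite cardC1 card_Fp.
    by apply: eq_card => x; rewrite mem_filter mem_enum andbT.
  move/(_ isT isT); rewrite oddprimeE -/h /= ltnS -addnn -{3}[h]addn0 leq_add2l leqn0.
  by rewrite gtn_eqF.
exists (val x)%:Z; have := leg_cases (val x)%:Z.
have E : ((val x)%:Z%:~R : 'F_p) = x by rewrite -pmulrn natr_Zp.
have := @legE _ (val x)%:Z (pchar_Fp pp); rewrite E -/h.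
rewrite !inE => hE /or3P[]/eqP e //; move: hE; rewrite e => /esym/eqP.
  by rewrite mulr0z expf_eq0 (negbTE x0) andbF.
by rewrite mulr1z (negbTE hx).
Qed.

Lemma leg_N1 : leg p (-1) = (-1) ^+ (p.-1)./2.
Proof.
apply: (leg_inj (pchar_Fp pp)); rewrite ?leg_cases //.
  by rewrite -signr_odd; case: (odd _); rewrite !inE.
by rewrite legE ?pchar_Fp // rmorphXn.
Qed.

End Legendre.

Section Reciprocity.
Variables p q : nat.
Hypotheses (pp : prime p) (op : odd p) (pq : prime q) (oq : odd q) (npq : p != q).

Definition legF (x : 'F_p) : int := leg p (val x)%:Z.

Lemma leg_legF (a : int) : leg p a = legF a%:~R.
Proof.
apply: leg_mod => //; rewrite (dvdz_pcharf (pchar_Fp pp)) rmorphB /= -pmulrn natr_Zp subrr //.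
Qed.

Lemma legFM x y : legF (x * y) = legF x * legF y.
Proof.
have -> : x * y = ((val x)%:Z * (val y)%:Z)%:~R.
  by rewrite rmorphM /= -!pmulrn !natr_Zp.
by rewrite -leg_legF legM.
Qed.

Lemma legF_eq0 x : (legF x == 0) = (x == 0).
Proof.
by rewrite /legF leg_eq0 // (dvdz_pcharf (pchar_Fp pp)) -pmulrn natr_Zp.
Qed.

Lemma legF_sum : \sum_x legF x = 0.
Proof.
have [a ha] := leg_nonres pp op; set u : 'F_p := a%:~R.
have hu : legF u = -1 by rewrite -leg_legF.
have u0 : u != 0 by rewrite -legF_eq0 hu.
have E : \sum_x legF x = - \sum_x legF x.
  rewrite [LHS](reindex_inj (mulfI u0)) /= -sumrN; apply: eq_bigr => x _.
  by rewrite legFM hu mulN1r.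
lia.
Qed.

Variables (L : fieldType) (z : L).
Hypotheses (cL : q \in [pchar L]) (hz : p.-primitive_root z).

(** A nontrivial additive character of F_p with values in characteristic q. *)
Let E (x : 'F_p) : L := z ^+ (x : nat).

Let E_nat n : E n%:R = z ^+ n.
Proof. by rewrite /E val_Fp_nat // (prim_expr_mod hz). Qed.

Let ED x y : E (x + y) = E x * E y.
Proof. by rewrite -[x]natr_Zp -[y]natr_Zp -natrD !E_nat exprD. Qed.

Let E_sum t : \sum_x E (x * t) = if t == 0 then p%:R else 0.
Proof.
case: eqP => [->|/eqP t0].
  rewrite (eq_bigr (fun=> 1)) => [|x _]; last by rewrite mulr0 /E /= expr0.
  by rewrite sumr_const card_Fp.
have <- : \sum_x E x = \sum_x E (x * t) by rewrite [LHS](reindex_inj (mulIf t0)).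
have e1 : E 1 != 1.
  rewrite -[1 : 'F_p]/(1%:R) E_nat expr1 -[z]expr1 -(prim_order_dvd hz).
  by rewrite dvdn1; apply: contraL pp => /eqP->.
have : E 1 * \sum_x E x = \sum_x E x.
  rewrite [RHS](reindex_inj (addrI 1)) /= mulr_sumr.
  by apply: eq_bigr => x _; rewrite ED.
move/eqP; rewrite -subr_eq0 -{2}[\sum_x _]mul1r -mulrBl mulf_eq0 subr_eq0 (negbTE e1) /=.
by move/eqP.
Qed.

Let l (x : 'F_p) : L := (legF x)%:~R.
(** The quadratic Gauss sum. *)
Let g := \sum_x l x * E x.

(** Writing the second summation variable as a c makes the symbol of a cancel; the sum over a is
    then p - 1 for c = -1 and -1 otherwise, and the symbols sum to 0. *)
Let g_sqr : g ^+ 2 = p%:R * (leg p (-1))%:~R.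
Proof.
have -> : g ^+ 2 = \sum_c l c * (\sum_(a | a != 0) E (a * (1 + c))).
  rewrite expr2 {1}/g mulr_suml (bigD1 0) //= /l /legF.
  have -> : leg p 0 = 0 by apply/eqP; rewrite leg_eq0 // dvdz0.
  rewrite mulr0z !mul0r add0r.
  under [RHS]eq_bigr do rewrite mulr_sumr.
  rewrite [RHS]exchange_big /=; apply: eq_bigr => a a0.
  rewrite /g (reindex_inj (mulfI a0)) /= mulr_sumr; apply: eq_bigr => c _.
  rewrite -/(legF a) -/(legF c) /l legFM mulrDr mulr1 ED rmorphM /=.
  rewrite mulrACA; congr (_ * _).
  rewrite -!rmorphM /= mulrA.
  have -> : legF a * legF a = 1.
    by rewrite /legF leg_sqr // -leg_eq0 // -/(legF a) legF_eq0.
  by rewrite mul1r.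
have Ea c : \sum_(a | a != 0) E (a * (1 + c)) = (if c == -1 then p%:R else 0) - 1.
  have := E_sum (1 + c); rewrite (bigD1 0) //= mul0r {1}/E expr0 [1 + c]addrC addr_eq0.
  by move=> <-; rewrite [1 + _]addrC addrK.
under eq_bigr do rewrite Ea mulrBr mulr1.
rewrite sumrB /l -rmorph_sum /= legF_sum mulr0z subr0 (bigD1 (-1)) //= eqxx big1 ?addr0.
  by rewrite mulrC leg_legF rmorphN1.
by move=> c /negbTE ->; rewrite mulr0.
Qed.

(** Frobenius fixes the symbols and multiplies the argument of [E] by q, which the substitution x ->
    q x absorbs. *)
Let g_frob : g ^+ q = (leg p q)%:~R * g.
Proof.
rewrite -(pFrobenius_autE cL) rmorph_sum /= /g mulr_sumr.
have q0 : (q%:R : 'F_p) != 0.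
  by rewrite -(dvdn_pcharf (pchar_Fp pp)) dvdn_prime2.
rewrite [RHS](reindex_inj (mulfI q0)) /=; apply: eq_bigr => x _.
rewrite rmorphM /= mulrA; congr (_ * _).
  rewrite /l pFrobenius_aut_int -rmorphM /= legFM leg_legF -pmulrn mulrA.
  have -> : legF q%:R * legF q%:R = 1.
    rewrite -[legF q%:R]/(legF (q%:Z%:~R)) -leg_legF leg_sqr //.
    by rewrite -leg_eq0 // leg_legF legF_eq0.
  by rewrite mul1r.
rewrite pFrobenius_autE /E -exprM mulnC.
by rewrite -[in RHS](natr_Zp x) -natrM -/(E _) E_nat.
Qed.

(** Both sides are g ^ (q - 1): once by [g_frob], and once as the power (q - 1) / 2 of g ^ 2, that
    is, by Euler's criterion modulo q. *)
Lemma reciprocity_aux : leg p q = leg q (leg p (-1) * p%:Z).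
Proof.
have p0 : (p%:R : L) != 0 by rewrite -(dvdn_pcharf cL) dvdn_prime2 // eq_sym.
have g2 : g ^+ 2 != 0.
  rewrite g_sqr mulf_neq0 // leg_N1 // rmorphXn /= expf_neq0 //.
  by rewrite rmorphN1 oppr_eq0 oner_eq0.
have g0 : g != 0 by move: g2; rewrite expf_eq0 /=.
apply: (leg_inj pq oq cL); rewrite ?leg_cases //.
rewrite (legE pq oq _ cL) rmorphM /= -pmulrn mulrC -g_sqr -exprM mul2n.
have := g_frob; rewrite {1}(oddprimeE pq oq) exprSr => /(mulIf g0) <-.
by rewrite doubleE.
Qed.

End Reciprocity.

Lemma reciprocity (p q : nat) : prime p -> odd p -> prime q -> odd q ->
  leg p q = leg q (leg p (-1) * p%:Z).
Proof.
move=> pp op pq oq; case: (eqVneq p q) => [e|npq].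
  subst q; have -> : leg p p = 0 by apply/eqP; rewrite leg_eq0 // dvdzz.
  by apply/esym/eqP; rewrite leg_eq0 // dvdz_mull // dvdzz.
have [|L [z [cL hz]]] := prim_root_in_pchar pq (prime_gt0 pp) _.
  by rewrite dvdn_prime2 // eq_sym.
exact: reciprocity_aux cL hz.
Qed.

(** For a primitive eighth root of unity z, the element t = z + 1 / z has square 2, and t ^ p = z ^
    p + z ^ (- p) is t or - t according to p modulo 8. *)
Lemma leg_2 (p : nat) : prime p -> odd p ->
  leg p 2 = if ((p %% 8 == 1) || (p %% 8 == 7))%N then 1 else -1.
Proof.
move=> pp op.
have p8 : ~~ (p %| 8)%N.
  rewrite (_ : 8 = 2 ^ 3)%N // Euclid_dvdX // andbT.
  by rewrite (dvdn_prime2 pp) //; apply: contraL op => /eqP ->.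
have [L [z [cL hz]]] := @prim_root_in_pchar p 8 pp isT p8.
have z8 : z ^+ 8 = 1 by apply: prim_expr_order.
have z4 : z ^+ 4 = -1.
  have : (z ^+ 4) ^+ 2 == 1 by rewrite -exprM z8.
  rewrite sqrf_eq1 => /orP[|/eqP//].
  by rewrite -(prim_order_dvd hz).
pose w := z ^+ 7.
have zw : z * w = 1 by rewrite /w -exprS.
pose t := z + w.
have t2 : t ^+ 2 = 2%:R.
  have h : z ^+ 14 = z ^+ 6 by rewrite (_ : 14 = 8 + 6)%N // exprD z8 mul1r.
  rewrite /t sqrrD zw /w -exprM h.
  have h2 : z ^+ 6 = - z ^+ 2 by rewrite (_ : 6 = 4 + 2)%N // exprD z4 mulN1r.
  by rewrite h2; ring.
have two0 : (2%:R : L) != 0.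
  rewrite -(dvdn_pcharf cL) dvdn_prime2 //; by apply: contraL op => /eqP ->.
have t0 : t != 0 by move: two0; rewrite -t2 expf_eq0.
have tp : t ^+ p = z ^+ (p %% 8) + z ^+ ((p %% 8) * 7).
  rewrite -(pFrobenius_autE cL) rmorphD /= !pFrobenius_autE /w -exprM mulnC exprM.
  by rewrite -(prim_expr_mod hz) -exprM.
have leg2 : (leg p 2)%:~R * t = t ^+ p.
  rewrite (legE pp op _ cL) (_ : 2%:~R = t ^+ 2); last by rewrite t2 -pmulrn.
  by rewrite -exprM mul2n -exprSr -oddprimeE.
have c := leg_cases p 2.
have key (e : int) : e \in [:: 0; 1; -1] -> t ^+ p = e%:~R * t -> leg p 2 = e.
  move=> he h; apply: (leg_inj pp op cL) => //; apply: (mulIf t0).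
  by rewrite leg2.
have z12 (a : nat) : z ^+ (4 + a) = - z ^+ a by rewrite exprD z4 mulN1r.
have : odd (p %% 8) by rewrite -[8%N]/(4 * 2)%N odd_mod // op.
have : (p %% 8 < 8)%N by rewrite ltn_mod.
move: tp; case: (p %% 8)%N => [|[|[|[|[|[|[|[|]]]]]]]] //= tp _ _; apply: key;
  rewrite ?inE // tp ?mulr1z ?mulrN1z ?mul1r ?mulN1r /t /w.
- by rewrite expr1 mul1n.
- by rewrite -[(3 * 7)%N]/(4 + (4 + (4 + (4 + (4 + 1)))))%N -[7%N]/(4 + 3)%N !z12; ring.
- by rewrite -[(5 * 7)%N]/(4 + (4 + (4 + (4 + (4 + (4 + (4 + (4 + 3))))))))%N -[7%N]/(4 + 3)%N -[5%N]/(4 + 1)%N !z12; ring.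
by rewrite -[(7 * 7)%N]/(4 + (4 + (4 + (4 + (4 + (4 + (4 + (4 + (4 + (4 + (4 + (4 + 1))))))))))))%N -[7%N]/(4 + 3)%N !z12; ring.
Qed.

(** The prime discriminant p*, that is, p or - p, whichever is 1 modulo 4. *)
Definition star (p : nat) : int := leg p (-1) * p%:Z.

Lemma star_mod8 p : prime p -> odd p ->
  (star p = 1 %[mod 8])%Z /\ leg p 2 = 1 \/ (star p = 5 %[mod 8])%Z /\ leg p 2 = -1.
Proof.
move=> pp op; rewrite leg_2 // /star leg_N1 //.
have : odd (p %% 8) by rewrite -[8%N]/(4 * 2)%N odd_mod // op.
have : (p %% 8 < 8)%N by rewrite ltn_mod.
have := divn_eq p 8; set m := (p %/ 8)%N; set r := (p %% 8)%N => pE.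
have hE : (p.-1)./2 = (4 * m + (r.-1)./2)%N \/ r = 0%N.
  case: r pE => [|r] pE; [by right|left].
  rewrite pE /= addnS /= halfD -[8%N]/(2 * 4)%N mulnCA mul2n odd_double andFb add0n doubleK.
  by rewrite mulnC.
move=> r8 ro; case: hE => [->|r0]; last by move: ro; rewrite r0.
rewrite exprD exprM (_ : (-1) ^+ 4 = 1 :> int) // expr1n mul1r pE.
by case: r r8 ro pE => [|[|[|[|[|[|[|[|]]]]]]]] //= _ _ _ ; [left|right|right|left]; split=> //; lia.
Qed.

Lemma prod_star (s : seq nat) : all prime s -> all odd s ->
  ((\prod_(p <- s) star p = 1 %[mod 8])%Z /\ \prod_(p <- s) leg p 2 = 1) \/
  ((\prod_(p <- s) star p = 5 %[mod 8])%Z /\ \prod_(p <- s) leg p 2 = -1).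
Proof.
elim: s => [|p s IH] /=; first by left; rewrite !big_nil.
case/andP=> pp ps /andP[op os]; rewrite !big_cons.
have hp := star_mod8 pp op; have hs := IH ps os.
move: hp hs; set a := star p; set b := \prod_(_ <- _) star _ => hp hs.
by case: hp => [[h1 ->]|[h1 ->]]; case: hs => [[h2 ->]|[h2 ->]];
  rewrite ?mul1r ?mulr1 ?mulrNN ?mul1r; [left|right|right|left]; split=> //;
  rewrite -modzMm h1 h2 modzMm.
Qed.

(** The product of the p* and s0 times the product of the p differ at most in sign and are both 1
    modulo 4, hence are equal; reciprocity then applies prime by prime. That the residue modulo 8 is
    1 and not 5 gives the value at 2. *)
Lemma jacobi_reciprocity (s : seq nat) (s0 : int) : all prime s -> all odd s ->
  s0 = 1 \/ s0 = -1 -> (s0 * (\prod_(p <- s) p)%N%:Z = 1 %[mod 8])%Z ->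
  [/\ \prod_(p <- s) leg p (-1) = s0, \prod_(p <- s) leg p 2 = 1 &
     forall q, prime q -> odd q ->
       \prod_(p <- s) leg p q%:Z = leg q (s0 * (\prod_(p <- s) p)%N%:Z)].
Proof.
move=> ps os hs0 h8.
have E : \prod_(p <- s) star p = \prod_(p <- s) leg p (-1) * (\prod_(p <- s) p)%N%:Z.
  by rewrite big_split /= (big_morph Posz PoszM (erefl _)).
have hT : \prod_(p <- s) leg p (-1) = 1 \/ \prod_(p <- s) leg p (-1) = -1.
  elim: s ps os {h8 E} => [|p s IH] /=; first by left; rewrite big_nil.
  case/andP=> pp ps /andP[op os]; rewrite big_cons leg_N1 //.
  rewrite -signr_odd; case: (IH ps os) => ->; case: (odd _) => /=; rewrite ?mulr1 ?mulN1r ?opprK ?expr0 ?expr1 ?mul1r; by [left|right].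
have hP := prod_star ps os.
have eT : \prod_(p <- s) leg p (-1) = s0.
  move: hP h8; rewrite E; move: hT hs0; set T := \prod_(_ <- _) leg _ _; set P := Posz _.
  case=> ->; case=> -> //; rewrite ?mulN1r ?mul1r; case=> [[h _]|[h _]] h8; lia.
have hP2 : (\prod_(p <- s) star p = 1 %[mod 8])%Z by rewrite E eT.
split=> //.
  case: hP => [[_ //]|[h5 _]]; exfalso; move: h5; rewrite hP2; lia.
move=> q pq oq; rewrite -eT -E.
elim: s ps os {h8 E hT hP eT hP2} => [|p s IH] /=; first by rewrite !big_nil leg1.
case/andP=> pp ps /andP[op os]; rewrite !big_cons IH // legM // reciprocity //.
Qed.

(** * Primes congruent to 1 modulo k *)

Definition cyclo_val (k m : nat) : nat := `|('Phi_k).[m%:Z]|%N.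

(** Over the complex numbers the value is a product of factors m - zeta of modulus at least m - 1;
    one is kept and the others are at least 1. *)
Lemma cyclo_val_ge (k m : nat) : (2 <= k)%N -> (2 <= m)%N -> (m.-1 <= cyclo_val k m)%N.
Proof.
move=> k2 m2; have k0 : (0 < k)%N by rewrite ltnW.
have [z hz] := C_prim_root_exists k0.
have E : (('Phi_k).[m%:Z])%:~R = \prod_(i < k | coprime i k) (m%:R - z ^+ i) :> algC.
  rewrite -horner_map /= (Cintr_Cyclotomic hz) /cyclotomic horner_prod /= -pmulrn.
  by apply: eq_bigr => i _; rewrite hornerXsubC.
have nz (i : nat) : `|z ^+ i| = 1.
  suff z1 : `|z| = 1 by rewrite normrX z1 expr1n.
  by apply/eqP; rewrite -(pexpr_eq1 k0 (normr_ge0 z)) -normrX (prim_expr_order hz) normr1.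
have ge (i : nat) : (m.-1)%:R <= `|m%:R - z ^+ i : algC|.
  apply: le_trans (lerB_dist _ _); rewrite nz normr_nat -subn1 natrB //.
  by rewrite ltnW.
suff : ((m.-1)%:R : algC) <= (cyclo_val k m)%:R by rewrite ler_nat.
have -> : (cyclo_val k m)%:R = `|(('Phi_k).[m%:Z])%:~R| :> algC.
  by rewrite /cyclo_val pmulrn abszE intr_norm.
rewrite E normr_prod (bigD1 (Ordinal k2)) /=; last by rewrite /coprime gcd1n.
have hr : 1 <= \prod_(i < k | coprime i k && (i != Ordinal k2)) `|m%:R - z ^+ i : algC|.
  apply: (big_ind (fun x => 1 <= x)) => // [u v|i _]; first exact: mulr_ege1.
  apply: le_trans (ge i).
  by rewrite ler1n -subn1 subn_gt0.
by apply: le_trans (ge 1%N) _; rewrite -[leLHS]mulr1 ler_wpM2l.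
Qed.

Lemma PoszXn (m n : nat) : (m ^ n)%N%:Z = m%:Z ^+ n.
Proof. by rewrite -[LHS]natz natrX natz. Qed.

Lemma cyclo_val_dvd (k m : nat) : (0 < k)%N -> (0 < m)%N -> (cyclo_val k m %| m ^ k - 1)%N.
Proof.
move=> k0 m0; have := prod_Cyclotomic k0.
rewrite (big_rem k) -?dvdn_divisors //= => /(congr1 (fun P => P.[m%:Z])).
rewrite hornerM hornerD hornerN hornerC hornerXn => h.
have : ('Phi_k).[m%:Z] * (\prod_(d <- rem k (divisors k)) 'Phi_d).[m%:Z] = (m ^ k - 1)%N%:Z.
  by rewrite h -subzn ?expn_gt0 ?m0 // PoszXn.
move/(congr1 absz); rewrite abszM /= => <-; exact: dvdn_mulr.
Qed.

Lemma prime_dvd_cyclo_ndvd (k m p : nat) : (0 < k)%N -> (0 < m)%N -> (k %| m)%N -> prime p ->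
  (p %| cyclo_val k m)%N -> ~~ (p %| k)%N.
Proof.
move=> k0 m0 km pp pv; apply/negP => pk.
have h1 : (p %| m ^ k)%N by rewrite Euclid_dvdX // k0 (dvdn_trans pk km).
have h2 := dvdn_trans pv (cyclo_val_dvd k0 m0).
have : (p %| m ^ k - (m ^ k - 1))%N by rewrite dvdn_sub.
by rewrite subKn ?expn_gt0 ?m0 // dvdn1 => /eqP p1; rewrite p1 in pp.
Qed.

(** Since p does not divide k, X ^ k - 1 is separable modulo p, so a root of Phi_k there is no root
    of Phi_d for any other d dividing k. Hence m has order exactly k modulo p. *)
Lemma prime_dvd_cyclo (k m p : nat) : (0 < k)%N -> (0 < m)%N -> (k %| m)%N -> prime p ->
  (p %| cyclo_val k m)%N -> (k %| p.-1)%N.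
Proof.
move=> k0 m0 km pp pv; have pk := prime_dvd_cyclo_ndvd k0 m0 km pp pv.
pose f := (intr : int -> 'F_p); pose x : 'F_p := m%:R.
pose G : {poly int} := \prod_(d <- rem k (divisors k)) 'Phi_d.
have fac : 'Phi_k * G = 'X^k - 1.
  by rewrite -prod_Cyclotomic // (big_rem k) -?dvdn_divisors.
have sep : separable_poly (map_poly f 'Phi_k * map_poly f G).
  rewrite -rmorphM /= fac rmorphB /= map_polyXn rmorph1.
  by rewrite separable_Xn_sub_1 // -(dvdn_pcharf (pchar_Fp pp)).
have x0 : root (map_poly f 'Phi_k) x.
  rewrite /root -[x]/(m%:R) (_ : m%:R = f m%:Z) // horner_map /= /f -(dvdz_pcharf (pchar_Fp pp)).
  by rewrite /dvdz.
have Gx : ~~ root (map_poly f G) x.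
  move: sep; rewrite separable_mul => /and3P[_ _ cop].
  exact: coprimep_root cop x0.
have xk : x ^+ k = 1.
  have := congr1 (fun P => (map_poly f P).[x]) fac.
  rewrite /= rmorphM /= hornerM (rootP x0) mul0r rmorphB /= map_polyXn rmorph1.
  by rewrite hornerD hornerN hornerC hornerXn => /eqP; rewrite eq_sym subr_eq0 => /eqP.
have [d hd dk] := prim_order_exists k0 xk.
have dE : d = k.
  apply/eqP; apply: contraNT Gx => ndk; have d0 := prim_order_gt0 hd.
  have : (map_poly f ('X^d - 1)).[x] = 0.
    rewrite rmorphB /= map_polyXn rmorph1 hornerD hornerN hornerC hornerXn.
    by rewrite (prim_expr_order hd) subrr.
  rewrite -prod_Cyclotomic // rmorph_prod /= horner_prod => /eqP.
  rewrite prodf_seq_eq0 => /hasP[e]; rewrite -dvdn_divisors // => ed /andP[_ /eqP ex].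
  rewrite /root /G rmorph_prod /= horner_prod prodf_seq_eq0; apply/hasP.
  exists e; last by rewrite ex eqxx.
  have ek : e != k.
    by apply: contra ndk => /eqP ek; rewrite ek in ed; rewrite eqn_dvd dk ed.
  by rewrite rem_filter ?divisors_uniq // mem_filter /= ek -dvdn_divisors // (dvdn_trans ed dk).
rewrite dE in hd; rewrite (prim_order_dvd hd).
have xn0 : x != 0.
  by apply/negP => /eqP e; move: xk; rewrite e expr0n gtn_eqF // => /eqP; rewrite eq_sym oner_eq0.
have := expf_card x; rewrite card_Fp // -[X in x ^+ X](prednK (prime_gt0 pp)) exprSr -[RHS]mul1r.
by move/(mulIf xn0) ->.
Qed.

(** Uniqueness in Hensel's lemma: x ^ k - y ^ k = (x - y) S, and S is k x ^ (k - 1) modulo p, a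
    unit. *)
Lemma pow_root_lift (k p j : nat) (x y : int) : prime p -> ~~ (p %| k)%N -> (0 < k)%N -> (0 < j)%N ->
  ((p ^ j)%N%:Z %| x ^+ k - 1)%Z -> ((p ^ j)%N%:Z %| y ^+ k - 1)%Z ->
  (p%:Z %| x - y)%Z -> ((p ^ j)%N%:Z %| x - y)%Z.
Proof.
move=> pp pk k0 j0 hx hy xy.
have : ((p ^ j)%N%:Z %| x ^+ k - y ^+ k)%Z.
  have -> : x ^+ k - y ^+ k = (x ^+ k - 1) - (y ^+ k - 1) by ring.
  exact: rpredB.
rewrite subrXX; set S := \sum_(i < k) _.
have cop : coprimez (p ^ j)%N%:Z S.
  rewrite coprimezE /= coprimeXl // prime_coprime //.
  have fxy : x%:~R = y%:~R :> 'F_p.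
    by apply/eqP; rewrite -subr_eq0 -rmorphB /= -(dvdz_pcharf (pchar_Fp pp)).
  have xk : (x%:~R : 'F_p) ^+ k = 1.
    have : (p%:Z %| x ^+ k - 1)%Z.
      by apply: dvdz_trans hx; change (p %| p ^ j)%N; exact: dvdn_exp (dvdnn p).
    by rewrite (dvdz_pcharf (pchar_Fp pp)) rmorphB rmorphXn rmorph1 subr_eq0 => /eqP.
  have : S%:~R = k%:R * x%:~R ^+ k.-1 :> 'F_p.
    rewrite /S rmorph_sum /= (eq_bigr (fun=> x%:~R ^+ k.-1)) ?sumr_const ?card_ord ?mulr_natl // => i _.
    rewrite rmorphM !rmorphXn /= -fxy -exprD; congr (_ ^+ _).
    by have := ltn_ord i; move: (nat_of_ord i) => m; clear; lia.
  move=> fS; change (~~ (p%:Z %| S)%Z); rewrite (dvdz_pcharf (pchar_Fp pp)) fS.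
  rewrite mulf_neq0 -?(dvdn_pcharf (pchar_Fp pp)) // expf_neq0 //.
  by apply/negP => /eqP e; move: xk; rewrite e expr0n gtn_eqF // => /eqP; rewrite eq_sym oner_eq0.
by rewrite mulrC (Gauss_dvdzr _ cop).
Qed.

(** Such an i is determined by its block of length p ^ j and by the residue of k (i + 1) modulo p,
    which is one of at most k roots of unity. *)
Lemma count_cyclo (k N p j : nat) : (0 < k)%N -> prime p -> ~~ (p %| k)%N -> (0 < j)%N ->
  (\sum_(0 <= i < N) (p ^ j %| cyclo_val k (k * i.+1))%N <= k * (N %/ p ^ j).+1)%N.
Proof.
move=> k0 pp pk j0; rewrite big_mkord.
pose A := [set i : 'I_N | (p ^ j %| cyclo_val k (k * i.+1))%N].
have -> : (\sum_(i < N) (p ^ j %| cyclo_val k (k * i.+1)) = #|A|)%N.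
  by rewrite -sum1_card [RHS]big_mkcond /=; apply: eq_bigr => i _; rewrite inE; case: (_ %| _)%N.
have pj0 : (0 < p ^ j)%N by rewrite expn_gt0 prime_gt0.
pose B := [set x : 'F_p | x ^+ k == 1].
have cB : (#|B| <= k)%N.
  pose P : {poly 'F_p} := 'X^k - 1.
  have P0 : P != 0 by rewrite -size_poly_eq0 size_XnsubC.
  have := max_poly_roots P0 (rs := enum B) _ (enum_uniq _).
  rewrite size_XnsubC // ltnS -cardE; apply.
  apply/allP => x; rewrite mem_enum inE => /eqP xk.
  by rewrite /root /P hornerD hornerN hornerC hornerXn xk subrr.
have Ak i : i \in A -> ((p ^ j)%N%:Z %| (k * i.+1)%N%:Z ^+ k - 1)%Z.
  rewrite inE => h; have := dvdn_trans h (@cyclo_val_dvd k (k * i.+1) k0 _).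
  rewrite muln_gt0 k0 => /(_ isT) h2.
  by rewrite -PoszXn subzn ?expn_gt0 ?muln_gt0 ?k0.
pose h (i : 'I_N) : 'I_(N %/ p ^ j).+1 * 'F_p := (inord (i %/ p ^ j), (k * i.+1)%:R).
have hinj : {in A &, injective h}.
  move=> i i' iA iA' [] /(congr1 val); rewrite /= !inordK ?ltnS ?leq_div2r ?(ltnW (ltn_ord _)) // => e1 e2.
  have d1 : (p%:Z %| (k * i.+1)%N%:Z - (k * i'.+1)%N%:Z)%Z.
    by rewrite (dvdz_pcharf (pchar_Fp pp)) rmorphB /= -!pmulrn e2 subrr.
  have := pow_root_lift pp pk k0 j0 (Ak _ iA) (Ak _ iA') d1.
  rewrite !PoszM -mulrBr (Gauss_dvdzr); last first.
    by rewrite coprimezE /= coprimeXl // prime_coprime.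
  have ei := divn_eq i (p ^ j); have ei' := divn_eq i' (p ^ j).
  rewrite e1 in ei; move=> hd; apply/val_inj => /=.
  move: ei ei' (ltn_pmod i pj0) (ltn_pmod i' pj0) hd.
  set Q := (i' %/ p ^ j * p ^ j)%N; set a := (i %% p ^ j)%N; set b := (i' %% p ^ j)%N.
  move: Q a b (nat_of_ord i) (nat_of_ord i') pj0; move: (p ^ j)%N; clear => d Q a b i i' d0 -> -> ad bd.
  have -> : (Q + a).+1%:Z - (Q + b).+1%:Z = a%:Z - b%:Z by lia.
  rewrite dvdzE /= => dab; case: (posnP `|a%:Z - b%:Z|) => [|q0]; first by lia.
  by have := dvdn_leq q0 dab; lia.
rewrite -(card_in_imset hinj).
apply: leq_trans (_ : #|finset.setX [set: 'I_(N %/ p ^ j).+1] B| <= _)%N; last first.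
  by rewrite cardsX cardsT card_ord mulnC leq_mul2r cB orbT.
apply: subset_leq_card; apply/fintype.subsetP => _ /imsetP[i iA ->].
rewrite !inE /= -natrX; have := Ak _ iA.
move=> hd; have : (p%:Z %| (k * i.+1)%N%:Z ^+ k - 1)%Z.
  by apply: dvdz_trans hd; change (p %| p ^ j)%N; exact: dvdn_exp (dvdnn p).
by rewrite (dvdz_pcharf (pchar_Fp pp)) rmorphB rmorphXn rmorph1 subr_eq0 /= natrX.
Qed.

Definition cyclo_primes (k N : nat) : seq nat :=
  [seq p <- index_iota 0 ((k * N) ^ k).+1 |
     prime p && has (fun i => p %| cyclo_val k (k * i.+1))%N (index_iota 0 N)].

Section Supply.
Variable R : realType.

Lemma cyclo_val_bound (k N i : nat) : (2 <= k)%N -> (i < N)%N ->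
  (i.+1 <= cyclo_val k (k * i.+1) <= (k * N) ^ k)%N.
Proof.
move=> k2 iN; have k0 : (0 < k)%N by rewrite ltnW.
apply/andP; split.
  apply: leq_trans (@cyclo_val_ge k (k * i.+1) k2 _); last by nia.
  by case: k k2 {k0} => [|[|k]] // _; rewrite -subn1; nia.
have hd := @cyclo_val_dvd k (k * i.+1) k0 _.
apply: leq_trans (dvdn_leq _ (hd _)) _; rewrite ?muln_gt0 ?k0 //.
  rewrite subn_gt0 -[X in (X < _)%N](exp1n k) ltn_exp2r //; nia.
apply: leq_trans (leq_subr _ _) _; rewrite leq_exp2r // leq_mul2l iN orbT //.
Qed.

(** In the bound k (N / p ^ j + 1) of [count_cyclo], the first parts form a geometric series. The
    second parts occur for at most log_p B exponents, B bounding the values, and give k ln B. *)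
Lemma cyclo_prime_term (k N p : nat) : (2 <= k)%N -> (0 < N)%N -> prime p -> ~~ (p %| k)%N ->
  (p <= (k * N) ^ k)%N ->
  ln (p%:R : R) * (\sum_(1 <= j < ((k * N) ^ k).+1) \sum_(0 <= i < N)
       (p ^ j %| cyclo_val k (k * i.+1))%N)%N%:R <=
  k%:R * N%:R * (ln p%:R / (p%:R - 1)) + k%:R * ln ((k * N) ^ k)%N%:R.
Proof.
move=> k2 N0 pp pk pB; have k0 : (0 < k)%N by rewrite ltnW.
set B := ((k * N) ^ k)%N in pB *.
have B0 : (0 < B)%N by rewrite expn_gt0 muln_gt0 k0 N0.
pose J := trunc_log p B; have p1 := prime_gt1 pp.
have JB : (J <= B)%N.
  by have := trunc_logP p1 B0; apply: leq_trans; apply: ltnW; apply: ltn_expl.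
have l0 := ln_prime_gt0 R pp.
rewrite (@big_cat_nat _ _ _ J.+1) //= natrD.
rewrite [X in _ + X%:R](_ : _ = 0%N) ?addr0; last first.
  rewrite big_nat_cond big1 // => j /andP[/andP[Jj _] _].
  rewrite big_nat_cond big1 // => i /andP[/andP[_ iN] _].
  have /andP[v0 vB] := cyclo_val_bound k2 iN.
  rewrite gtnNdvd //; first exact: leq_trans v0.
  apply: leq_ltn_trans vB _; rewrite -/B.
  apply: leq_trans (trunc_log_ltn B p1) _.
  by rewrite leq_exp2l.
have H : (\sum_(1 <= j < J.+1) \sum_(0 <= i < N) (p ^ j %| cyclo_val k (k * i.+1))%N)%N%:R <=
  k%:R * N%:R * (p%:R - 1)^-1 + k%:R * J%:R :> R.
  rewrite natr_sum; apply: (@le_trans _ _ (\sum_(1 <= j < J.+1) (k%:R * N%:R * p%:R ^- j + k%:R))).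
    apply: ler_sum_nat => j /andP[j1 _].
    apply: (@le_trans _ _ ((k * (N %/ p ^ j).+1)%N%:R)).
      by rewrite ler_nat; apply: count_cyclo.
    rewrite natrM -natr1 mulrDr mulr1 lerD2r -mulrA ler_pM2l ?ltr0n //.
    by rewrite -natrX natr_divn_le.
  rewrite big_split /= -mulr_sumr sumr_const_nat subn1 /= -[_ *+ J]mulr_natr lerD2r.
  by rewrite ler_wpM2l ?mulr_ge0 // geom_sum_le.
apply: le_trans (ler_wpM2l (ltW l0) H) _.
rewrite mulrDr mulrCA lerD //.
rewrite mulrCA ler_wpM2l // mulr_natr -lnXn ?(prime_gt0R R pp) // ler_ln ?posrE ?exprn_gt0 ?(prime_gt0R R pp) ?ltr0n //.
by rewrite -natrX ler_nat trunc_logP.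
Qed.

(** The values of Phi_k at k, 2k, ..., kN have product at least N!. Primes up to z are charged
    through the Mertens bound; each larger prime dividing a value is charged a uniform amount, so
    their number appears. *)
Lemma primes_one_mod_ineq (k N z : nat) (L : R) : (2 <= k)%N -> (0 < N)%N -> (0 < z)%N ->
  L = ln ((k * N) ^ k)%N%:R ->
  N%:R * ln N%:R - N%:R <= k%:R * N%:R * (ln z%:R + 6) + z.+1%:R * (k%:R * L)
     + (size (cyclo_primes k N))%:R * (k%:R * L * (N%:R / z%:R + 1)).
Proof.
move=> k2 N0 z0; have k0 : (0 < k)%N by rewrite ltnW.
set B := ((k * N) ^ k)%N => LE.
have B0 : (0 < B)%N by rewrite expn_gt0 muln_gt0 k0 N0.
have L0 : 0 <= L by rewrite LE ln_ge0 // ler1n.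
have kL0 : 0 <= k%:R * L by rewrite mulr_ge0.
pose inS p := has (fun i => p %| cyclo_val k (k * i.+1))%N (index_iota 0 N).
pose c := k%:R * L * (N%:R / z%:R + 1).
have c0 : 0 <= c by rewrite mulr_ge0 // addr_ge0 // divr_ge0.
pose u (p : nat) : R := k%:R * N%:R * (ln p%:R / (p%:R - 1)) + k%:R * L.
have u0 p : prime p -> 0 <= u p.
  move=> pp; rewrite addr_ge0 // !mulr_ge0 ?invr_ge0 ?subr_ge0 ?ler1n ?prime_gt0 //.
  by rewrite ltW // ln_prime_gt0.
apply: le_trans (lnfact_ge R N) _.
apply: (@le_trans _ _ (\sum_(0 <= i < N) ln (cyclo_val k (k * i.+1))%:R)).
  apply: ler_sum_nat => i /andP[_ iN]; have /andP[v0 _] := cyclo_val_bound k2 iN.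
  by rewrite ler_ln ?posrE ?ltr0n // ?ler_nat //; apply: leq_trans v0.
rewrite (@sum_ln_natE R N B); last first.
  move=> i iN; have /andP[v0 ->] := cyclo_val_bound k2 iN.
  by rewrite andbT; apply: leq_trans v0.
apply: (@le_trans _ _ (\sum_(0 <= p < B.+1 | prime p)
   ((if (p <= z)%N then u p else 0) + (if inS p then c else 0)))).
  rewrite big_nat_cond [in leRHS]big_nat_cond; apply: ler_sum => p /andP[/andP[_ pB] pp].
  rewrite ltnS in pB.
  case: (boolP (inS p)) => [pS|pS]; last first.
    rewrite big_nat_cond big1 ?mulr0 ?addr0 => [|j /andP[/andP[j1 _] _]]; first by case: ifP => // _; exact: u0.
    rewrite big_nat_cond big1 // => i /andP[/andP[_ iN] _].
    have : ~~ (p %| cyclo_val k (k * i.+1))%N.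
      apply: contra pS => h; apply/hasP; exists i => //; by rewrite mem_index_iota.
    case: (boolP (p ^ j %| _)%N) => // h /negP[]; apply: dvdn_trans h.
    by apply: dvdn_exp.
  have pk : ~~ (p %| k)%N.
    have /hasP[i ] := pS; rewrite mem_index_iota => /andP[_ iN] h.
    by apply: prime_dvd_cyclo_ndvd h; rewrite ?muln_gt0 ?k0 // dvdn_mulr.
  apply: le_trans (cyclo_prime_term k2 N0 pp pk pB) _; rewrite -/B -LE -/(u p).
  case: leqP => pz; first by rewrite lerDl.
  rewrite add0r /u /c mulrDr mulr1 lerD2r.
  have -> : k%:R * L * (N%:R / z%:R) = k%:R * N%:R * (L / z%:R) by ring.
  apply: ler_wpM2l; first by rewrite mulr_ge0.
  have p1 : z%:R <= p%:R - 1 :> R by rewrite lerBrDr natr1 ler_nat.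
  have zR : 0 < z%:R :> R by rewrite ltr0n.
  apply: ler_pM; rewrite ?ln_ge0 ?ler1n ?prime_gt0 // ?invr_ge0 ?(le_trans _ p1) //.
    by rewrite LE ler_ln ?posrE ?ler_nat ?ltr0n ?(prime_gt0 pp).
  by rewrite lef_pV2 ?posrE // (lt_le_trans zR).
rewrite big_split /=; apply: lerD; last first.
  rewrite -big_mkcondr /= -[leLHS]big_filter big_const_seq count_predT iter_addr addr0.
  by rewrite -[c *+ _]mulr_natl /cyclo_primes -/B.
apply: (@le_trans _ _ (\sum_(0 <= p < z.+1 | prime p) u p)).
  rewrite -big_mkcondr /=; case: (leqP B z) => Bz.
    rewrite [leRHS](@big_cat_nat _ _ _ B.+1) //=.
    apply: (@le_trans _ _ (\sum_(0 <= p < B.+1 | prime p) u p)); last first.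
      by rewrite lerDl; apply: sumr_ge0.
    rewrite big_mkcondr; apply: ler_sum => p pp; case: ifP => // _; exact: u0.
  by rewrite [leRHS](@big_nat_widen _ _ _ _ _ B.+1) //= ltnS ltnW.
rewrite /u big_split /= -mulr_sumr; apply: lerD.
  by rewrite ler_wpM2l ?mulr_ge0 // -/(mertens_sum R z) mertens_sum_le.
apply: (@le_trans _ _ (\sum_(0 <= p < z.+1) (k%:R * L))).
  by rewrite big_mkcond; apply: ler_sum => p _; case: ifP.
by rewrite sumr_const_nat subn0 -[leLHS]mulr_natl.
Qed.

Lemma cyclo_primesP (k N p : nat) : (2 <= k)%N -> p \in cyclo_primes k N ->
  [/\ prime p, (k %| p.-1)%N & (p <= (k * N) ^ k)%N].
Proof.
move=> k2; have k0 : (0 < k)%N by rewrite ltnW.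
rewrite mem_filter mem_index_iota => /andP[/andP[pp /hasP[i _ h]] /andP[_ pB]].
by split=> //; apply: prime_dvd_cyclo h; rewrite ?muln_gt0 ?k0 // dvdn_mulr.
Qed.

End Supply.

(** Here a = ln z and N = z ^ (4 k): the left side is about 4 k a N, while the primes up to z
    account for about k a N only, so the larger primes must supply the rest. *)
Lemma primes_one_mod_arith (R : realType) (k a N z L T' : R) : 2 <= k -> 5 <= a -> 0 < N -> 1 <= z ->
  L <= 5 * k ^+ 2 * a -> 0 <= L -> 10 * k ^+ 3 * z <= N -> z <= N -> 0 <= T' ->
  N * (4 * k * a) - N <= k * N * (a + 6) + (z + 1) * (k * L) + T' * (k * L * (N / z + 1)) ->
  z <= 10 * k ^+ 2 * T'.
Proof.
move=> k2 a5 N0 z1 hL L0 hz zN T0 H.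
have z0 : 0 < z by lra.
have ak : 0 < k * a by rewrite mulr_gt0; lra.
have h1 : k * L <= 5 * k ^+ 3 * a.
  rewrite (_ : 5 * k ^+ 3 * a = k * (5 * k ^+ 2 * a)); last by ring.
  by rewrite ler_wpM2l //; lra.
have kL0 : 0 <= k * L by rewrite mulr_ge0 //; lra.
have h2 : (z + 1) * (k * L) <= N * a.
  apply: (@le_trans _ _ ((2 * z) * (5 * k ^+ 3 * a))).
    by apply: ler_pM => //; lra.
  have -> : 2 * z * (5 * k ^+ 3 * a) = 10 * k ^+ 3 * z * a by ring.
  by rewrite ler_wpM2r //; lra.
have h3 : N / z + 1 <= 2 * (N / z).
  have : 1 <= N / z by rewrite ler_pdivlMr // mul1r.
  lra.
have h4 : T' * (k * L * (N / z + 1)) <= T' * (5 * k ^+ 3 * a * (2 * (N / z))).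
  rewrite ler_wpM2l //; apply: ler_pM => //.
  by rewrite addr_ge0 // divr_ge0 // ltW.
have h5 : N * (4 * k * a) - N <= k * N * (a + 6) + N * a + N * (T' * (10 * k ^+ 3 * a) / z).
  apply: le_trans H _; have -> : N * (T' * (10 * k ^+ 3 * a) / z) = T' * (5 * k ^+ 3 * a * (2 * (N / z))) by ring.
  by apply: lerD => //; apply: lerD.
have h6 : k * a <= T' * (10 * k ^+ 3 * a) / z.
  have : N * (3 * k * a - 6 * k - a - 1) <= N * (T' * (10 * k ^+ 3 * a) / z) by lra.
  rewrite ler_pM2l //; apply: le_trans.
  have : 0 <= (k - 2) * a by rewrite mulr_ge0; lra.
  have : 0 <= k * (a - 5) by rewrite mulr_ge0; lra.
  lra.
move: h6; rewrite ler_pdivlMr // (_ : T' * (10 * k ^+ 3 * a) = k * a * (10 * k ^+ 2 * T')); last by ring.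
by rewrite ler_pM2l.
Qed.

(* The values of the cyclotomic polynomial Phi_k at multiples of k only have prime factors = 1 mod k, and few of
   the values are divisible by a given prime power, so many primes are needed to make up their product. *)
Lemma primes_one_mod (R : realType) (k : nat) : (2 <= k)%N -> exists M e : nat, forall T : nat,
  exists s : seq nat, [/\ uniq s, (T < size s)%N &
    forall p, p \in s -> [/\ prime p, (k %| p.-1)%N & (p <= (M * T.+1) ^ e)%N]].
Proof.
move=> k2; have k0 : (0 < k)%N by rewrite ltnW.
pose m0 := (Num.truncn (expR 5 : R)).+1.
exists (16 * k ^ 2 * m0)%N, ((4 * k).+1 * k)%N => T.
(* [primes_one_mod_arith] yields at least z / (10 k ^ 2) primes, more than T because 16 > 10; the
   factor [m0] ensures ln z >= 5. *)
set z := (16 * k ^ 2 * m0 * T.+1)%N.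
have zm : (m0 <= z)%N by rewrite /z -mulnA mulnCA leq_pmulr // muln_gt0 muln_gt0 expn_gt0 k0.
have zk : (16 * k ^ 2 <= z)%N by rewrite /z -mulnA leq_pmulr.
have z0 : (0 < z)%N by apply: leq_trans zm.
have a5 : 5 <= ln z%:R :> R.
  rewrite -[5]expRK ler_ln ?posrE ?expR_gt0 ?ltr0n //.
  apply: le_trans (_ : _ <= m0%:R) _; last by rewrite ler_nat.
  by apply: ltW; apply: truncnS_gt.
(* A fixed power of z, so that the primes found, at most (k N) ^ k, stay polynomial in T. *)
pose N := (z ^ (4 * k))%N.
have N0 : (0 < N)%N by rewrite expn_gt0 z0.
exists (cyclo_primes k N); split; first by rewrite filter_uniq // iota_uniq.
  have := @primes_one_mod_ineq R k N z _ k2 N0 z0 (erefl _).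
  set L := ln ((k * N) ^ k)%N%:R; set S := size _ => H.
  have kz : (k <= z)%N by apply: leq_trans zk; nia.
  have lN : ln N%:R = 4 * k%:R * ln z%:R :> R.
    by rewrite /N natrX lnXn ?ltr0n // -[LHS]mulr_natl natrM.
  have hL : L <= 5 * k%:R ^+ 2 * ln z%:R.
    have -> : L = k%:R * (ln k%:R + ln N%:R).
      have kR : 0 < k%:R :> R by rewrite ltr0n.
      have NR : 0 < N%:R :> R by rewrite ltr0n.
      have E : ((k * N) ^ k)%N%:R = (k%:R * N%:R : R) ^+ k.
        by rewrite (natrX _ (k * N)%N); congr (_ ^+ _); exact: natrM.
      rewrite /L E lnXn ?mulr_gt0 //.
      by rewrite (@lnM R k%:R N%:R) ?posrE ?ltr0n // -[LHS]mulr_natl.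
    have : ln k%:R <= ln z%:R :> R by rewrite ler_ln ?posrE ?ltr0n // ler_nat.
    have k2R : 2 <= k%:R :> R by rewrite ler_nat.
    rewrite lN; move: (ln k%:R) => b ba.
    rewrite (_ : 5 * _ * _ = k%:R * (5 * k%:R * ln z%:R)); last by ring.
    rewrite ler_wpM2l ?ler0n //.
    have : 0 <= (k%:R - 1) * ln z%:R :> R by rewrite mulr_ge0 //; lra.
    lra.
  have L0 : 0 <= L by rewrite ln_ge0 // ler1n expn_gt0 muln_gt0 k0 N0.
  have NE : (z ^ 3 * z <= N)%N by rewrite -expnSr leq_pexp2l //; lia.
  have h10 : (10 * k ^ 3 <= z ^ 3)%N.
    apply: (@leq_trans ((16 * k ^ 2) ^ 3)); last by rewrite leq_exp2r.
    rewrite expnMn -expnM; apply: leq_mul; first by [].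
    by rewrite leq_pexp2l.
  have h10N : (10 * k ^ 3 * z <= N)%N by apply: leq_trans NE; rewrite leq_mul2r h10 orbT.
  have zN : (z <= N)%N by apply: leq_trans NE; rewrite leq_pmull // expn_gt0 z0.
  have : z%:R <= 10 * k%:R ^+ 2 * S%:R :> R.
    apply: (@primes_one_mod_arith R k%:R (ln z%:R) N%:R z%:R L S%:R) => //.
    - by rewrite ler_nat.
    - by rewrite ltr0n.
    - by rewrite ler1n.
    - by rewrite -natrX -!natrM ler_nat.
    - by rewrite ler_nat.
    - by rewrite -lN natr1.
  rewrite -natrX -!natrM ler_nat => h.
  have m1 : (0 < m0)%N by [].
  have : (10 * k ^ 2 * T.+1 < z)%N.
    rewrite /z; have : (0 < k ^ 2)%N by rewrite expn_gt0 k0.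
    move: (k ^ 2)%N m1 => w m1 w0.
    have h1 : (16 * w * T.+1 <= 16 * w * m0 * T.+1)%N by rewrite leq_mul2r leq_pmulr ?orbT.
    apply: leq_trans h1; nia.
  move=> h2; have := leq_trans h2 h; rewrite ltn_mul2l => /andP[_]; exact: ltnW.
move=> p /(cyclo_primesP k2)[pp kp pB]; split=> //; apply: leq_trans pB _.
rewrite expnM leq_exp2r // expnS leq_mul2r; apply/orP; right.
by apply: leq_trans zk; nia.
Qed.

(** * Dirichlet characters and autocorrelations *)

Local Open Scope complex_scope.

Section Characters.
Variable R : realType.
Implicit Types (chi f : int -> R[i]) (z w : R[i]).

(** The norm of [R[i]] takes its values in [R[i]]; this one takes them in [R], where real
    inequalities can be handled. *)
Definition nm (z : R[i]) : R := ComplexField.Normc.normc z.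

Lemma normE z : `|z| = (nm z)%:C. Proof. by []. Qed.
Lemma nm_ge0 z : 0 <= nm z. Proof. by case: z => a b; rewrite /nm /= sqrtr_ge0. Qed.
Lemma nmM z w : nm (z * w) = nm z * nm w. Proof. exact: ComplexField.Normc.normcM. Qed.
Lemma nmD z w : nm (z + w) <= nm z + nm w. Proof. exact: le_normcD. Qed.
Lemma nm0 : nm 0 = 0. Proof. exact: ComplexField.Normc.normc0. Qed.
Lemma nm1 : nm 1 = 1. Proof. exact: ComplexField.Normc.normc1. Qed.
Lemma nmN z : nm (- z) = nm z. Proof. exact: normcN. Qed.
Lemma nm_real (x : R) : nm x%:C = `|x|.
Proof. by rewrite /nm /= expr0n addr0 sqrtr_sqr. Qed.
Lemma nmX z n : nm (z ^+ n) = nm z ^+ n.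
Proof. by elim: n => [|n IH]; rewrite ?expr0 ?nm1 // !exprS nmM IH. Qed.
Lemma nm_conj z : nm (conjc z) = nm z.
Proof. by case: z => a b; rewrite /nm /= sqrrN. Qed.
Lemma nm_mulconj z : z * conjc z = (nm z ^+ 2)%:C.
Proof.
case: z => a b; rewrite /nm /= sqr_sqrtr ?addr_ge0 ?sqr_ge0 //.
by simpc; congr (_ +i* _); ring.
Qed.
Lemma nm_sum (I : Type) (r : seq I) (P : pred I) (F : I -> R[i]) :
  nm (\sum_(i <- r | P i) F i) <= \sum_(i <- r | P i) nm (F i).
Proof.
apply: (big_ind2 (fun x y => nm x <= y)); rewrite ?nm0 // => x1 x2 y1 y2 h1 h2.
by apply: le_trans (nmD _ _) _; apply: lerD.
Qed.
Lemma Re_le_nm z : complex.Re z <= nm z.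
Proof.
case: z => a b; rewrite /nm /=; apply: le_trans (ler_norm a) _.
by rewrite -sqrtr_sqr ler_sqrt ?addr_ge0 ?sqr_ge0 // lerDl sqr_ge0.
Qed.

Definition nonprincipal (q : nat) chi := exists2 t : int, coprimez t q%:Z & chi t != 1.

Definition periodic (T : Type) (q : nat) (F : int -> T) := forall a b : int, (q%:Z %| a - b)%Z -> F a = F b.

Lemma periodicP (T : Type) (q : nat) (F : int -> T) : (forall n : int, F (n + q%:Z) = F n) -> periodic q F.
Proof.
move=> H; have Hn (n : nat) a : F (a + (n * q)%N%:Z) = F a.
  elim: n => [|n IH]; first by rewrite mul0n addr0.
  by rewrite mulSn PoszD addrCA addrA [q%:Z + a]addrC -addrA [q%:Z + _]addrC addrA H IH.
move=> a b /dvdzP[c]; move/(canRL (subrK _)) => ->.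
case: (intP c) => [|n|n]; first by rewrite mul0r add0r.
  by rewrite addrC -PoszM Hn.
by rewrite -[LHS](Hn n.+1) mulNr PoszM addrAC addNr add0r.
Qed.

Section OneChar.
Variables (q : nat) (chi : int -> R[i]).
Hypothesis hchi : dirichlet_char q chi.

Lemma dc_q0 : (0 < q)%N. Proof. by case: hchi. Qed.
Lemma dcM m n : chi (m * n) = chi m * chi n. Proof. by case: hchi. Qed.
Lemma dc_per : periodic q chi. Proof. by apply: periodicP; case: hchi. Qed.
Lemma dc_neq0 n : (chi n != 0) = coprimez n q%:Z. Proof. by case: hchi. Qed.
Lemma dc_eq0 n : ~~ coprimez n q%:Z -> chi n = 0.
Proof. by rewrite -dc_neq0 negbK => /eqP. Qed.

Lemma dc1 : chi 1 = 1.
Proof.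
have h : chi 1 != 0 by rewrite dc_neq0 /coprimez /gcdz /= gcd1n.
by apply: (mulIf h); rewrite -dcM mulr1 mul1r.
Qed.

Lemma dcX (m : int) n : chi (m ^+ n) = chi m ^+ n.
Proof. by elim: n => [|n IH]; rewrite ?expr0 ?dc1 // !exprS dcM IH. Qed.

(** By Euler's theorem a nonzero value is a root of unity. *)
Lemma dc_nm n : coprimez n q%:Z -> nm (chi n) = 1.
Proof.
move=> cn; have q0 := dc_q0.
have [m [mn mE]] : exists m : nat, chi n = chi m%:Z /\ coprime m q.
  exists `|(n %% q%:Z)%Z|%N; have m0 : (0 <= n %% q%:Z)%Z by rewrite modz_ge0 // eqz_nat -lt0n.
  have E : chi n = chi `|(n %% q%:Z)%Z|%N%:Z.
    apply: dc_per; rewrite gez0_abs // {1}(divz_eq n q%:Z) addrK.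
    exact: dvdz_mull.
  split=> //; have : chi `|(n %% q%:Z)%Z|%N%:Z != 0 by rewrite -E dc_neq0.
  by rewrite dc_neq0 coprimezE.
rewrite mn; have hp : chi m%:Z ^+ totient q = 1.
  rewrite -dcX -dc1; apply: dc_per.
  rewrite -eqz_mod_dvd -PoszXn !modz_nat; apply/eqP; congr Posz.
  exact: Euler_exp_totient.
have := congr1 nm hp; rewrite nmX nm1 => /eqP.
by rewrite pexpr_eq1 ?nm_ge0 ?totient_gt0 // => /eqP.
Qed.

Lemma dc_nm_le1 n : nm (chi n) <= 1.
Proof.
by case: (boolP (coprimez n q%:Z)) => [/dc_nm -> //|/dc_eq0 ->]; rewrite nm0 ler01.
Qed.

End OneChar.
End Characters.

Section Sums.
Variable R : realType.
Implicit Types (chi f : int -> R[i]).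

Lemma sum_affine (q : nat) (F : int -> R[i]) (a b : int) : (0 < q)%N -> periodic q F ->
  coprimez a q%:Z -> \sum_(0 <= i < q) F (a * i%:Z + b) = \sum_(0 <= i < q) F i%:Z.
Proof.
move=> q0 perF cop; rewrite !big_mkord.
have qz : q%:Z != 0 by rewrite eqz_nat -lt0n.
have hlt (i : 'I_q) : (`|((a * i%:Z + b) %% q%:Z)%Z| < q)%N.
  rewrite -ltz_nat gez0_abs ?modz_ge0 //; exact: ltz_pmod.
pose h (i : 'I_q) := Ordinal (hlt i).
have hE i : (h i)%:Z = ((a * i%:Z + b) %% q%:Z)%Z by rewrite /= gez0_abs ?modz_ge0.
have hinj : injective h.
  move=> i j /(congr1 (fun x : 'I_q => x%:Z)); rewrite !hE => /eqP.
  rewrite eqz_mod_dvd opprD addrACA subrr addr0 -mulrBr Gauss_dvdzr; last by rewrite coprimez_sym.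
  rewrite dvdzE /= => hd; apply/val_inj => /=.
  have := ltn_ord i; have := ltn_ord j; case: (posnP `|i%:Z - j%:Z|) => [|p0]; first by lia.
  by have := dvdn_leq p0 hd; lia.
rewrite [RHS](reindex_inj hinj) /=; apply: eq_bigr => i _; apply: perF.
by rewrite -[X in _ - X%:Z]/(nat_of_ord (h i)) hE -eqz_mod_dvd modz_mod.
Qed.

Lemma sum_nonprincipal (q : nat) chi : dirichlet_char q chi -> nonprincipal q chi ->
  \sum_(0 <= i < q) chi i%:Z = 0.
Proof.
move=> hc [t ct t1].
have := sum_affine 0 (dc_q0 hc) (dc_per hc) ct.
rewrite (eq_bigr (fun i : nat => chi t * chi i%:Z)) => [|i _]; last by rewrite addr0 (dcM hc).
rewrite -mulr_sumr => /eqP; rewrite -subr_eq0 -{2}[\sum_(_ <= _ < _) _]mul1r -mulrBl.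
by rewrite mulf_eq0 subr_eq0 (negbTE t1) => /eqP.
Qed.

Lemma sum_block_le (q : nat) chi (a b : int) (n : nat) : dirichlet_char q chi -> nonprincipal q chi ->
  coprimez a q%:Z -> nm (\sum_(0 <= j < n) chi (a * j%:Z + b)) <= q%:R.
Proof.
move=> hc np cop; have [m] := ubnP n; elim: m n => // m IH n nm'.
case: (ltnP n q) => nq.
  apply: le_trans (nm_sum _ _ _) _; apply: (@le_trans _ _ (\sum_(0 <= j < n) 1)).
    by apply: ler_sum => j _; apply: (dc_nm_le1 hc).
  by rewrite sumr_const_nat subn0 ler_nat ltnW.
rewrite (@big_cat_nat _ _ _ (n - q)) ?leq_subr //=.
rewrite [X in _ + X](_ : _ = 0).
  rewrite addr0; apply: IH; have := dc_q0 hc; lia.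
rewrite -{1}[(n - q)%N]add0n big_addn subKn //.
rewrite (eq_bigr (fun j : nat => chi (a * j%:Z + (a * (n - q)%N%:Z + b)))) => [|j _].
  by rewrite (sum_affine _ (dc_q0 hc) (dc_per hc) cop) sum_nonprincipal.
by rewrite PoszD mulrDr addrA.
Qed.

Lemma sum_nat_block (q1 q2 : nat) (G : nat -> R[i]) :
  \sum_(0 <= x < q1 * q2) G x = \sum_(0 <= i < q1) \sum_(0 <= j < q2) G (i * q2 + j)%N.
Proof.
elim: q1 => [|q1 IH]; first by rewrite mul0n !big_geq.
rewrite [RHS]big_nat_recr //= -IH (@big_cat_nat _ _ _ (q1 * q2)) //=; last by rewrite leq_mul2r leqnSn orbT.
congr (_ + _); rewrite -{1}[(q1 * q2)%N]add0n big_addn mulSn addnK.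
by apply: eq_bigr => j _; rewrite addnC.
Qed.

Lemma sum_crt (q1 q2 : nat) (F1 F2 : int -> R[i]) : (0 < q1)%N -> (0 < q2)%N -> coprime q1 q2 ->
  periodic q1 F1 -> periodic q2 F2 ->
  \sum_(0 <= x < q1 * q2) F1 x%:Z * F2 x%:Z =
  (\sum_(0 <= x < q1) F1 x%:Z) * (\sum_(0 <= x < q2) F2 x%:Z).
Proof.
move=> q10 q20 cop per1 per2; rewrite (sum_nat_block q1 q2 (fun x => F1 x%:Z * F2 x%:Z)).
rewrite exchange_big /= mulr_sumr; apply: eq_bigr => j _.
have cop' : coprimez q2%:Z q1%:Z by rewrite coprimezE /= coprime_sym.
rewrite -(sum_affine j%:Z q10 per1 cop') mulr_suml; apply: eq_bigr => i _.
congr (_ * _); first by rewrite PoszD PoszM mulrC.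
by apply: per2; rewrite PoszD addrK PoszM dvdz_mull.
Qed.

Definition autocorr (q : nat) f (h : int) : R[i] :=
  \sum_(0 <= x < q) f (x%:Z + h) * conjc (f x%:Z).

Lemma autocorr_prod (q1 q2 : nat) f1 f2 h : dirichlet_char q1 f1 -> dirichlet_char q2 f2 ->
  coprime q1 q2 ->
  autocorr (q1 * q2) (fun n => f1 n * f2 n) h = autocorr q1 f1 h * autocorr q2 f2 h.
Proof.
move=> h1 h2 cop; rewrite /autocorr.
have per q f : dirichlet_char q f -> periodic q (fun x : int => f (x + h) * conjc (f x)).
  move=> hf a b ab; rewrite (dc_per hf ab); congr (_ * _); apply: (dc_per hf).
  by rewrite opprD addrACA subrr addr0.
rewrite -(sum_crt (dc_q0 h1) (dc_q0 h2) cop (per _ _ h1) (per _ _ h2)).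
by apply: eq_bigr => x _; rewrite rmorphM /= mulrACA.
Qed.

Lemma autocorr_le (q : nat) f h : dirichlet_char q f -> nm (autocorr q f h) <= q%:R.
Proof.
move=> hf; apply: le_trans (nm_sum _ _ _) _; apply: (@le_trans _ _ (\sum_(0 <= j < q) 1)).
  apply: ler_sum => x _; rewrite nmM nm_conj -[leRHS]mulr1.
  by apply: ler_pM; rewrite ?nm_ge0 ?(dc_nm_le1 hf).
by rewrite sumr_const_nat subn0.
Qed.

Lemma autocorr0_prime (p : nat) chi : prime p -> dirichlet_char p chi -> autocorr p chi 0 = (p.-1)%:R.
Proof.
move=> pp hc; rewrite /autocorr; case: p pp hc => // p pp hc.
rewrite big_nat_recl //= (dc_eq0 hc) ?mul0r ?add0r; last first.
  by rewrite coprimezE /coprime /= gcd0n; case: p pp {hc}.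
rewrite (eq_big_nat _ _ (F2 := fun=> 1)) => [|i /andP[_ ip]]; last first.
  rewrite addr0 nm_mulconj (dc_nm hc) ?expr1n // coprimezE /= coprime_sym prime_coprime //.
  by rewrite gtnNdvd // ltnS.
by rewrite sumr_const_nat subn0.
Qed.

(* The values at h prime to p are all equal (substitute x -> h x), and the values at all h sum to 0. *)
Lemma autocorr_prime (p : nat) chi h : prime p -> dirichlet_char p chi -> nonprincipal p chi ->
  nm (autocorr p chi h) <= (gcdn `|h| p)%:R.
Proof.
move=> pp hc np; have p0 := prime_gt0 pp.
have eqc (u : int) : coprimez u p%:Z -> autocorr p chi u = autocorr p chi 1.
  move=> cu; rewrite /autocorr.
  have per : periodic p (fun x : int => chi (x + u) * conjc (chi x)).
    move=> a b ab; rewrite (dc_per hc ab); congr (_ * _); apply: (dc_per hc).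
    by rewrite opprD addrACA subrr addr0.
  rewrite -(sum_affine 0 p0 per cu); apply: eq_bigr => x _; rewrite addr0.
  rewrite -{2}[u]mulr1 -mulrDr !(dcM hc) rmorphM /= mulrACA.
  by rewrite nm_mulconj (dc_nm hc cu) expr1n mul1r.
have tot : \sum_(0 <= u < p) autocorr p chi u%:Z = 0.
  rewrite /autocorr exchange_big /= big1 // => x _.
  rewrite -mulr_suml; have := sum_affine x%:Z p0 (dc_per hc) (coprime1n p : coprimez 1 p%:Z).
  rewrite sum_nonprincipal // => E.
  by rewrite (eq_bigr (fun u : nat => chi (1 * u%:Z + x%:Z))) ?E ?mul0r // => u _; rewrite mul1r addrC.
have c1 : autocorr p chi 1 = -1.
  move: tot; case: p pp hc np p0 eqc => // p pp hc np p0 eqc.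
  rewrite big_nat_recl // autocorr0_prime //=.
  rewrite (eq_big_nat _ _ (F2 := fun=> autocorr p.+1 chi 1)) => [|i /andP[_ ip]]; last first.
    by apply: eqc; rewrite coprimezE /= coprime_sym prime_coprime // gtnNdvd // ltnS.
  rewrite sumr_const_nat subn0 -[X in _ + X]mulr_natl -{1}[p%:R]mulr1 -mulrDr => /eqP.
  rewrite mulf_eq0 pnatr_eq0; case/orP => [/eqP p00|]; first by move: pp; rewrite p00.
  by rewrite addrC addr_eq0 => /eqP.
case: (boolP (coprimez h p%:Z)) => [ch|].
  by rewrite eqc // c1 nmN nm1 ler1n gcdn_gt0 p0 orbT.
rewrite coprimezE /= coprime_sym prime_coprime // negbK => ph.
by rewrite (gcdn_idPr ph); apply: autocorr_le.
Qed.

Lemma dc_prod (q1 q2 : nat) f1 f2 : dirichlet_char q1 f1 -> dirichlet_char q2 f2 ->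
  dirichlet_char (q1 * q2) (fun n => f1 n * f2 n).
Proof.
move=> h1 h2; split.
- by rewrite muln_gt0 (dc_q0 h1) (dc_q0 h2).
- by move=> m n; rewrite (dcM h1) (dcM h2) mulrACA.
- move=> n; congr (_ * _); [apply: (dc_per h1)|apply: (dc_per h2)];
    rewrite addrAC subrr add0r PoszM; [exact: dvdz_mulr|exact: dvdz_mull].
- by move=> n; rewrite mulf_eq0 negb_or (dc_neq0 h1) (dc_neq0 h2) PoszM coprimezMr.
Qed.

Lemma crt_int (q1 q2 : nat) (a b : int) : coprime q1 q2 ->
  exists t : int, (q1%:Z %| t - a)%Z /\ (q2%:Z %| t - b)%Z.
Proof.
move=> cop; exists (zchinese q1%:Z q2%:Z a b).
have c : coprimez q1%:Z q2%:Z by rewrite coprimezE.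
by split; rewrite -eqz_mod_dvd; [rewrite zchinese_modl|rewrite zchinese_modr].
Qed.

Lemma coprimez_mod (a b : int) (q : nat) : (q%:Z %| a - b)%Z -> coprimez a q%:Z = coprimez b q%:Z.
Proof.
move=> /dvdzP[c /(canRL (subrK _)) ->].
by rewrite /coprimez gcdzC gcdzMDl gcdzC.
Qed.

End Sums.

(** * Primitivity of products over coprime moduli *)

Section Primitive.
Variable R : realType.
Implicit Types (chi f : int -> R[i]).

Lemma gcd_split (d q1 q2 : nat) : coprime q1 q2 -> (d %| q1 * q2)%N ->
  (gcdn d q1 * gcdn d q2 = d)%N.
Proof.
move=> cop dq; apply/eqP; rewrite eqn_dvd; apply/andP; split.
  rewrite Gauss_dvd ?dvdn_gcdl //.
  apply: coprime_dvdl (dvdn_gcdr d q1) _; exact: coprime_dvdr (dvdn_gcdr d q2) cop.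
rewrite muln_gcdl dvdn_gcd dvdn_mulr //= muln_gcdr dvdn_gcd dq dvdn_mull //.
Qed.

Lemma dvdz_natP (a b : nat) (x : int) : (a %| b)%N -> (b%:Z %| x)%Z -> (a%:Z %| x)%Z.
Proof. by move=> ab; apply: dvdz_trans; rewrite dvdzE. Qed.

(** The factor modulo q2 is frozen by the Chinese remainder theorem: [s n] is n modulo d1 and 1
    modulo d2, and [psi] along [s] is a character modulo d1 that induces f1. *)
Lemma induced_prod_l (q1 q2 d : nat) f1 f2 : dirichlet_char q1 f1 -> dirichlet_char q2 f2 ->
  coprime q1 q2 -> induced_from (q1 * q2) (fun n => f1 n * f2 n) d ->
  induced_from q1 f1 (gcdn d q1).
Proof.
move=> h1 h2 cop [dq [psi [hpsi E]]].
set d1 := gcdn d q1; set d2 := gcdn d q2.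
have dE : (d1 * d2 = d)%N by exact: gcd_split.
have d10 : (0 < d1)%N by rewrite gcdn_gt0 (dc_q0 h1) orbT.
have c12 : coprime d1 d2.
  apply: coprime_dvdl (dvdn_gcdr d q1) _; exact: coprime_dvdr (dvdn_gcdr d q2) cop.
split; first exact: dvdn_gcdr.
have cz : coprimez d1%:Z d2%:Z by rewrite coprimezE.
have [s [s1 s2]] : exists s : int -> int,
    (forall n, (d1%:Z %| s n - n)%Z) /\ (forall n, (d2%:Z %| s n - 1)%Z).
  by exists (fun n => zchinese d1%:Z d2%:Z n 1); split=> n; rewrite -eqz_mod_dvd ?zchinese_modl ?zchinese_modr.
have perd a b : (d1%:Z %| a - b)%Z -> (d2%:Z %| a - b)%Z -> psi a = psi b.
  by move=> ha hb; apply: (dc_per hpsi); rewrite -dE PoszM Gauss_dvdz // ha hb.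
exists (fun n => psi (s n)); split; first split => //.
- move=> m n; rewrite -(dcM hpsi); apply: perd.
    have -> : s (m * n) - s m * s n = (s (m * n) - m * n) - (s m * (s n - n) + n * (s m - m)) by ring.
    by apply: rpredB; [exact: s1|apply: rpredD; apply: dvdz_mull; exact: s1].
  have -> : s (m * n) - s m * s n = (s (m * n) - 1) - (s m * (s n - 1) + (s m - 1)) by ring.
  by apply: rpredB; [exact: s2|apply: rpredD; [apply: dvdz_mull|]; exact: s2].
- move=> n; apply: perd.
    have -> : s (n + d1%:Z) - s n = (s (n + d1%:Z) - (n + d1%:Z)) - (s n - n) + d1%:Z by ring.
    by apply: rpredD; [apply: rpredB; exact: s1|exact: dvdzz].
  have -> : s (n + d1%:Z) - s n = (s (n + d1%:Z) - 1) - (s n - 1) by ring.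
  by apply: rpredB; exact: s2.
- move=> n; rewrite (dc_neq0 hpsi) -dE PoszM coprimezMr.
  rewrite (coprimez_mod (s1 n)) (coprimez_mod (s2 n)).
  by rewrite [coprimez 1 _]coprimezE /= coprime1n andbT.
move=> n cn; have [t [t1 t2]] := crt_int n 1 cop.
have <- : f1 t = f1 n by exact: (dc_per h1).
have ct : coprimez t (q1 * q2)%N%:Z.
  rewrite PoszM coprimezMr (coprimez_mod t1) cn (coprimez_mod t2).
  by rewrite coprimezE /= coprime1n.
have := E _ ct; rewrite (dc_per h2 t2) (dc1 h2) mulr1 => ->.
apply: perd.
  have -> : t - s n = (t - n) - (s n - n) by ring.
  by apply: rpredB; [exact: (dvdz_natP (dvdn_gcdr _ _) t1)|exact: s1].
have -> : t - s n = (t - 1) - (s n - 1) by ring.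
by apply: rpredB; [exact: (dvdz_natP (dvdn_gcdr _ _) t2)|exact: s2].
Qed.

Lemma primitive_prod (q1 q2 : nat) f1 f2 : primitive_char q1 f1 -> primitive_char q2 f2 ->
  coprime q1 q2 -> primitive_char (q1 * q2) (fun n => f1 n * f2 n).
Proof.
move=> [h1 p1] [h2 p2] cop; split; first exact: dc_prod.
move=> d hd; have [dq _] := hd.
have e1 := p1 _ (induced_prod_l h1 h2 cop hd).
have e2 : gcdn d q2 = q2.
  apply: p2; apply: (induced_prod_l h2 h1 _); first by rewrite coprime_sym.
  rewrite mulnC; have -> // : (fun n => f2 n * f1 n) = (fun n => f1 n * f2 n).
  by apply: funext => n; rewrite mulrC.
by rewrite -(gcd_split cop dq) e1 e2.
Qed.

Lemma dc_modn1 chi : dirichlet_char 1 chi -> forall n, chi n = 1.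
Proof. by move=> h n; rewrite -(dc1 h); apply: (dc_per h); rewrite dvd1z. Qed.

Lemma dc_triv : dirichlet_char 1 (fun _ : int => 1 : R[i]).
Proof.
by split=> // [m n|n]; rewrite ?mulr1 // oner_neq0 coprimezE /= coprimen1.
Qed.

Lemma primitive_triv : primitive_char 1 (fun _ : int => 1 : R[i]).
Proof. by split=> [|d [d1 _]]; [exact: dc_triv|apply/eqP; rewrite -dvdn1]. Qed.

Lemma primitive_prime (p : nat) chi : prime p -> dirichlet_char p chi -> nonprincipal p chi ->
  primitive_char p chi.
Proof.
move=> pp hc [t ct t1]; split=> // d [dp [psi [hpsi E]]].
have [_ /(_ _ dp)/orP[/eqP d1|/eqP//]] := primeP pp.
by rewrite d1 in hpsi; move: t1; rewrite E // (dc_modn1 hpsi) eqxx.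
Qed.

Lemma primitive_nonprincipal (q : nat) chi : (1 < q)%N -> primitive_char q chi -> nonprincipal q chi.
Proof.
move=> q1 [hc hp]; apply: contrapT => np.
have : 1%N = q.
  apply: hp; split; first exact: dvd1n.
  exists (fun=> 1); split; first exact: dc_triv.
  move=> n cn; apply: contrapT => h; apply: np; exists n => //; exact/eqP.
by move=> e; rewrite -e in q1.
Qed.

Lemma nonprincipal_prod_r (q1 q2 : nat) f1 f2 : dirichlet_char q1 f1 -> dirichlet_char q2 f2 ->
  coprime q1 q2 -> nonprincipal q2 f2 -> nonprincipal (q1 * q2) (fun n => f1 n * f2 n).
Proof.
move=> h1 h2 cop [t ct t1]; have [u [u1 u2]] := crt_int 1 t cop.
exists u; last by rewrite (dc_per h1 u1) (dc1 h1) mul1r (dc_per h2 u2).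
rewrite PoszM coprimezMr (coprimez_mod u1) (coprimez_mod u2) ct andbT.
by rewrite coprimezE /= coprime1n.
Qed.

Lemma dc_principal (l : nat) : (0 < l)%N -> dirichlet_char l (@principal_char R l).
Proof.
move=> l0; split=> // [m n|n|n]; rewrite /principal_char.
- rewrite coprimezMl; case: (coprimez m _); rewrite ?mul0r ?mul1r //.
- by rewrite (_ : coprimez (n + l%:Z) l%:Z = coprimez n l%:Z) //; apply: coprimez_mod; rewrite addrAC subrr add0r dvdzz.
- by case: ifP; rewrite ?oner_neq0 ?eqxx.
Qed.

Lemma dc_conj (q : nat) chi : dirichlet_char q chi -> dirichlet_char q (fun n => conjc (chi n)).
Proof.
move=> h; split=> [|m n|n|n]; first exact: dc_q0 h.
- by rewrite (dcM h) rmorphM.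
- by congr conjc; case: h.
- by rewrite conjc_eq0 (dc_neq0 h).
Qed.

Lemma nonprincipal_conj (q : nat) chi : nonprincipal q chi -> nonprincipal q (fun n => conjc (chi n)).
Proof.
move=> [t ct t1]; exists t => //; apply: contra t1 => /eqP h.
by rewrite -[chi t]conjcK h conjc1.
Qed.

(* Primitivity together with the autocorrelation bound: both pass to products of characters with coprime moduli. *)
Definition good (m : nat) chi := primitive_char m chi /\
  forall h : int, nm (autocorr m chi h) <= (gcdn `|h| m)%:R.

Lemma good_triv : good 1 (fun _ : int => 1 : R[i]).
Proof.
split; first exact: primitive_triv.
by move=> h; rewrite gcdn1; exact: autocorr_le dc_triv.
Qed.

Lemma good_prime (p : nat) chi : prime p -> dirichlet_char p chi -> nonprincipal p chi -> good p chi.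
Proof. by move=> pp hc np; split; [exact: primitive_prime|move=> h; exact: autocorr_prime]. Qed.

Lemma gcdn_mul_coprime (h m n : nat) : coprime m n -> (gcdn h m * gcdn h n = gcdn h (m * n))%N.
Proof.
move=> cop; rewrite -[RHS](@gcd_split _ m n cop (dvdn_gcdr _ _)).
by rewrite -!gcdnA (gcdn_idPr (dvdn_mulr n (dvdnn m))) (gcdn_idPr (dvdn_mull m (dvdnn n))).
Qed.

Lemma good_prod (q1 q2 : nat) f1 f2 : good q1 f1 -> good q2 f2 -> coprime q1 q2 ->
  good (q1 * q2) (fun n => f1 n * f2 n).
Proof.
move=> [p1 a1] [p2 a2] cop; split; first exact: primitive_prod.
move=> h; rewrite (autocorr_prod h p1.1 p2.1 cop) nmM -gcdn_mul_coprime // natrM.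
by apply: ler_pM; rewrite ?nm_ge0.
Qed.

Lemma good_bigprod (s : seq nat) (F : nat -> int -> R[i]) : uniq s ->
  (forall p, p \in s -> prime p /\ (dirichlet_char p (F p) /\ nonprincipal p (F p))) ->
  good (\prod_(p <- s) p)%N (fun n => \prod_(p <- s) F p n).
Proof.
elim: s => [|p s IH] /=.
  move=> _ _; rewrite big_nil; have -> : (fun n : int => \prod_(p <- [::]) F p n) = (fun=> 1) :> (int -> R[i]).
    by apply: funext => n; rewrite big_nil.
  exact: good_triv.
move=> /andP[ps us] H; rewrite big_cons.
have -> : (fun n : int => \prod_(q <- p :: s) F q n) = (fun n => F p n * \prod_(q <- s) F q n).
  by apply: funext => n; rewrite big_cons.
have [pp [hc np]] := H p (mem_head _ _).
apply: good_prod; first exact: good_prime.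
  by apply: IH => // q qs; apply: H; rewrite in_cons qs orbT.
rewrite prime_coprime //; apply/negP.
have : forall q, q \in s -> prime q by move=> q qs; have [] := H q; rewrite ?in_cons ?qs ?orbT.
elim: s ps us {IH H} => [|q s IH] /=; first by rewrite big_nil dvdn1 => _ _ _ /eqP p1; rewrite p1 in pp.
rewrite in_cons negb_or => /andP[pq ps] /andP[_ us] H; rewrite big_cons Euclid_dvdM //.
rewrite (dvdn_prime2 pp (H q (mem_head _ _))) (negbTE pq) /=; apply: IH => // r rs; apply: H.
by rewrite in_cons rs orbT.
Qed.

End Primitive.

(** * The tail of the L-series *)

Section Tail.
Local Open Scope classical_set_scope.
Local Open Scope ring_scope.
Local Open Scope complex_scope.
Variable R : realType.
Implicit Types (chi f : int -> R[i]).

Lemma real_cauchy (u : nat -> R) (B : R) : 0 <= B ->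
  (forall m M, (m <= M)%N -> `|u M - u m| <= B / m.+1%:R) ->
  exists x : R, forall m, `|x - u m| <= B / m.+1%:R.
Proof.
move=> B0 hu; have : cvgn u.
  apply/cauchy_cvgP; apply: cauchy_exP => e e0.
  pose m := Num.truncn (B / e).
  have hm : B / m.+1%:R < e.
    rewrite ltr_pdivrMr ?ltr0Sn // mulrC -ltr_pdivrMr //; exact: truncnS_gt.
  exists (u m); exists m => // n /= mn; rewrite -ball_normE /= distrC.
  by apply: le_lt_trans hm; apply: hu.
move=> cu; exists (limn u) => m; apply/ler_addgt0Pr => e e0.
have /cvgrPdist_lt/(_ _ e0) [n0 _ hn] := cu.
pose n := maxn n0 m.
have h1 := hn n (leq_maxl _ _); have h2 := hu m n (leq_maxr _ _).
rewrite -(subrK (u n) (limn u)) -addrA addrC; apply: le_trans (ler_normD _ _) _.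
by apply: lerD => //; apply: ltW.
Qed.

Lemma nm_le_ReIm (z : R[i]) : nm z <= `|complex.Re z| + `|complex.Im z|.
Proof.
rewrite {1}(complexE z); apply: le_trans (nmD _ _) _.
rewrite nmM !nm_real; have -> : nm 'i%C = 1 :> R by rewrite /nm /= expr0n add0r expr1n sqrtr1.
by rewrite mul1r.
Qed.

Lemma normr_Re_le_nm (z : R[i]) : `|complex.Re z| <= nm z.
Proof.
case: z => a b; rewrite /nm /= -sqrtr_sqr.
by rewrite ler_sqrt ?addr_ge0 ?sqr_ge0 // lerDl sqr_ge0.
Qed.

Lemma Im_le_nm (z : R[i]) : `|complex.Im z| <= nm z.
Proof.
case: z => a b; rewrite /nm /= -sqrtr_sqr.
by rewrite ler_sqrt ?addr_ge0 ?sqr_ge0 // lerDr sqr_ge0.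
Qed.

(** Real and imaginary parts converge separately, which doubles the constant. *)
Lemma complex_cauchy (u : nat -> R[i]^o) (B : R) : 0 <= B ->
  (forall m M, (m <= M)%N -> nm (u M - u m) <= B / m.+1%:R) ->
  exists z : R[i], (u @ \oo --> (z : R[i]^o)) /\ forall m, nm (z - u m) <= 2 * B / m.+1%:R.
Proof.
move=> B0 hu.
have [x hx] : exists x : R, forall m, `|x - complex.Re (u m)| <= B / m.+1%:R.
  apply: (@real_cauchy (fun m => complex.Re (u m))) => // m M mM; apply: le_trans (hu m M mM).
  by rewrite -raddfB normr_Re_le_nm.
have [y hy] : exists x : R, forall m, `|x - complex.Im (u m)| <= B / m.+1%:R.
  apply: (@real_cauchy (fun m => complex.Im (u m))) => // m M mM; apply: le_trans (hu m M mM).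
  by rewrite -raddfB Im_le_nm.
have hz m : nm (x +i* y - u m) <= 2 * B / m.+1%:R.
  apply: le_trans (nm_le_ReIm _) _; rewrite -mulrA mulr_natl mulr2n.
  by move: (hx m) (hy m); case: (u m) => a b /= *; apply: lerD.
exists (x +i* y); split=> //.
apply/cvgrPdist_le => -[e e'] he.
have {he} [-> e0] : e' = 0 /\ 0 < e.
  by move: he; rewrite ltcE /= => /andP[/eqP -> ->].
pose m := Num.truncn (2 * B / e).
exists m => // n /= mn; rewrite normE lecR; apply: le_trans (hz n) _.
rewrite ler_pdivrMr ?ltr0Sn // [e * _]mulrC -ler_pdivrMr //.
by apply: ltW; apply: lt_le_trans (truncnS_gt _) _; rewrite ler_nat ltnS.
Qed.

Definition inv_succ (k : nat) : R := k.+1%:R^-1.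

Lemma inv_succ_dec (k : nat) : 0 <= inv_succ k - inv_succ k.+1.
Proof. by rewrite subr_ge0 /inv_succ lef_pV2 ?posrE ?ltr0Sn // ler_nat. Qed.

Lemma inv_succ_ge0 k : 0 <= inv_succ k. Proof. by rewrite invr_ge0. Qed.

(** Summation by parts: the weights decrease, so their total variation and their last value add up
    to the first weight. *)
Lemma abel_le (a : nat -> R[i]) (B : R) (m M : nat) : (m <= M)%N ->
  (forall n, (m <= n)%N -> nm (\sum_(m <= k < n) a k) <= B) ->
  nm (\sum_(m <= k < M) a k * (inv_succ k)%:C) <= B * inv_succ m.
Proof.
move=> mM hB; have B0 : 0 <= B by apply: le_trans (hB m (leqnn m)); exact: nm_ge0.
pose A n := \sum_(m <= k < n) a k.
have E : \sum_(m <= k < M) a k * (inv_succ k)%:C = A M * (inv_succ M)%:C +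
   \sum_(m <= k < M) A k.+1 * (inv_succ k - inv_succ k.+1)%:C.
  elim: M mM => [|M IH]; first by rewrite leqn0 => /eqP m0; rewrite /A m0 !big_geq // mul0r addr0.
  rewrite leq_eqVlt => /orP[/eqP <-|mM]; first by rewrite /A !big_geq // mul0r addr0.
  rewrite !big_nat_recr //= IH //.
  have -> : A M.+1 = A M + a M by rewrite /A big_nat_recr.
  rewrite rmorphB /=; ring.
rewrite E; apply: le_trans (nmD _ _) _.
apply: (@le_trans _ _ (B * inv_succ M + \sum_(m <= k < M) B * (inv_succ k - inv_succ k.+1))).
  apply: lerD.
    rewrite nmM nm_real ger0_norm ?inv_succ_ge0 //; apply: ler_wpM2r; [exact: inv_succ_ge0|exact: hB].
  apply: le_trans (nm_sum _ _ _) _; apply: ler_sum_nat => k /andP[mk _].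
  rewrite nmM nm_real ger0_norm ?inv_succ_dec //; apply: ler_wpM2r; [exact: inv_succ_dec|].
  by apply: hB; apply: leqW.
rewrite -mulr_sumr -mulrDr ler_wpM2l //.
rewrite (@telescope_sumr_eq _ _ _ (fun i => - inv_succ i)) //; last by move=> k _; ring.
by rewrite opprK addrA subrr add0r.
Qed.

Lemma nat_cpowN1 n : nat_cpowN n.+1 (1 : R[i]) = (inv_succ n)%:C.
Proof.
rewrite /nat_cpowN /= mul1r mul0r cos0 sin0 expRN lnK ?posrE ?ltr0Sn //.
by rewrite oppr0 -[1 +i* 0]/(1 : R[i]) mulr1.
Qed.

(** Expanding the square and summing over a full period turns the pair of shifts (i, j) into the
    autocorrelation at i - j. The H diagonal pairs give at most q each, the others at most c. *)
Lemma sum_nm_sq (q : nat) f (N H : nat) (c : R) : dirichlet_char q f -> 0 <= c ->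
  (forall h : int, h != 0 -> (`|h| < H)%N -> nm (autocorr q f h) <= c) ->
  \sum_(N <= k < N + q) nm (\sum_(0 <= j < H) f (k.+1 + j)%N%:Z) ^+ 2 <=
    H%:R * q%:R + H%:R ^+ 2 * c.
Proof.
move=> hf c0 hc.
rewrite -lecR rmorph_sum /=.
under eq_bigr do rewrite -nm_mulconj rmorph_sum /= mulr_suml.
rewrite exchange_big /=.
under eq_bigr do under eq_bigr do rewrite mulr_sumr.
under eq_bigr do rewrite exchange_big /=.
have E i j : \sum_(N <= k < N + q) f (k.+1 + i)%N%:Z * conjc (f (k.+1 + j)%N%:Z) =
   autocorr q f (i%:Z - j%:Z).
  rewrite -{1}[N]add0n [(N + q)%N]addnC big_addn addnK /autocorr.
  have per : periodic q (fun x : int => f (x + (i%:Z - j%:Z)) * conjc (f x)).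
    move=> a b ab; rewrite (dc_per hf ab); congr (_ * _); apply: (dc_per hf).
    by rewrite opprD addrACA subrr addr0.
  have c1 : coprimez 1 q%:Z by rewrite coprimezE /= coprime1n.
  rewrite -(sum_affine (N.+1 + j)%N%:Z (dc_q0 hf) per c1); apply: eq_bigr => x _.
  by congr (f _ * conjc (f _)); lia.
under eq_bigr do under eq_bigr do rewrite E.
set S := \sum_(_ <= _ < _) _.
have hS : nm S <= H%:R * q%:R + H%:R ^+ 2 * c.
  apply: le_trans (nm_sum _ _ _) _.
  apply: (@le_trans _ _ (\sum_(0 <= i < H) (q%:R + H%:R * c))).
    apply: ler_sum_nat => i /andP[_ iH]; apply: le_trans (nm_sum _ _ _) _.
    apply: (@le_trans _ _ (\sum_(0 <= j < H) ((if j == i then q%:R else 0) + c))).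
      apply: ler_sum_nat => j /andP[_ jH]; case: eqP => [->|/eqP ji].
        by rewrite subrr; apply: le_trans (autocorr_le 0 hf) _; rewrite lerDl.
      by rewrite add0r; apply: hc; [rewrite subr_eq0 eqz_nat eq_sym|lia].
    rewrite big_split /= sumr_const_nat subn0 -[c *+ H]mulr_natl lerD2r.
    rewrite -big_mkcond /= big_mkord (big_pred1 (Ordinal iH)) //.
  by rewrite sumr_const_nat subn0 -[_ *+ H]mulr_natl mulrDr mulrA expr2.
have -> : S = (complex.Re S)%:C.
  have : S = (\sum_(N <= k < N + q) nm (\sum_(0 <= j < H) f (k.+1 + j)%N%:Z) ^+ 2)%:C.
    rewrite rmorph_sum /=.
    under [RHS]eq_bigr do rewrite -nm_mulconj rmorph_sum /= mulr_suml.
    rewrite exchange_big /=.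
    under [RHS]eq_bigr do under eq_bigr do rewrite mulr_sumr.
    under [RHS]eq_bigr do rewrite exchange_big /=.
    by under [RHS]eq_bigr do under eq_bigr do rewrite E.
  by move=> ->.
rewrite lecR; exact: le_trans (Re_le_nm _) hS.
Qed.

End Tail.

Section LTail.
Local Open Scope classical_set_scope.
Local Open Scope ring_scope.
Local Open Scope complex_scope.
Variable R : realType.
Implicit Types (chi f : int -> R[i]).

Definition psum f (n : nat) : R[i] := \sum_(0 <= k < n) f k.+1%:Z * (inv_succ R k)%:C.

Lemma psum_cauchy (q : nat) f : dirichlet_char q f -> nonprincipal q f ->
  forall m M, (m <= M)%N -> nm (psum f M - psum f m) <= q%:R / m.+1%:R.
Proof.
move=> hf np m M mM.
have -> : psum f M - psum f m = \sum_(m <= k < M) f k.+1%:Z * (inv_succ R k)%:C.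
  by rewrite /psum (@big_cat_nat _ _ _ m 0 M) //= addrAC subrr add0r.
apply: abel_le => // n mn.
rewrite -{1}[m]add0n big_addn.
have c1 : coprimez 1 q%:Z by rewrite coprimezE /= coprime1n.
have := @sum_block_le R q f 1 m.+1%:Z (n - m) hf np c1.
rewrite (eq_bigr (fun j : nat => f (j + m).+1%:Z)) // => j _.
by congr f; lia.
Qed.

(** For a unit shift the unweighted differences telescope to at most 2, so summation by parts bounds
    its effect by twice the first weight. *)
Lemma shift_sum_le f (N K j : nat) : (forall n, nm (f n) <= 1) -> (N <= K)%N ->
  nm (\sum_(N <= k < K) f (k.+1 + j)%N%:Z * (inv_succ R k)%:C - \sum_(N <= k < K) f k.+1%:Z * (inv_succ R k)%:C)
    <= j%:R * (2 * inv_succ R N).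
Proof.
move=> f1 NK; elim: j => [|j IH].
  rewrite mul0r (eq_bigr (fun k : nat => f k.+1%:Z * (inv_succ R k)%:C)) ?subrr ?nm0 // => k _.
  by rewrite addn0.
set T0 := \sum_(_ <= _ < _) f (_.+1)%:Z * _ in IH *.
set Tj := \sum_(_ <= _ < _) _ in IH; set Tj1 := \sum_(_ <= _ < _) _.
have -> : Tj1 - T0 = (Tj1 - Tj) + (Tj - T0) by rewrite addrA subrK.
apply: le_trans (nmD _ _) _; rewrite -natr1 mulrDl mul1r addrC; apply: lerD => //.
rewrite /Tj1 /Tj -sumrB.
under eq_bigr do rewrite -mulrBl.
apply: abel_le => // n Nn.
rewrite (@telescope_sumr_eq _ _ _ (fun k => f (k.+1 + j)%N%:Z)) //.
  by apply: le_trans (nmD _ _) _; rewrite nmN (_ : 2 = 1 + 1) ?lerD.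
by move=> k _; rewrite addnS addSn.
Qed.

(* The window is averaged over H shifts; expanding the square leaves autocorrelations. *)
Lemma window_le (q : nat) f (N H : nat) (l : R) : dirichlet_char q f ->
  0 <= l -> (forall h : int, h != 0 -> (`|h| < H)%N -> nm (autocorr q f h) <= l * H%:R) ->
  (0 < H)%N -> (H <= N)%N -> q%:R <= H%:R * N%:R :> R -> l * H%:R <= N%:R ->
  nm (psum f (N + q) - psum f N) <= 5.
Proof.
move=> hf l0 hc H0 HN qHN lHN.
have N0 : (0 < N)%N by apply: leq_trans HN.
have NR : 0 < N%:R :> R by rewrite ltr0n.
have HR : 0 < H%:R :> R by rewrite ltr0n.
have -> : psum f (N + q) - psum f N = \sum_(N <= k < N + q) f k.+1%:Z * (inv_succ R k)%:C.
  by rewrite /psum (@big_cat_nat _ _ _ N 0 (N + q)) ?leq_addr //= addrAC subrr add0r.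
set T0 := \sum_(_ <= _ < _) _.
pose T j := \sum_(N <= k < N + q) f (k.+1 + j)%N%:Z * (inv_succ R k)%:C.
(* The shift error is at most 2 j / (N + 1), and j < H <= N. *)
have hT j : (j < H)%N -> nm (T0 - T j) <= 2.
  move=> jH; rewrite -nmN opprB; apply: le_trans (shift_sum_le j (dc_nm_le1 hf) (leq_addr _ _)) _.
  rewrite mulrCA -[leRHS]mulr1 ler_wpM2l // /inv_succ ler_pdivrMr ?ltr0Sn // mul1r ler_nat.
  by apply: leq_trans (leq_trans (ltnW jH) HN) _; exact: leqnSn.
pose W k := \sum_(0 <= j < H) f (k.+1 + j)%N%:Z.
have hW : \sum_(0 <= j < H) T j = \sum_(N <= k < N + q) W k * (inv_succ R k)%:C.
  by rewrite /T exchange_big /=; apply: eq_bigr => k _; rewrite mulr_suml.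
have h1 : H%:R * nm T0 <= H%:R * 2 + nm (\sum_(0 <= j < H) T j).
  have -> : H%:R * nm T0 = nm (\sum_(0 <= j < H) T0).
    rewrite sumr_const_nat subn0 -[T0 *+ H]mulr_natl nmM; congr (_ * _).
    have -> : H%:R = (H%:R : R)%:C :> R[i] by rewrite rmorph_nat.
    by rewrite nm_real ger0_norm.
  have -> : \sum_(0 <= j < H) T0 = \sum_(0 <= j < H) (T0 - T j) + \sum_(0 <= j < H) T j.
    by rewrite -big_split /=; apply: eq_bigr => j _; rewrite subrK.
  apply: le_trans (nmD _ _) _; rewrite lerD2r; apply: le_trans (nm_sum _ _ _) _.
  apply: (@le_trans _ _ (\sum_(0 <= j < H) 2)).
    by apply: ler_sum_nat => j /andP[_ jH]; exact: hT.
  by rewrite sumr_const_nat subn0 mulr_natl.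
(* 1 comes from the squared weights, whose sum is at most 1 / N, and 2 from the squared windows,
   where q <= H N bounds the diagonal and l H <= N the rest. *)
have h2 : nm (\sum_(0 <= j < H) T j) <= H%:R * 3.
  rewrite hW; apply: le_trans (nm_sum _ _ _) _.
  (* AM-GM: x w <= H N w^2 + x^2 / (H N) *)
  apply: (@le_trans _ _ (\sum_(N <= k < N + q)
    (H%:R * N%:R * (inv_succ R k ^+ 2) + (H%:R * N%:R)^-1 * nm (W k) ^+ 2))).
    apply: ler_sum => k _; rewrite nmM nm_real ger0_norm ?inv_succ_ge0 //.
    have P0 : 0 < H%:R * N%:R :> R by rewrite mulr_gt0.
    move: (nm_ge0 (W k)) (inv_succ_ge0 R k) P0; move: (nm _) (inv_succ R k) (_ * _) => x w P x0 w0 P0.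
    have : 0 <= P^-1 * (P * w - x) ^+ 2 by rewrite mulr_ge0 ?invr_ge0 ?sqr_ge0 // ltW.
    have -> : P^-1 * (P * w - x) ^+ 2 = P * w ^+ 2 - 2 * (x * w) + P^-1 * x ^+ 2.
      by field; rewrite gt_eqF.
    have : 0 <= x * w by rewrite mulr_ge0.
    lra.
  rewrite big_split /= -!mulr_sumr.
  have a1 : \sum_(N <= k < N + q) inv_succ R k ^+ 2 <= N%:R^-1.
    apply: le_trans (sum_inv_sq_le R (N + q).+1 N0).
    rewrite -[N.+1]addn1 -[(N + q).+1]addn1 big_addn addnK.
    by apply: ler_sum => k _; rewrite /inv_succ exprVn addn1.
  have a2 := @sum_nm_sq R q f N H (l * H%:R) hf _ hc.
  have a3 : H%:R * N%:R * \sum_(N <= k < N + q) inv_succ R k ^+ 2 <= H%:R.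
    apply: (@le_trans _ _ (H%:R * N%:R * N%:R^-1)); last by rewrite mulfK // gt_eqF.
    by apply: ler_wpM2l => //; rewrite mulr_ge0.
  have a4 : (H%:R * N%:R)^-1 * \sum_(N <= k < N + q) nm (W k) ^+ 2 <= H%:R * 2.
    rewrite ler_pdivrMl ?mulr_gt0 //; apply: le_trans (a2 _) _; first by rewrite mulr_ge0 // ltW.
    have b1 : H%:R * q%:R <= H%:R * (H%:R * N%:R) :> R by rewrite ler_wpM2l.
    have b2 : H%:R ^+ 2 * (l * H%:R) <= H%:R ^+ 2 * N%:R by rewrite ler_wpM2l // sqr_ge0.
    have -> : H%:R * N%:R * (H%:R * 2) = H%:R * (H%:R * N%:R) + H%:R ^+ 2 * N%:R :> R by ring.
    exact: lerD.
  by apply: le_trans (lerD a3 a4) _; rewrite -{1}[H%:R]mulr1 -mulrDr ler_wpM2l //; lra.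
suff : H%:R * nm T0 <= H%:R * 5 by rewrite ler_pM2l.
apply: le_trans h1 _; have -> : H%:R * 5 = H%:R * 2 + H%:R * 3 :> R by ring.
by rewrite lerD2l.
Qed.

(** One period beyond N is handled by [window_le] at a cost of 5; past N + q, cancellation over full
    periods leaves at most 2. *)
Lemma L_tail (q : nat) f (N H : nat) (l : R) : dirichlet_char q f -> nonprincipal q f ->
  0 <= l -> (forall h : int, h != 0 -> (`|h| < H)%N -> nm (autocorr q f h) <= l * H%:R) ->
  (0 < H)%N -> (H <= N)%N -> q%:R <= H%:R * N%:R :> R -> l * H%:R <= N%:R ->
  exists z, is_dirichlet_L f 1 z /\ nm (z - psum f N) <= 7.
Proof.
move=> hf np l0 hc H0 HN qHN lHN.
have [z [hz hb]] := @complex_cauchy R (psum f) q%:R (ler0n _ _) (psum_cauchy hf np).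
exists z; split.
  rewrite /is_dirichlet_L.
  have -> : (series (fun n => f n.+1%:Z * nat_cpowN n.+1 1 : R[i]^o)) = psum f :> (nat -> R[i]^o).
    apply: funext => n; rewrite /series /psum /=; apply: eq_bigr => k _.
    by congr (_ * _); exact: nat_cpowN1.
  exact: hz.
have := window_le hf l0 hc H0 HN qHN lHN.
have := hb (N + q)%N.
have : 2 * q%:R / (N + q).+1%:R <= 2 :> R.
  rewrite -mulrA -[leRHS]mulr1 ler_wpM2l // ler_pdivrMr ?ltr0Sn // mul1r ler_nat.
  by apply: leqW; rewrite leq_addl.
move=> h1 h2 h3; have -> : z - psum f N = (z - psum f (N + q)) + (psum f (N + q) - psum f N).
  by rewrite addrA subrK.
apply: le_trans (nmD _ _) _; apply: le_trans (lerD (le_trans h2 h1) h3) _; lra.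
Qed.

End LTail.

(** * Characters of order k *)

Section OrderK.
Variable R : realType.

Lemma complex_prim_root (n : nat) : (0 < n)%N -> exists z : R[i], n.-primitive_root z.
Proof.
pose p : {poly R[i]} := 'X^n - 1; have [r Dp] := closed_field_poly_normal p.
move=> n_gt0; rewrite (monicP _) ?monicXnsubC // scale1r in Dp.
have rn1 : all n.-unity_root r by apply/allP => z; rewrite -root_prod_XsubC -Dp.
have sz_r : (n < (size r).+1)%N by rewrite -(size_prod_XsubC r id) -Dp size_XnsubC.
have [|z] := hasP (has_prim_root n_gt0 rn1 _ sz_r); last by exists z.
by rewrite -separable_prod_XsubC -Dp separable_Xn_sub_1 // pnatr_eq0 -lt0n.
Qed.

Lemma Fp_fermat (q : nat) (x : 'F_q) : prime q -> x != 0 -> x ^+ q.-1 = 1.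
Proof.
move=> pq x0; have : x ^+ (q.-1).+1 = x.
  by have := expf_card x; rewrite card_Fp // prednK ?prime_gt0.
by rewrite exprSr -[RHS]mul1r => /(mulIf x0).
Qed.

Lemma Fp_generator (q : nat) : prime q -> exists g : 'F_q, (q.-1).-primitive_root g.
Proof.
move=> pq; have q1 : (0 < q.-1)%N by rewrite -subn1 subn_gt0 prime_gt1.
pose rs := enum (predC1 (0 : 'F_q)).
have rn1 : all (q.-1).-unity_root rs.
  apply/allP => x; rewrite mem_enum inE => x0; apply/unity_rootP.
  exact: Fp_fermat.
have sz : (q.-1 < (size rs).+1)%N by rewrite -cardE cardC1 card_Fp.
by have [g _ hg] := hasP (has_prim_root q1 rn1 (enum_uniq _) sz); exists g.
Qed.

(** Send the i-th power of a generator modulo q to the i-th power of a primitive k-th root of unity;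
    this is well defined because k divides q - 1. *)
Lemma order_k_char (k q : nat) : (0 < k)%N -> prime q -> (k %| q.-1)%N ->
  exists chi : int -> R[i], [/\ dirichlet_char q chi,
    forall n, coprimez n q%:Z -> chi n ^+ k = 1 &
    exists2 g : int, coprimez g q%:Z & k.-primitive_root (chi g)].
Proof.
move=> k0 pq kq; have [z hz] := complex_prim_root k0; have [g hg] := Fp_generator pq.
pose x (n : int) : 'F_q := n%:~R.
have x0 n : (x n == 0) = ~~ coprimez n q%:Z.
  rewrite /x -(dvdz_pcharf (pchar_Fp pq)) coprimezE /= coprime_sym prime_coprime // negbK.
  by rewrite dvdzE.
pose lg (y : 'F_q) : nat := if [pick i : 'I_q.-1 | y == g ^+ i] is Some i then i else 0.
have lgE (y : 'F_q) : y != 0 -> y = g ^+ lg y.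
  move=> y0; rewrite /lg; case: pickP => [i /eqP //|H].
  have y1 := Fp_fermat pq y0.
  by have [i hi] := prim_rootP hg y1; have := H i; rewrite hi eqxx.
have zeq a b : g ^+ a = g ^+ b -> z ^+ a = z ^+ b.
  move/eqP; rewrite (eq_prim_root_expr hg) => h; apply/eqP; rewrite (eq_prim_root_expr hz).
  move: h; wlog ab : a b / (a <= b)%N.
    by move=> W; case: (leqP a b) => [/W //|/ltnW/W H]; rewrite eq_sym => /H; rewrite eq_sym.
  rewrite eq_sym eqn_mod_dvd // [in X in _ -> X]eq_sym eqn_mod_dvd //; exact: dvdn_trans.
pose chi (n : int) : R[i] := if x n == 0 then 0 else z ^+ lg (x n).
have z0 : z != 0.
  by apply/negP => /eqP e; have := prim_expr_order hz; rewrite e expr0n gtn_eqF // => /eqP; rewrite eq_sym oner_eq0.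
exists chi; split; first split.
- exact: prime_gt0.
- move=> m n; rewrite /chi; have -> : x (m * n) = x m * x n by rewrite /x rmorphM.
  rewrite mulf_eq0; case: eqP => [_|/eqP xm]; first by rewrite mul0r.
  case: eqP => [_|/eqP xn] /=; first by rewrite mulr0.
  rewrite -exprD; apply: zeq; rewrite exprD -!lgE //; exact: mulf_neq0.
- move=> n; rewrite /chi; have -> // : x (n + q%:Z) = x n.
  by rewrite /x rmorphD /= -pmulrn pchar_Fp_0 // addr0.
- move=> n; rewrite /chi x0; case: ifP => [/negbTE ->|]; first by rewrite eqxx.
  by move/negbT; rewrite negbK => ->; rewrite expf_neq0.
- by move=> n cn; rewrite /chi x0 cn /= exprAC (prim_expr_order hz) expr1n.
have xg : x (val g)%:Z = g by rewrite /x -pmulrn natr_Zp.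
have g0 : g != 0.
  have q1 : (0 < q.-1)%N by rewrite -subn1 subn_gt0 prime_gt1.
  by apply/negP => /eqP e; have := prim_expr_order hg; rewrite e expr0n gtn_eqF // => /eqP; rewrite eq_sym oner_eq0.
exists (val g)%:Z; first by rewrite -[coprimez _ _]negbK -x0 xg.
rewrite /chi xg (negbTE g0) (_ : z ^+ lg g = z) //.
by rewrite -[RHS]expr1; apply: zeq; rewrite -lgE // expr1.
Qed.

Definition legC (q : nat) (n : int) : R[i] := (leg q n)%:~R.

Lemma legC_dc (q : nat) : prime q -> odd q -> dirichlet_char q (legC q).
Proof.
move=> pq oq; split; first exact: prime_gt0.
- by move=> m n; rewrite /legC legM // rmorphM.
- by move=> n; rewrite /legC (@leg_mod q pq oq (n + q%:Z) n) // addrAC subrr add0r dvdzz.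
- move=> n; rewrite /legC intr_eq0 leg_eq0 //.
  by rewrite coprimezE /= coprime_sym prime_coprime // dvdzE.
Qed.

Lemma legC_nonprincipal (q : nat) : prime q -> odd q -> nonprincipal q (legC q).
Proof.
move=> pq oq; have [a ha] := leg_nonres pq oq; exists a.
  by rewrite -(dc_neq0 (legC_dc pq oq)) /legC ha intr_eq0.
by rewrite /legC ha -[1]/(1%:~R) eqr_int.
Qed.

End OrderK.

(** * Two characters of order k agreeing at the small primes *)

Section Pigeonhole.
Variable R : realType.

(** The point g with a value of exact order k is kept because the order of the final character is
    read off there. *)
Definition order_k (k q : nat) (chi : int -> R[i]) :=
  [/\ dirichlet_char q chi,
    forall n, coprimez n q%:Z -> chi n ^+ k = 1 &
    exists2 g : int, coprimez g q%:Z & k.-primitive_root (chi g)].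

Lemma count_small (s : seq nat) (m : nat) : uniq s -> (count (fun p => p <= m)%N s <= m.+1)%N.
Proof.
move=> us; rewrite -size_filter -[X in (_ <= X)%N](size_iota 0).
apply: uniq_leq_size; first exact: filter_uniq.
by move=> p; rewrite mem_filter mem_iota add0n ltnS => /andP[].
Qed.

Lemma pow_sum3 (a b c y : nat) : (0 < y)%N -> (a ^ y + b ^ y + c ^ y <= (a + b + c) ^ y)%N.
Proof.
have two (u v : nat) : (0 < y)%N -> (u ^ y + v ^ y <= (u + v) ^ y)%N.
  elim: y => // -[|y] IH _; first by rewrite !expn1.
  rewrite [((u + v) ^ _)%N]expnS; apply: leq_trans (_ : (u + v) * (u ^ y.+1 + v ^ y.+1) <= _)%N; last first.
    by rewrite leq_mul2l IH ?orbT.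
  by rewrite !(expnS _ y.+1); nia.
by move=> y0; apply: leq_trans (two _ _ y0); rewrite leq_add2r two.
Qed.

(** About k ^ y primes are requested, and [primes_one_mod] makes them polynomial in that number,
    hence at most E ^ y with E chosen before y. *)
Lemma agreeing_characters (k l : nat) : (2 <= k)%N -> exists2 E : nat, (0 < E)%N & forall y : nat, (0 < y)%N ->
  exists (q1 q2 : nat) (chi1 chi2 : int -> R[i]),
  [/\ [/\ prime q1, prime q2 & q1 != q2], [/\ (y < q1)%N, (y < q2)%N, (l < q1)%N & (l < q2)%N],
   (q1 <= E ^ y)%N /\ (q2 <= E ^ y)%N,
   order_k k q1 chi1 /\ order_k k q2 chi2 &
   forall p : nat, prime p -> (p <= y)%N -> chi1 p%:Z = chi2 p%:Z].
Proof.
move=> k2; have k0 : (0 < k)%N by rewrite ltnW.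
have [M [e hsup]] := primes_one_mod R k2.
pose E0 := (M * (k ^ 2 + 2 + (l + 4)))%N.
exists (E0.+1 ^ e)%N; first by rewrite expn_gt0.
(* More than k ^ (y + 1) primes must remain after discarding those up to y + l, at most y + l + 1 in
   number. *)
move=> y y0; pose T := (k ^ y.+1 + y + l + 1)%N.
have [s [us sT hs]] := hsup T.
pose s' := [seq p <- s | ~~ (p <= y + l)%N].
have ss' : (k ^ y.+1 < size s')%N.
  have h1 := count_small (y + l) us.
  have : (count (fun p => p <= y + l)%N s + size s' = size s)%N.
    by rewrite /s' size_filter; exact: count_predC.
  rewrite /T in sT; lia.
have hs' (i : 'I_(size s')) : [/\ prime (nth 0%N s' i), (y + l < nth 0%N s' i)%N,
    (k %| (nth 0%N s' i).-1)%N & (nth 0%N s' i <= (M * T.+1) ^ e)%N].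
  have := mem_nth 0%N (ltn_ord i); rewrite mem_filter -ltnNge => /andP[h1 /hs[h2 h3 h4]].
  by split.
have exC (i : 'I_(size s')) : exists c : int -> R[i], order_k k (nth 0%N s' i) c.
  have [h1 h2 h3 h4] := hs' i; exact: order_k_char.
have [C hC] := boolp.choice exC.
have [z hz] := complex_prim_root R k0.
(* Every index up to y receives an exponent, constrained at primes only, so there are k ^ (y + 1)
   patterns. *)
have exF (i : 'I_(size s')) : exists G : {ffun 'I_y.+1 -> 'I_k},
    forall p : 'I_y.+1, prime p -> C i (p : nat)%:Z = z ^+ (G p : 'I_k).
  have exg (p : 'I_y.+1) : exists e : 'I_k, prime p -> C i (p : nat)%:Z = z ^+ e.
    case: (boolP (prime p)) => pp; last by exists (Ordinal k0).
    have [h1 h2 h3 h4] := hs' i; have [c1 c2 c3] := hC i.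
    have cp : coprimez (p : nat)%:Z (nth 0%N s' i)%:Z.
      rewrite coprimezE /= prime_coprime // dvdn_prime2 // neq_ltn.
      by rewrite (leq_trans (ltn_ord p)) //; apply: leq_trans h2; rewrite ltnS leq_addr.
    by have [e' he'] := prim_rootP hz (c2 _ cp); exists e'.
  have [g hg] := boolp.choice exg.
  by exists (finfun g) => p pp; rewrite ffunE hg.
have [F hF] := boolp.choice exF.
have /injectivePn[i [j ij Fij]] : ~~ injectiveb F.
  apply/negP => /injectiveP hinj; have := leq_card F hinj.
  by rewrite card_ffun !card_ord leqNgt ss'.
have [a1 a2 a3 a4] := hs' i; have [b1 b2 b3 b4] := hs' j.
have bound (q : nat) : (q <= (M * T.+1) ^ e)%N -> (q <= (E0.+1 ^ e) ^ y)%N.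
  move=> /leq_trans; apply; rewrite -expnM [(e * y)%N]mulnC expnM.
  case: (posnP e) => [->//|e0]; rewrite leq_exp2r //.
  apply: (@leq_trans (M ^ y * (k ^ 2 + 2 + (l + 4)) ^ y)); last first.
    by rewrite -expnMn leq_exp2r.
  apply: leq_mul.
    by case: (posnP M) => [->//|M0]; rewrite -{1}[M]expn1 leq_pexp2l.
  apply: leq_trans (pow_sum3 _ _ _ y0).
  have e1 : (k ^ y.+1 <= (k ^ 2) ^ y)%N by rewrite -expnM leq_pexp2l //; lia.
  have e2 : (y <= 2 ^ y)%N by apply: ltnW; apply: ltn_expl.
  have e3 : (l + 4 <= (l + 4) ^ y)%N by case: (y) y0 => // y' _; rewrite expnS leq_pmulr // expn_gt0; lia.
  rewrite /T; lia.
exists (nth 0%N s' i), (nth 0%N s' j), (C i), (C j); split=> //.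
- split=> //; rewrite nth_uniq //; exact: filter_uniq.
- by split; lia.
- by split; apply: bound.
move=> p pp py; have py' : (p < y.+1)%N by [].
by rewrite (hF i (Ordinal py')) // (hF j (Ordinal py')) // Fij.
Qed.

End Pigeonhole.

(** * The first moment *)

Lemma coprime_prod_primes (p : nat) (s : seq nat) : prime p -> p \notin s -> all prime s ->
  coprime p (\prod_(q <- s) q)%N.
Proof.
move=> pp; elim: s => [|q s IH] /=; first by rewrite big_nil coprimen1.
rewrite in_cons negb_or => /andP[pq ps] /andP[qq qs]; rewrite big_cons coprimeMr IH // andbT.
by rewrite prime_coprime // dvdn_prime2.
Qed.

Section FirstMoment.
Variable R : realType.

Lemma dc_bigprod (s : seq nat) (F : nat -> int -> R[i]) : uniq s ->
  (forall p, p \in s -> prime p /\ dirichlet_char p (F p)) ->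
  dirichlet_char (\prod_(p <- s) p)%N (fun n => \prod_(p <- s) F p n).
Proof.
elim: s => [|p s IH] /=.
  move=> _ _; rewrite big_nil; have -> : (fun n : int => \prod_(p <- [::]) F p n) = (fun=> 1) :> (int -> R[i]).
    by apply: funext => n; rewrite big_nil.
  exact: dc_triv.
move=> /andP[ps us] H; rewrite big_cons.
have -> : (fun n : int => \prod_(q <- p :: s) F q n) = (fun n => F p n * \prod_(q <- s) F q n).
  by apply: funext => n; rewrite big_cons.
have [pp hc] := H p (mem_head _ _).
by apply: dc_prod => //; apply: IH => // q qs; apply: H; rewrite in_cons qs orbT.
Qed.

Lemma nonprincipal_bigprod (s : seq nat) (F : nat -> int -> R[i]) (p : nat) : uniq s ->
  (forall p, p \in s -> prime p /\ dirichlet_char p (F p)) -> p \in s -> nonprincipal p (F p) ->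
  nonprincipal (\prod_(p <- s) p)%N (fun n => \prod_(p <- s) F p n).
Proof.
move=> us H ps np; have hp := perm_to_rem ps.
rewrite (perm_big _ hp) /= big_cons mulnC.
have -> : (fun n : int => \prod_(q <- s) F q n) = (fun n => (\prod_(q <- rem p s) F q n) * F p n).
  by apply: funext => n; rewrite (perm_big _ hp) /= big_cons mulrC.
have ur : uniq (rem p s) by apply: rem_uniq.
have Hr q : q \in rem p s -> prime q /\ dirichlet_char q (F q).
  by move=> /mem_rem; exact: H.
have [pp hc] := H p ps.
apply: nonprincipal_prod_r => //; first exact: dc_bigprod.
rewrite coprime_sym; apply: coprime_prod_primes => //; first by rewrite mem_rem_uniqF.
by apply/allP => q /Hr[].
Qed.

Lemma dcX_pos (q : nat) (chi : int -> R[i]) v : (0 < v)%N -> dirichlet_char q chi ->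
  dirichlet_char q (fun n => chi n ^+ v).
Proof.
move=> v0 h; split=> [|m n|n|n]; first exact: dc_q0 h.
- by rewrite (dcM h) exprMn.
- by congr (_ ^+ _); case: h.
- by rewrite expf_eq0 v0 (dc_neq0 h).
Qed.

Lemma dc_primes (q : nat) (chi : int -> R[i]) (n : nat) : dirichlet_char q chi -> (0 < n)%N ->
  chi n%:Z = \prod_(p <- primes n) chi p%:Z ^+ logn p n.
Proof.
move=> h n0; rewrite {1}(prod_prime_decomp n0) prime_decompE big_map /=.
elim: (primes n) => [|p s IH]; first by rewrite !big_nil (dc1 h).
by rewrite !big_cons PoszM (dcM h) IH PoszXn (dcX h).
Qed.

Variables (y l Q0 W : nat) (psi : int -> R[i]) (s0 : int).
Hypotheses (hpsi : dirichlet_char Q0 psi) (psi1 : forall p : nat, prime p -> (p <= y)%N -> psi p%:Z = 1).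
Hypotheses (l0 : (0 < l)%N) (y2 : (2 <= y)%N) (hs0 : s0 = 1 \/ s0 = -1).
Hypothesis hW : forall p, prime p -> (y < p)%N -> (p %| W)%N -> (p %| Q0)%N.

(* The value at n of the quadratic character attached to d, when its values at 2 and at the primes up to y are 1. *)
Definition rough_leg (n : nat) (d : int) : R[i] :=
  \prod_(p <- primes n | (y < p)%N) legC R p d ^+ logn p n.

(* With W divisible by 8 and by all p <= y, disc j is 1 modulo 8 and modulo all p <= y. *)
Definition disc (j : nat) : int := s0 * W%:Z * j%:Z + (1 + s0 * W%:Z).

(** For squarefree [disc j] this is chi xi at n (see [F_twist]), but it makes sense for every j, so
    that the average needs no sieve and, for fixed n, runs over a full arithmetic progression. *)
Definition twist (n j : nat) : R[i] := @principal_char R l n%:Z * psi n%:Z * rough_leg n (disc j).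

Lemma prime_gt_odd p : prime p -> (y < p)%N -> odd p.
Proof. by move=> pp yp; case: (even_prime pp) => // p2; move: yp; rewrite p2 ltnNge y2. Qed.

Lemma rough_leg_nm n d : nm (rough_leg n d) <= 1.
Proof.
rewrite /rough_leg; elim/big_rec: _ => [|p x yp IH]; first by rewrite nm1.
rewrite nmM nmX -[leRHS]mulr1; apply: ler_pM => //; rewrite ?exprn_ge0 ?nm_ge0 //.
apply: exprn_ile1; first exact: nm_ge0.
case: (boolP (prime p && odd p)) => [/andP[pp op]|]; first exact: dc_nm_le1 (legC_dc R pp op) d.
rewrite /legC => _; have := leg_cases p d; rewrite !inE => /or3P[] /eqP ->.
- by rewrite mulr0z nm0 ler01.
- by rewrite mulr1z nm1.
- by rewrite mulrN1z nmN nm1.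
Qed.

Lemma twist_nm n j : nm (twist n j) <= 1.
Proof.
rewrite /twist !nmM -[leRHS]mulr1; apply: ler_pM; rewrite ?mulr_ge0 ?nm_ge0 ?rough_leg_nm //.
rewrite -[leRHS]mulr1; apply: ler_pM; rewrite ?nm_ge0 ?(dc_nm_le1 hpsi) //.
exact: dc_nm_le1 (dc_principal R l0) _.
Qed.

Lemma twist_smooth n j : (0 < n)%N -> smooth y n -> twist n j = if coprime n l then 1 else 0.
Proof.
move=> n0 /(smoothP _ n0) sm; rewrite /twist.
have -> : psi n%:Z = 1.
  rewrite (dc_primes hpsi n0) big_seq big1 // => p; rewrite mem_primes => /and3P[pp _ pn].
  by rewrite psi1 ?expr1n // sm.
have -> : rough_leg n (disc j) = 1.
  rewrite /rough_leg big_seq_cond big1 // => p; rewrite mem_primes => /andP[/and3P[pp _ pn]].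
  by rewrite ltnNge sm.
by rewrite !mulr1 /principal_char coprimezE.
Qed.

(** As a function of d, [rough_leg n d] is a character modulo the product of the primes above y
    dividing n; the odd exponent at p makes it nonprincipal. The step W of the progression is prime
    to this modulus unless psi n = 0, so full periods cancel and at most the modulus, which is at
    most n, is left. *)
Lemma twist_cancel n J p : (0 < n)%N -> prime p -> (y < p)%N -> odd (logn p n) ->
  nm (\sum_(0 <= j < J) twist n j) <= n%:R.
Proof.
move=> n0 pp yp op; rewrite /twist -mulr_sumr nmM.
have hnm : nm (@principal_char R l n%:Z * psi n%:Z) <= 1.
  rewrite nmM -[leRHS]mulr1; apply: ler_pM; rewrite ?nm_ge0 ?(dc_nm_le1 hpsi) //.
  exact: dc_nm_le1 (dc_principal R l0) _.
case: (boolP (coprimez n%:Z Q0%:Z)) => cn; last first.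
  by rewrite (dc_eq0 hpsi cn) mulr0 nm0 mul0r.
pose s := [seq q <- primes n | (y < q)%N].
have us : uniq s by rewrite filter_uniq ?primes_uniq.
have hs q : q \in s -> [/\ prime q, (q %| n)%N, (y < q)%N & odd q].
  rewrite mem_filter mem_primes => /andP[yq /and3P[qq _ qn]]; split=> //; exact: prime_gt_odd.
pose F q (d : int) := legC R q d ^+ logn q n.
have hF q : q \in s -> prime q /\ dirichlet_char q (F q).
  move=> qs; have [qq qn yq oq] := hs q qs; split=> //; apply: dcX_pos; last exact: legC_dc.
  by rewrite logn_gt0 mem_primes qq n0.
have ps : p \in s.
  rewrite mem_filter yp mem_primes pp n0 /=.
  by have : (0 < logn p n)%N by [case: (logn p n) op]; rewrite logn_gt0 mem_primes => /and3P[].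
have npp : nonprincipal p (F p).
  have [t ct t1] := legC_nonprincipal R pp (prime_gt_odd pp yp); exists t => //.
  rewrite /F -(odd_double_half (logn p n)) op exprD -mul2n exprM.
  have : legC R p t ^+ 2 = 1.
    rewrite /legC -rmorphXn /= expr2 leg_sqr ?prime_gt_odd //.
    by rewrite -leg_eq0 // -(intr_eq0 R[i]) -/(legC R p t) (dc_neq0 (legC_dc R pp (prime_gt_odd pp yp))).
  by move=> ->; rewrite expr1n mulr1 expr1.
have dck := dc_bigprod us hF.
have npk := nonprincipal_bigprod us hF ps npp.
have sn : (\prod_(q <- s) q <= n)%N.
  apply: dvdn_leq => //.
  have : forall q, q \in s -> prime q /\ (q %| n)%N by move=> q /hs[].
  elim: (s) us => [|q s' IH] /=; first by rewrite big_nil dvd1n.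
  move=> /andP[qs us'] H; rewrite big_cons Gauss_dvd; last first.
    apply: coprime_prod_primes => //; first by have [] := H q (mem_head _ _).
    by apply/allP => r rs; have [] := H r; rewrite ?in_cons ?rs ?orbT.
  have [_ ->] := H q (mem_head _ _); apply: IH => // r rs; apply: H.
  by rewrite in_cons rs orbT.
have cop : coprimez (s0 * W%:Z) (\prod_(q <- s) q)%N%:Z.
  rewrite coprimezE abszM.
  have -> : (`|s0| = 1)%N by case: hs0 => ->.
  rewrite mul1n /= coprime_sym.
  have : forall q, q \in s -> coprime q W.
    move=> q qs; have [qq qn yq oq] := hs q qs; rewrite prime_coprime //.
    apply/negP => /(hW qq yq) qQ; move: cn; rewrite coprimezE /= /coprime => /eqP cn.
    have : (q %| gcdn n Q0)%N by rewrite dvdn_gcd qn qQ.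
    by rewrite cn dvdn1 => /eqP q1; rewrite q1 in qq.
  elim: (s) => [|q s' IH] H; first by rewrite big_nil coprime1n.
  rewrite big_cons coprimeMl H ?mem_head //=; apply: IH => r rs; apply: H.
  by rewrite in_cons rs orbT.
have := sum_block_le (1 + s0 * W%:Z) J dck npk cop.
have -> : \sum_(0 <= j < J) (\prod_(q <- s) F q (s0 * W%:Z * j%:Z + (1 + s0 * W%:Z))) =
  \sum_(0 <= j < J) rough_leg n (disc j).
  by apply: eq_bigr => j _; rewrite /rough_leg -[RHS]big_filter.
move=> h; apply: (@le_trans _ _ (1 * (\prod_(q <- s) q)%N%:R)); last by rewrite mul1r ler_nat.
by apply: ler_pM; rewrite ?nm_ge0.
Qed.

Definition rough_square (n : nat) : bool := has (fun p => (y < p) && (p ^ 2 %| n))%N (primes n).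

(** If n is not smooth and no square of a prime above y divides it, some prime above y has exponent
    exactly 1 and [twist_cancel] applies; for a rough square the trivial bound J is used. *)
Lemma twist_moment n J : (0 < n)%N ->
  (if smooth y n && coprime n l then J%:R else 0) - (if rough_square n then J%:R else 0) - n%:R <=
  complex.Re (\sum_(0 <= j < J) twist n j).
Proof.
move=> n0; case: (boolP (smooth y n)) => sm.
  rewrite (eq_bigr (fun=> if coprime n l then 1 else 0)) => [|j _]; last by rewrite twist_smooth.
  rewrite sumr_const_nat subn0 /=.
  have b0 : 0 <= (if rough_square n then J%:R else 0 : R) by case: ifP.
  have n0' : 0 <= n%:R :> R by [].
  move: b0 n0'; move: (if rough_square n then _ else _) (n%:R : R) => b c b0 c0.
  case: ifP => _; first last.
    by rewrite mul0rn /=; lra.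
  have -> : complex.Re (1 *+ J : R[i]) = J%:R.
    have -> : 1 *+ J = (J%:R : R)%:C :> R[i] by rewrite rmorph_nat.
    by [].
  lra.
have hRe (z : R[i]) : - nm z <= complex.Re z.
  by have := normr_Re_le_nm z; rewrite ler_norml => /andP[].
rewrite /= sub0r; apply: le_trans (hRe _).
case: (boolP (rough_square n)) => sb.
  have : nm (\sum_(0 <= j < J) twist n j) <= J%:R.
    apply: le_trans (nm_sum _ _ _) _; apply: (@le_trans _ _ (\sum_(0 <= j < J) 1)).
      by apply: ler_sum => j _; exact: twist_nm.
    by rewrite sumr_const_nat subn0.
  have : 0 <= n%:R :> R by [].
  lra.
rewrite oppr0 add0r lerN2.
move: sm; rewrite /smooth -has_predC => /hasP[p pn /=]; rewrite -ltnNge => yp.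
move: (pn); rewrite mem_primes => /and3P[pp _ pdn].
apply: (@twist_cancel n J p) => //.
have lp : (0 < logn p n)%N by rewrite logn_gt0.
have : (logn p n < 2)%N.
  rewrite ltnNge; apply: contra sb => h; apply/hasP; exists p => //=.
  by rewrite yp pfactor_dvdn.
by case: (logn p n) lp => [|[|]].
Qed.

(** Primes p > y are relaxed to integers m > y; the multiples of m ^ 2 contribute at most m ^- 2
    times the harmonic sum. *)
Lemma rough_square_sum N : \sum_(1 <= n < N.+1) (if rough_square n then n%:R^-1 else 0) <= y%:R^-1 * harm R N.
Proof.
apply: (@le_trans _ _ (\sum_(1 <= n < N.+1) \sum_(y.+1 <= m < N.+1) (if (m ^ 2 %| n)%N then n%:R^-1 else 0))).
  apply: ler_sum_nat => n /andP[n0 nN].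
  case: ifP => [/hasP[p pn /andP[yp p2n]]|_]; last by apply: sumr_ge0 => m _; case: ifP => // _; rewrite invr_ge0.
  have pN : (p < N.+1)%N.
    by apply: leq_ltn_trans nN; apply: dvdn_leq => //; apply: dvdn_trans p2n; rewrite dvdn_exp.
  rewrite (bigD1_seq p) ?mem_index_iota ?yp ?pN ?iota_uniq //= p2n lerDl.
  by apply: sumr_ge0 => m _; case: ifP => // _; rewrite invr_ge0.
rewrite exchange_big /=.
apply: (@le_trans _ _ (\sum_(y.+1 <= m < N.+1) m%:R ^- 2 * harm R N)).
  apply: ler_sum_nat => m /andP[ym mN]; rewrite -big_mkcond /=.
  have m0 : (0 < m ^ 2)%N by rewrite expn_gt0 (leq_ltn_trans _ ym).
  rewrite (@sum_multiples R (fun n => n%:R^-1) (m ^ 2) N xpredT m0).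
  rewrite (eq_bigr (fun i : nat => m%:R ^- 2 * i%:R^-1)) => [|i _]; last by rewrite natrM invfM natrX.
  rewrite -mulr_sumr ler_wpM2l ?invr_ge0 ?exprn_ge0 //.
  rewrite big_add1 /= /harm [leRHS](@big_cat_nat _ _ _ (N %/ m ^ 2)) //= ?leq_div //.
  by rewrite lerDl; apply: sumr_ge0 => i _; rewrite invr_ge0.
rewrite -mulr_suml ler_wpM2r ?harm_ge0 //; apply: sum_inv_sq_le; exact: ltnW.
Qed.

(** The cancellation bound n meets the weight 1 / n, so the rough terms cost 1 each, N in all. *)
Lemma first_moment N J :
  J%:R * smsum (cop_inv R l) y N - J%:R * (y%:R^-1 * harm R N) - N%:R <=
  \sum_(0 <= j < J) complex.Re (\sum_(0 <= k < N) twist k.+1 j * (inv_succ R k)%:C).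
Proof.
rewrite -(raddf_sum (@complex.Re R)) exchange_big /= raddf_sum /=.
apply: (@le_trans _ _ (\sum_(0 <= k < N)
   ((if smooth y k.+1 && coprime k.+1 l then J%:R else 0)
     - (if rough_square k.+1 then J%:R else 0) - k.+1%:R) * inv_succ R k)); last first.
  apply: ler_sum => k _; rewrite -mulr_suml.
  have -> : complex.Re ((\sum_(0 <= j < J) twist k.+1 j) * (inv_succ R k)%:C) =
     complex.Re (\sum_(0 <= j < J) twist k.+1 j) * inv_succ R k.
    by case: (\sum_(_ <= _ < _) _) => a b; simpc.
  by rewrite ler_wpM2r ?inv_succ_ge0 // twist_moment.
under eq_bigr do rewrite !mulrBl.
rewrite !sumrB; apply: lerB; [apply: lerB|].
- rewrite /smsum mulr_sumr big_add1 /= big_mkcond /=; apply: ler_sum => k _.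
  rewrite /cop_inv /inv_succ; case: (smooth y k.+1) => /=; last by rewrite mul0r.
  by case: ifP; rewrite ?mul0r ?mulr0.
- apply: le_trans (ler_wpM2l _ (rough_square_sum N)); rewrite // mulr_sumr big_add1 /=.
  by apply: ler_sum => k _; rewrite /inv_succ; case: ifP; rewrite ?mul0r ?mulr0.
- rewrite (eq_bigr (fun=> 1)) ?sumr_const_nat ?subn0 // => k _.
  by rewrite /inv_succ mulfV // pnatr_eq0.
Qed.

End FirstMoment.

(** * Squarefree discriminants *)

Lemma count_ap (D J : nat) (a b : int) : (0 < D)%N -> coprimez a D%:Z ->
  (\sum_(0 <= j < J) (D%:Z %| (a * j%:Z + b)%R)%Z <= (J %/ D).+1)%N.
Proof.
move=> D0 cop; rewrite big_mkord.
pose A := [set i : 'I_J | (D%:Z %| (a * (i : nat)%:Z + b)%R)%Z].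
have -> : (\sum_(i < J) (D%:Z %| (a * (i : nat)%:Z + b)%R)%Z = #|A|)%N.
  by rewrite -sum1_card [RHS]big_mkcond /=; apply: eq_bigr => i _; rewrite inE; case: (_ %| _)%Z.
pose h (i : 'I_J) : 'I_(J %/ D).+1 := inord (i %/ D).
have hinj : {in A &, injective h}.
  move=> i i'; rewrite !inE => iA iA' /(congr1 val).
  rewrite /= !inordK ?ltnS ?leq_div2r ?(ltnW (ltn_ord _)) // => e1.
  have : (D%:Z %| a * (i : nat)%:Z - a * (i' : nat)%:Z)%Z.
    have -> : a * (i : nat)%:Z - a * (i' : nat)%:Z = (a * (i : nat)%:Z + b) - (a * (i' : nat)%:Z + b) by ring.
    exact: rpredB.
  rewrite -mulrBr Gauss_dvdzr; last by rewrite coprimez_sym.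
  rewrite dvdzE /= => hd; apply/val_inj => /=.
  have ei := divn_eq i D; have ei' := divn_eq i' D; rewrite e1 in ei.
  have r1 := ltn_pmod i D0; have r2 := ltn_pmod i' D0.
  move: ei ei' r1 r2 hd; set Q := (i' %/ D * D)%N; set u := (i %% D)%N; set v := (i' %% D)%N.
  move: Q u v (nat_of_ord i) (nat_of_ord i').
  clear => Q u v i i' -> -> r1 r2; have -> : (Q + u)%N%:Z - (Q + v)%N%:Z = u%:Z - v%:Z by lia.
  move=> hd; case: (posnP `|u%:Z - v%:Z|) => [|q0]; first by lia.
  by have := dvdn_leq q0 hd; lia.
rewrite -(card_in_imset hinj); apply: leq_trans (max_card _) _.
by rewrite card_ord.
Qed.

Definition sqfree (n : nat) : bool := all (fun p => logn p n == 1)%N (primes n).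

Lemma sqfree_prod n : (0 < n)%N -> sqfree n -> (\prod_(p <- primes n) p = n)%N.
Proof.
move=> n0 /allP sf; rewrite [RHS](prod_prime_decomp n0) prime_decompE big_map /=.
by apply: eq_big_seq => p /sf /eqP ->; rewrite expn1.
Qed.

Lemma nsqfree n : (0 < n)%N -> ~~ sqfree n -> exists2 p, prime p & (p ^ 2 %| n)%N.
Proof.
move=> n0; rewrite -has_predC => /hasP[p pn /= l1]; exists p.
  by move: pn; rewrite mem_primes => /and3P[].
move: (pn); rewrite mem_primes => /and3P[pp _ _]; rewrite pfactor_dvdn //.
have : (0 < logn p n)%N by rewrite logn_gt0.
by move: l1; case: (logn p n) => [|[|]].
Qed.

Section Moduli.
Variable R : realType.
Variables (y W : nat) (s0 : int).
Hypotheses (hs0 : s0 = 1 \/ s0 = -1) (W8 : (8 %| W)%N) (W0 : (0 < W)%N).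
Hypothesis hWy : forall p, prime p -> (p <= y)%N -> (p %| W)%N.

Local Notation disc := (disc W s0).
Definition absdisc (j : nat) : nat := `|disc j|%N.

Lemma discE j : disc j = 1 + s0 * W%:Z * j.+1%:Z.
Proof. by rewrite /disc; lia. Qed.

Lemma W_ge8 : (8 <= W)%N. Proof. exact: dvdn_leq. Qed.

Lemma absdiscE j : disc j = s0 * (absdisc j)%:Z.
Proof.
rewrite /absdisc discE; have := W_ge8; move: (W) => w w8.
have : (8 <= w * j.+1)%N by nia.
case: hs0 => ->; rewrite ?mul1r ?mulN1r ?mulNr -PoszM; move: (w * j.+1)%N => u; lia.
Qed.

Lemma absdisc_bounds j : (W * j.+1 - 1 <= absdisc j <= W * j.+1 + 1)%N.
Proof.
rewrite /absdisc discE; case: hs0 => ->; rewrite ?mul1r ?mulN1r ?mulNr -PoszM; move: (W * j.+1)%N => u; lia.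
Qed.

Lemma absdisc_gt1 j : (1 < absdisc j)%N.
Proof.
have /andP[h _] := absdisc_bounds j; apply: leq_trans h; have := W_ge8; nia.
Qed.

Lemma absdisc_coprime j : coprime (absdisc j) W.
Proof.
have : coprimez (disc j) W%:Z.
  rewrite discE (_ : 1 + _ = (s0 * j.+1%:Z) * W%:Z + 1); last by ring.
  by rewrite /coprimez gcdzC gcdzMDl -/(coprimez _ _) coprimezE /= coprimen1.
by rewrite coprimezE.
Qed.

Lemma prime_dvd_absdisc p j : prime p -> (p %| absdisc j)%N -> (y < p)%N /\ ~~ (p %| W)%N.
Proof.
move=> pp pr; have npW : ~~ (p %| W)%N.
  apply/negP => pW; have : (p %| gcdn (absdisc j) W)%N by rewrite dvdn_gcd pr pW.
  by rewrite (eqP (absdisc_coprime j)) dvdn1 => /eqP p1; rewrite p1 in pp.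
by split=> //; rewrite ltnNge; apply: contra npW; exact: hWy.
Qed.

Lemma disc_mod8 j : (disc j = 1 %[mod 8])%Z.
Proof.
apply/eqP; rewrite eqz_mod_dvd discE addrAC subrr add0r -mulrA dvdz_mull //.
by apply: dvdz_mulr; rewrite dvdzE.
Qed.

Lemma disc_mod_small p j : prime p -> (p <= y)%N -> (p%:Z %| disc j - 1)%Z.
Proof.
move=> pp py; rewrite discE addrAC subrr add0r -mulrA dvdz_mull // dvdz_mulr // dvdzE.
exact: hWy.
Qed.

(** A prime whose square divides |d| exceeds y, as d is prime to W, and is at most P. For each m in
    (y, P] at most J / m ^ 2 + 1 indices are hit, and none if m has a factor in common with W. *)
Lemma bad_count (J P : nat) : (0 < y)%N -> (forall j, (j < J)%N -> (absdisc j <= P ^ 2)%N) ->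
  (\sum_(0 <= j < J) ~~ sqfree (absdisc j))%N%:R <= J%:R * y%:R^-1 + P%:R :> R.
Proof.
move=> y0 hP.
have H : (\sum_(0 <= j < J) ~~ sqfree (absdisc j) <= \sum_(y.+1 <= m < P.+1) (J %/ m ^ 2).+1)%N.
  apply: (@leq_trans (\sum_(y.+1 <= m < P.+1) \sum_(0 <= j < J) (m ^ 2 %| absdisc j))).
    rewrite exchange_big /= big_nat_cond [in leqRHS]big_nat_cond.
    apply: leq_sum => j /andP[/andP[_ jJ] _]; case: (boolP (sqfree (absdisc j))) => //= sf.
    have r0 : (0 < absdisc j)%N by apply: ltnW; exact: absdisc_gt1.
    have [p pp p2] := nsqfree r0 sf.
    have [yp _] : (y < p)%N /\ ~~ (p %| W)%N.
      by apply: (@prime_dvd_absdisc _ j) => //; apply: dvdn_trans p2; rewrite dvdn_exp.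
    have pP : (p < P.+1)%N.
      by rewrite ltnS -(leq_exp2r _ _ (isT : 0 < 2)%N); apply: leq_trans (hP j jJ); exact: dvdn_leq.
    by rewrite (bigD1_seq p) ?mem_index_iota ?yp ?pP ?iota_uniq //= p2.
  rewrite big_nat_cond [in leqRHS]big_nat_cond; apply: leq_sum => m /andP[/andP[ym _] _].
  have m0 : (0 < m ^ 2)%N by rewrite expn_gt0 (leq_ltn_trans _ ym).
  case: (boolP (coprime m W)) => cm.
    apply: leq_trans (@count_ap (m ^ 2) J (s0 * W%:Z) (1 + s0 * W%:Z) m0 _); last first.
      rewrite coprimezE abszM (_ : `|s0| = 1)%N ?mul1n /= ?coprimeXr 1?coprime_sym //.
      by case: hs0 => ->.
    by apply: leq_sum => j _; rewrite dvdzE.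
  rewrite big1 // => j _; case: (boolP (m ^ 2 %| absdisc j)%N) => // h.
  case/negP: cm; apply: coprime_dvdl (absdisc_coprime j); apply: dvdn_trans h.
  by rewrite dvdn_exp.
apply: (@le_trans _ _ (\sum_(y.+1 <= m < P.+1) (J %/ m ^ 2).+1)%N%:R); first by rewrite ler_nat.
rewrite natr_sum; apply: (@le_trans _ _ (\sum_(y.+1 <= m < P.+1) (J%:R * m%:R ^- 2 + 1))).
  by apply: ler_sum => m _; rewrite -natr1 lerD2r -natrX natr_divn_le.
rewrite big_split /= -mulr_sumr sumr_const_nat; apply: lerD.
  by rewrite ler_wpM2l //; apply: sum_inv_sq_le.
by rewrite ler_nat; lia.
Qed.

Definition quad_char (j : nat) (n : int) : R[i] := \prod_(p <- primes (absdisc j)) legC R p n.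

Lemma primes_absdisc j p : p \in primes (absdisc j) -> prime p /\ odd p.
Proof.
rewrite mem_primes => /and3P[pp _ pr]; split=> //.
case: (even_prime pp) => // p2; have [_ ] := prime_dvd_absdisc pp pr.
by rewrite p2 (dvdn_trans _ W8).
Qed.

Lemma quad_char_good j : sqfree (absdisc j) -> good (absdisc j) (quad_char j).
Proof.
move=> sf; have := @good_bigprod R (primes (absdisc j)) (legC R) (primes_uniq _).
rewrite sqfree_prod //; last by apply: ltnW; exact: absdisc_gt1.
apply=> p /primes_absdisc[pp op]; split=> //; split; [exact: legC_dc|exact: legC_nonprincipal].
Qed.

Lemma quad_char_jacobi j : sqfree (absdisc j) ->
  [/\ quad_char j (-1) = s0%:~R, quad_char j 2 = 1 & forall q : nat, prime q -> odd q -> quad_char j q%:Z = legC R q (disc j)].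
Proof.
move=> sf; have r0 : (0 < absdisc j)%N by apply: ltnW; exact: absdisc_gt1.
have ps : all prime (primes (absdisc j)) by apply/allP => p /primes_absdisc[].
have os : all odd (primes (absdisc j)) by apply/allP => p /primes_absdisc[].
have := jacobi_reciprocity ps os hs0; rewrite sqfree_prod // -absdiscE => /(_ (disc_mod8 j))[h1 h2 h3].
have E n : quad_char j n = (\prod_(p <- primes (absdisc j)) leg p n)%:~R by rewrite /quad_char rmorph_prod.
split; rewrite ?E ?h1 ?h2 // => q pq oq.
by rewrite E h3.
Qed.

(** The primes up to y drop out: 2 by the residue of d modulo 8, an odd q <= y because d is 1 modulo
    q. *)
Lemma quad_char_rough_leg j n : (0 < n)%N -> (2 <= y)%N -> sqfree (absdisc j) -> quad_char j n%:Z = rough_leg R y n (disc j).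
Proof.
move=> n0 y2 sf; have [gc _] := quad_char_good sf; have [_ h2 h3] := quad_char_jacobi sf.
rewrite (dc_primes gc.1 n0) /rough_leg [RHS]big_mkcond; apply: eq_big_seq => q.
rewrite mem_primes => /and3P[pq _ _].
case: (even_prime pq) => [q2|oq].
  by rewrite q2 h2 expr1n ltnNge y2.
rewrite h3 //; case: ltnP => // qy.
rewrite /legC (_ : leg q (disc j) = 1) ?mulr1z ?expr1n //.
by rewrite (@leg_mod q pq oq (disc j) 1) ?leg1 // disc_mod_small.
Qed.

End Moduli.

(** * The characters with large L-value *)

Local Open Scope classical_set_scope.
Local Open Scope card_scope.
Local Open Scope ring_scope.
Local Open Scope complex_scope.

Lemma inj_card_le_ord (n : nat) (U : Type) (f : 'I_n -> U) (B : set U) :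
  injective f -> (forall i, B (f i)) -> [set: 'I_n] #<= B.
Proof.
move=> fi fB; apply: (@card_le_trans _ _ _ (f @` [set: 'I_n])).
  have /(@inj_card_eq _ _ [set: 'I_n]) : {in [set: 'I_n] &, injective f} by move=> i j _ _; apply: fi.
  by rewrite card_eq_le => /andP[].
by apply: subset_card_le => _ [i _ <-].
Qed.

Section Core.
Variable R : realType.

Lemma sqr1_cases (z : R[i]) : z ^+ 2 = 1 -> z = 1 \/ z = -1.
Proof. by move/eqP; rewrite sqrf_eq1 => /orP[] /eqP; [left|right]. Qed.

Lemma real_char_sqr (l : nat) (xi : int -> R[i]) n : dirichlet_char l xi -> real_char xi ->
  xi n * xi n = @principal_char R l n.
Proof.
move=> hxi rxi; rewrite /principal_char; case: ifP => [cn|/negbT cn]; last by rewrite (dc_eq0 hxi cn) mul0r.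
have := dc_nm hxi cn; have /complex_realP[x ->] := rxi n.
rewrite nm_real => x1; have x2 : x * x = 1.
  by have := real_normK (num_real x); rewrite x1 expr1n expr2 => ->.
by rewrite -(rmorphM (real_complex R)) x2.
Qed.

Section Fixed.
Variables (k l : nat) (xi : int -> R[i]) (delta : int).
Hypotheses (k2 : (2 <= k)%N) (keven : ~~ odd k) (hxi : primitive_char l xi) (rxi : real_char xi).
Hypothesis hdelta : delta = 1 \/ delta = -1.
Variables (y q1 q2 : nat) (chi1 chi2 : int -> R[i]).
Hypotheses (y2 : (2 <= y)%N) (ly : (l <= y)%N) (pq1 : prime q1) (pq2 : prime q2) (q12 : q1 != q2).
Hypotheses (yq1 : (y < q1)%N) (yq2 : (y < q2)%N).
Hypotheses (ok1 : order_k k q1 chi1) (ok2 : order_k k q2 chi2).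
Hypothesis agree : forall p : nat, prime p -> (p <= y)%N -> chi1 p%:Z = chi2 p%:Z.

(** The factor 8 controls the values of chi_d at -1 and 2, q1 q2 keeps d prime to the modulus of
    psi, and the primorial makes d equal to 1 modulo each p <= y. Since l <= y, it also keeps d
    prime to l. *)
Let W := (8 * (q1 * q2) * primorial y)%N.
Let psi (n : int) : R[i] := chi1 n * conjc (chi2 n).

Let l0 : (0 < l)%N. Proof. exact: dc_q0 hxi.1. Qed.
Let W0 : (0 < W)%N. Proof. by rewrite /W !muln_gt0 primorial_gt0 (prime_gt0 pq1) (prime_gt0 pq2). Qed.
Let W8 : (8 %| W)%N. Proof. by rewrite /W -mulnA dvdn_mulr. Qed.
Let hWy : forall p, prime p -> (p <= y)%N -> (p %| W)%N.
Proof. by move=> p pp py; apply: dvdn_mull; rewrite prime_dvd_primorial. Qed.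
Let hW : forall p, prime p -> (y < p)%N -> (p %| W)%N -> (p %| q1 * q2)%N.
Proof.
move=> p pp yp; rewrite /W Euclid_dvdM // prime_dvd_primorial // leqNgt yp orbF Euclid_dvdM //.
case/orP => //; rewrite (_ : 8 = 2 ^ 3)%N // Euclid_dvdX // andbT => p2.
by have := leq_trans yp (@dvdn_leq p 2 isT p2); rewrite ltnNge y2.
Qed.
Let cop12 : coprime q1 q2. Proof. by rewrite prime_coprime // dvdn_prime2. Qed.
Let cop_lq (q : nat) : prime q -> (y < q)%N -> coprime l q.
Proof.
move=> pq yq; rewrite coprime_sym prime_coprime //; apply/negP => ql.
by have := leq_trans yq (leq_trans (dvdn_leq l0 ql) ly); rewrite ltnn.
Qed.
Let copl12 : coprime l (q1 * q2). Proof. by rewrite coprimeMr !cop_lq. Qed.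

Let np1 (q : nat) (chi : int -> R[i]) : order_k k q chi -> nonprincipal q chi.
Proof.
move=> [_ _ [g cg hg]]; exists g => //; apply/negP => /eqP e; move: hg; rewrite e => h.
by have := prim_order_dvd h 1; rewrite expr1 eqxx dvdn1 => /eqP k1; move: (k2); rewrite k1.
Qed.

Let good1 : good q1 chi1.
Proof. by apply: good_prime => //; [case: ok1|exact: np1 ok1]. Qed.
Let good2 : good q2 (fun n => conjc (chi2 n)).
Proof. by apply: good_prime => //; [apply: dc_conj; case: ok2|apply: nonprincipal_conj; exact: np1 ok2]. Qed.
Let goodpsi : good (q1 * q2) psi. Proof. exact: good_prod. Qed.
Let dcpsi : dirichlet_char (q1 * q2) psi. Proof. exact: goodpsi.1.1. Qed.

Let psi_small p : prime p -> (p <= y)%N -> psi p%:Z = 1.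
Proof.
move=> pp py; have [dc1 _ _] := ok2.
have cp : coprimez p%:Z q2%:Z.
  rewrite coprimezE /= prime_coprime // dvdn_prime2 //.
  by rewrite neq_ltn (leq_ltn_trans py yq2).
by rewrite /psi agree // nm_mulconj (dc_nm dc1 cp) expr1n.
Qed.

Let nonzero_N1 (q : nat) (chi : int -> R[i]) : dirichlet_char q chi -> chi (-1) = 1 \/ chi (-1) = -1.
Proof. by move=> h; apply: sqr1_cases; rewrite expr2 -(dcM h) mulrNN mulr1 (dc1 h). Qed.

Let ex_s0 : exists s0 : int, (s0 = 1 \/ s0 = -1) /\ xi (-1) * (psi (-1) * s0%:~R) = delta%:~R.
Proof.
have hx := nonzero_N1 hxi.1; have hp := nonzero_N1 dcpsi.
case: hdelta => ->; case: hx => ->; case: hp => ->;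
  first [by exists 1; split; [left|rewrite ?mulrN1z ?mulr1z; ring]
        |by exists (-1); split; [right|rewrite ?mulrN1z ?mulr1z; ring]].
Qed.

Section WithS.
Variable s0 : int.
Hypotheses (hs0 : s0 = 1 \/ s0 = -1) (hpar : xi (-1) * (psi (-1) * s0%:~R) = delta%:~R).

(* Xj j is the character chi attached to disc j, and Fj j = Xj j * xi. *)
Let rj j := absdisc W s0 j.
Let ch j := quad_char R W s0 j.
Let fj j (n : int) : R[i] := psi n * ch j n.
Let Fj j (n : int) : R[i] := @principal_char R l n * fj j n.
Let Xj j (n : int) : R[i] := xi n * fj j n.
Let mj j := (q1 * q2 * rj j)%N.

Let cop_rW j : coprime (rj j) W. Proof. exact: absdisc_coprime. Qed.
Let cop_rq j : coprime (q1 * q2) (rj j).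
Proof.
have := cop_rW j; rewrite coprime_sym; apply: coprime_dvdl.
by rewrite /W -mulnA dvdn_mull // dvdn_mulr.
Qed.
Let cop_lr j : coprime l (rj j).
Proof.
have := cop_rW j; rewrite [coprime (rj j) W]coprime_sym => c.
have r1 := absdisc_gt1 hs0 W8 W0 j.
rewrite /coprime; apply/eqP; case: (leqP (gcdn l (rj j)) 1) => h.
  by apply/eqP; rewrite eqn_leq h gcdn_gt0 l0.
have pp := pdiv_prime h; have := pdiv_dvd (gcdn l (rj j)); rewrite dvdn_gcd => /andP[pl pr].
have [yp _] := prime_dvd_absdisc hs0 W8 W0 hWy pp pr.
by have := leq_trans yp (leq_trans (dvdn_leq l0 pl) ly); rewrite ltnn.
Qed.
Let cop_lm j : coprime l (mj j). Proof. by rewrite coprimeMr copl12 cop_lr. Qed.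

Section OneJ.
Variable j : nat.
Hypothesis sf : sqfree (rj j).

Let goodch : good (rj j) (ch j). Proof. exact: (quad_char_good R hs0 W8 W0 hWy sf). Qed.
Let goodf : good (mj j) (fj j).
Proof. exact: (good_prod goodpsi goodch (cop_rq j)). Qed.

Lemma Xj_primitive : primitive_char (l * mj j) (Xj j).
Proof. exact: (primitive_prod hxi goodf.1 (cop_lm j)). Qed.

Let m_gt1 : (1 < mj j)%N.
Proof.
have := prime_gt1 pq1; have := prime_gt0 pq2; have := absdisc_gt1 hs0 W8 W0 j; rewrite -/(rj j) /mj.
by move: (rj j) => r; nia.
Qed.

Let dcF : dirichlet_char (l * mj j) (Fj j).
Proof. exact: dc_prod (dc_principal R l0) goodf.1.1. Qed.

Let npF : nonprincipal (l * mj j) (Fj j).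
Proof.
apply: nonprincipal_prod_r (dc_principal R l0) goodf.1.1 (cop_lm j) _.
exact: primitive_nonprincipal goodf.1.
Qed.

(** The principal factor modulo l is bounded trivially by l; the primitive rest by gcd(h, m) <=
    |h|. *)
Let acF h : h != 0 -> nm (autocorr (l * mj j) (Fj j) h) <= l%:R * (`|h|%N)%:R.
Proof.
move=> h0; rewrite (autocorr_prod h (dc_principal R l0) goodf.1.1 (cop_lm j)) nmM.
apply: ler_pM; rewrite ?nm_ge0 // ?(autocorr_le h (dc_principal R l0)) //.
apply: le_trans (goodf.2 h) _; rewrite ler_nat; apply: dvdn_leq; last exact: dvdn_gcdl.
by rewrite absz_gt0.
Qed.

(** As k is even, the k-th powers of the real factors xi and chi_d are principal. No smaller
    exponent works: an integer that is g modulo q1 and 1 modulo the rest of the conductor has value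
    chi1(g), a primitive k-th root of unity. *)
Let orderX : char_order (l * mj j) (Xj j) k.
Proof.
have [dc1' h1 [g cg hg]] := ok1; have [dc2' h2 _] := ok2.
have dX := Xj_primitive.1.
split=> [|n|i i0 hi]; first exact: ltnW.
  rewrite /principal_char; case: ifP => [cn|/negbT cn]; last first.
    by rewrite (dc_eq0 dX cn) expr0n gtn_eqF // ltnW.
  move: cn; rewrite /mj !PoszM !coprimezMr => /andP[cl /andP[/andP[c1 c2] cr]].
  have kE : k = (2 * k./2)%N by rewrite mul2n -[LHS](odd_double_half k) (negbTE keven).
  have sq1 (z : R[i]) : z ^+ 2 = 1 -> z ^+ k = 1 by move=> z2; rewrite kE exprM z2 expr1n.
  rewrite /Xj /fj /psi !exprMn h1 // -rmorphXn /= h2 // conjc1 !mul1r.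
  rewrite sq1 ?mul1r; last by rewrite expr2 (real_char_sqr _ hxi.1 rxi) /principal_char cl.
  rewrite sq1 // /ch /quad_char -prodrXl big_seq big1 // => p pr.
  have [pp op] := primes_absdisc hs0 W8 W0 hWy pr.
  rewrite /legC expr2 -rmorphM /= leg_sqr //.
  have /dvdnP[u hu] : (p %| rj j)%N by move: pr; rewrite mem_primes => /and3P[].
  apply/negP => pn; move: cr; rewrite hu mulnC PoszM coprimezMr => /andP[+ _].
  by rewrite coprimezE /= coprime_sym prime_coprime // => /negP; apply; exact: pn.
have copq : coprime q1 (l * (q2 * rj j)).
  rewrite !coprimeMr cop12 [coprime q1 l]coprime_sym cop_lq //=.
  by have := cop_rq j; rewrite coprimeMl => /andP[].
have [t [t1 t2]] := crt_int g 1 copq.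
have dt m : (m %| l * (q2 * rj j))%N -> (m%:Z %| t - 1)%Z by move=> hm; apply: dvdz_trans t2.
have tX : Xj j t = chi1 g.
  have el : xi t = 1 by rewrite (dc_per hxi.1 (dt l (dvdn_mulr _ (dvdnn l)))) (dc1 hxi.1).
  have e2 : chi2 t = 1.
    by rewrite (dc_per dc2' (dt q2 (dvdn_mull _ (dvdn_mulr _ (dvdnn q2))))) (dc1 dc2').
  have er : ch j t = 1.
    by rewrite (dc_per goodch.1.1 (dt _ (dvdn_mull _ (dvdn_mull _ (dvdnn (rj j)))))) (dc1 goodch.1.1).
  by rewrite /Xj /fj /psi el e2 er conjc1 mul1r !mulr1 (dc_per dc1' t1).
have := hi t; rewrite tX /principal_char.
have -> : coprimez t (l * mj j)%N%:Z.
  by rewrite -(dc_neq0 dX) tX (dc_neq0 dc1').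
by move=> e; apply: dvdn_leq i0 _; rewrite (prim_order_dvd hg) e.
Qed.

Let parX : Xj j (-1) = delta%:~R.
Proof. by have [e _ _] := quad_char_jacobi R hs0 W8 W0 hWy sf; rewrite /Xj /fj /ch e. Qed.

Let XF : (fun n : int => Xj j n * xi n) = Fj j.
Proof.
by apply/funext => n; rewrite /Fj -(real_char_sqr n hxi.1 rxi) /Xj mulrAC.
Qed.

Let F_twist n : (0 < n)%N -> Fj j n%:Z = twist y l W psi s0 n j.
Proof. by move=> n0; rewrite /Fj /fj /ch (quad_char_rough_leg R hs0 W8 W0 hWy) // mulrA. Qed.

(** The L-series is cut at J. Of the loss 8, the tail takes 7 by [L_tail], and 1 is the margin
    allowed when large partial sums are selected. *)
Lemma Xj_large (J H : nat) (Q Bd : R) : (0 < H)%N -> (l * H <= J)%N -> (l * mj j <= H * J)%N ->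
  (l * mj j)%:R <= Q ->
  Bd - 1 <= complex.Re (\sum_(0 <= n < J) twist y l W psi s0 n.+1 j * (inv_succ R n)%:C) ->
  large_L1_chars k delta xi Q (Bd - 8) (Xj j).
Proof.
move=> H0 lHJ mHJ mQ hB; exists (l * mj j)%N; split=> //; first exact: Xj_primitive.
have HJ : (H <= J)%N by apply: leq_trans lHJ; rewrite leq_pmull.
have [||||||z [hz hz7]] := @L_tail R (l * mj j) (Fj j) J H l%:R dcF npF.
- exact: ler0n.
- move=> h h0 hH; apply: le_trans (acF h0) _.
  by rewrite ler_wpM2l // ler_nat ltnW.
- exact: H0.
- exact: HJ.
- by rewrite -natrM ler_nat.
- by rewrite -natrM ler_nat.
exists z; first by move: hz; rewrite -XF.
rewrite normE lecR.
have -> : Bd - 8 = Bd - 1 - 7 by ring.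
rewrite lerBlDr; apply: le_trans hB _.
rewrite (_ : \sum_(0 <= n < J) _ = psum (Fj j) J); last first.
  by apply: eq_bigr => n _; rewrite F_twist.
apply: le_trans (Re_le_nm _) _.
have -> : psum (Fj j) J = z - (z - psum (Fj j) J) by ring.
apply: le_trans (nmD _ _) _; rewrite nmN; exact: lerD.
Qed.

End OneJ.

(** The character vanishes at the primes dividing d, and the rest of its conductor is prime to every
    such d. So the squarefree |d| can be recovered, and it determines j since consecutive values lie
    W >= 8 apart. *)
Lemma Xj_inj i j : sqfree (rj i) -> sqfree (rj j) -> Xj i = Xj j -> i = j.
Proof.
move=> si sj e.
have sub a b : sqfree (rj a) -> sqfree (rj b) -> Xj a = Xj b ->
    forall p, p \in primes (rj a) -> p \in primes (rj b).
  move=> sa sb eab p; rewrite !mem_primes => /and3P[pp ra pa].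
  have rb0 : (0 < rj b)%N := ltnW (absdisc_gt1 hs0 W8 W0 b).
  rewrite pp rb0 /=; apply: contraT => npb.
  have : Xj b p%:Z != 0.
    rewrite (dc_neq0 (Xj_primitive sb).1) /mj !PoszM !coprimezMr !coprimezE /=.
    rewrite !prime_coprime // npb andbT.
    rewrite -!prime_coprime // ![coprime p _]coprime_sym.
    have c m : coprime m (rj a) -> coprime m p by apply: coprime_dvdr.
    by rewrite (c _ (cop_lr a)) -coprimeMl c.
  rewrite -eab (dc_neq0 (Xj_primitive sa).1) /mj !PoszM !coprimezMr !coprimezE /=.
  by rewrite [coprime p (rj a)]prime_coprime // pa !andbF.
have ep : primes (rj i) = primes (rj j).
  by apply/eq_primes => p; apply/idP/idP; apply: sub.
have r0 a : (0 < rj a)%N := ltnW (absdisc_gt1 hs0 W8 W0 a).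
have er : rj i = rj j by rewrite -(sqfree_prod (r0 i) si) ep sqfree_prod.
have W8' : (8 <= W)%N := dvdn_leq W0 W8.
have := absdisc_bounds hs0 W8 W0 i; have := absdisc_bounds hs0 W8 W0 j; rewrite -/(rj i) -/(rj j) er.
by move: (rj j) W8' => r; clear; move: W => w *; nia.
Qed.

(** In the lower bound for the average, 2 pays for the error J of [first_moment] and for P in
    [bad_count]; the two copies of harm / y pay for rough squares and for non-squarefree d. Indices
    outside [G] contribute at most harm if bad and Bd - 1 otherwise, so the margin 1 leaves J <= |G|
    * harm. *)
Lemma many_large (J H P n : nat) (Q Bd : R) : (0 < J)%N -> (0 < H)%N -> (l * H <= J)%N ->
  (forall j, (j < J)%N -> [/\ (rj j <= P ^ 2)%N, (l * mj j <= H * J)%N & (l * mj j)%:R <= Q]) ->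
  1 <= Bd -> P%:R * harm R J <= J%:R -> n%:R * harm R J <= J%:R ->
  Bd + 2 + 2 * (y%:R^-1 * harm R J) <= smsum (cop_inv R l) y J ->
  [set: 'I_n] #<= large_L1_chars k delta xi Q (Bd - 8).
Proof.
move=> J0 H0 lHJ hj Bd1 hP hn hS.
pose A j := complex.Re (\sum_(0 <= n < J) twist y l W psi s0 n.+1 j * (inv_succ R n)%:C).
pose G := [seq j <- index_iota 0 J | sqfree (rj j) && (Bd - 1 <= A j)].
have h0 := harm_ge0 R J.
have Ah j : A j <= harm R J.
  apply: le_trans (Re_le_nm _) _; apply: le_trans (nm_sum _ _ _) _.
  rewrite /harm; apply: ler_sum => i _; rewrite nmM nm_real ger0_norm ?inv_succ_ge0 //.
  rewrite -[leRHS]mul1r; apply: ler_wpM2r; first exact: inv_succ_ge0.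
  exact: twist_nm dcpsi l0 _ _.
have fm := first_moment dcpsi psi_small l0 y2 hs0 hW J J.
have bc := bad_count R hs0 W8 W0 hWy (ltnW y2) (fun j jJ => let: And3 a _ _ := hj j jJ in a).
have ub : \sum_(0 <= j < J) A j <=
    harm R J * (\sum_(0 <= j < J) ~~ sqfree (rj j))%:R + harm R J * (size G)%:R + J%:R * (Bd - 1).
  have -> : size G = (\sum_(0 <= j < J) (sqfree (rj j) && (Bd - 1 <= A j)%R))%N.
    rewrite size_filter -sum1_count big_mkcond /=; apply: eq_bigr => j _.
    by case: (_ && _).
  rewrite !natr_sum !mulr_sumr -[X in X%:R * (Bd - 1)](subn0 J) -[X in X * (Bd - 1)]/(_ *+ _).
  rewrite mulr_natl -sumr_const_nat -!big_split /=; apply: ler_sum => j _.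
  case: (sqfree (rj j)) => /=; case: (leP (Bd - 1) (A j)) => hA;
    rewrite ?mulr1 ?mulr0 ?addr0 ?add0r; have := Ah j; move: h0 Bd1 hA; move: (A j) (harm R J) => * ; lra.
have J0' : 0 < J%:R :> R by rewrite ltr0n.
have y0' : 0 < y%:R :> R by rewrite ltr0n ltnW.
have hG : J%:R <= (size G)%:R * harm R J.
  have t1 : harm R J * (\sum_(0 <= j < J) ~~ sqfree (rj j))%:R <=
      J%:R * (y%:R^-1 * harm R J) + J%:R.
    apply: le_trans (ler_wpM2l h0 bc) _.
    by rewrite mulrDr lerD //; [rewrite mulrC -mulrA|rewrite mulrC].
  have t2 := ler_wpM2l (ltW J0') hS.
  move: fm ub t1 t2; rewrite -/A [harm R J * (size G)%:R]mulrC.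
  set a := \sum_(0 <= j < J) A j; set b := _ * harm R J; set c := J%:R * smsum _ _ _.
  move: (harm R J * _) => d; rewrite !mulrDr; set e := J%:R * (y%:R^-1 * _).
  rewrite (_ : J%:R * (2 * (y%:R^-1 * harm R J)) = 2 * e); last by rewrite mulrCA.
  rewrite mulrN1; move: a b c d e (J%:R * Bd) (J%:R) => {}a {}b {}c {}d {}e f g *.
  lra.
have hh0 : 0 < harm R J.
  rewrite lt0r h0 andbT; apply/eqP => hz; move: hG; rewrite hz mulr0 => hG.
  by have := lt_le_trans J0' hG; rewrite ltxx.
have nG : (n <= size G)%N.
  by rewrite -(ler_nat R) -(ler_pM2r hh0) (le_trans hn).
have Gj (i : 'I_n) : let j := nth 0%N G i in [/\ (j < J)%N, sqfree (rj j) & Bd - 1 <= A j].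
  have /= := mem_nth 0%N (leq_trans (ltn_ord i) nG).
  by rewrite mem_filter mem_index_iota => /andP[/andP[]].
apply: (@inj_card_le_ord n _ (fun i : 'I_n => Xj (nth 0%N G i))).
  move=> i1 i2 e; apply: val_inj => /=; apply/eqP.
  have [_ s1 _] := Gj i1; have [_ s2 _] := Gj i2.
  have uG : uniq G by rewrite filter_uniq // iota_uniq.
  by rewrite -(nth_uniq 0%N _ _ uG) ?(leq_trans (ltn_ord _) nG) //; apply/eqP/Xj_inj.
move=> i; have [jJ sf hA] := Gj i; have [_ m1 m2] := hj _ jJ.
exact: (Xj_large sf H0 lHJ m1 m2 hA).
Qed.

End WithS.

Lemma many_large_L1 (J H P n : nat) (Q Bd : R) : (0 < J)%N -> (0 < H)%N -> (l * H <= J)%N ->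
  (W * J + 1 <= P ^ 2)%N -> (l * (q1 * q2 * (W * J + 1)) <= H * J)%N ->
  (l * (q1 * q2 * (W * J + 1)))%:R <= Q ->
  1 <= Bd -> P%:R * harm R J <= J%:R -> n%:R * harm R J <= J%:R ->
  Bd + 2 + 2 * (y%:R^-1 * harm R J) <= smsum (cop_inv R l) y J ->
  [set: 'I_n] #<= large_L1_chars k delta xi Q (Bd - 8).
Proof.
move=> J0 H0 lHJ hP hHJ hQ; have [s0 [hs0 hpar]] := ex_s0.
apply: (many_large hs0 hpar J0 H0 lHJ) => j jJ.
have /andP[_ rj] := absdisc_bounds hs0 W8 W0 j.
have rJ : (absdisc W s0 j <= W * J + 1)%N by apply: leq_trans rj _; rewrite leq_add2r leq_mul2l jJ orbT.
have mJ : (l * (q1 * q2 * absdisc W s0 j) <= l * (q1 * q2 * (W * J + 1)))%N by rewrite !leq_mul.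
split; [exact: leq_trans hP|exact: leq_trans hHJ|].
by apply: le_trans hQ; rewrite ler_nat.
Qed.

End Fixed.
End Core.

(** * Choice of parameters *)

Lemma fourth_root_floor (J : nat) : exists B, (B ^ 4 <= J < B.+1 ^ 4)%N.
Proof.
have h0 : exists n, (n ^ 4 <= J)%N by exists 0%N.
have hb n : (n ^ 4 <= J)%N -> (n <= J)%N.
  by apply: leq_trans; rewrite -{1}[n]expn1; case: n => // n; rewrite leq_pexp2l.
exists (ex_maxn h0 hb); case: ex_maxnP => B -> hm /=.
by rewrite ltnNge; apply/negP => /hm; rewrite ltnn.
Qed.

(** U dominates all quantities of size exp(O(y)), in particular W and a = l q1 q2; with J = Q / U ^
    2 the conductors stay below Q. B is the integer fourth root of J: 4 B + 1 will bound the
    harmonic sum up to J, P is of size U times the square root of J, and B ^ 2 characters suffice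
    because B ^ 6 > Q. *)
Lemma nat_params (U Qn a W : nat) : (64 <= U)%N -> (U ^ 16 <= Qn)%N -> (a <= U)%N -> (W < U)%N ->
  let J := (Qn %/ U ^ 2)%N in
  exists B, let P := (U * B.+1 ^ 2)%N in
  [/\ [/\ (U ^ 14 <= J)%N, (B ^ 4 <= J)%N & (J < B.+1 ^ 4)%N],
      (W * J + 1 <= P ^ 2)%N, (a * (W * J + 1) <= U ^ 4 * J)%N, (a * (W * J + 1) <= Qn)%N &
      [/\ (P * (4 * B + 1) <= J)%N, (B ^ 2 * (4 * B + 1) <= J)%N & (Qn < B ^ 6)%N]].
Proof.
move=> U64 hQ aU WU J; have [B /andP[B1 B2]] := fourth_root_floor J.
have U0 : (0 < U)%N by apply: leq_trans U64.
have U20 : (0 < U ^ 2)%N by rewrite expn_gt0 U0.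
have hJ : (U ^ 14 <= J)%N by rewrite leq_divRL // -expnD.
have J0 : (0 < J)%N by apply: leq_trans hJ; rewrite expn_gt0 U0.
have JQ : (U ^ 2 * J <= Qn)%N by rewrite mulnC leq_trunc_div.
have QJ : (Qn < U ^ 2 * J.+1)%N by rewrite mulnC ltn_ceil.
have WJ : (W * J + 1 <= U * J)%N by apply: leq_trans (_ : W.+1 * J <= _)%N; rewrite ?leq_mul2r ?WU ?orbT // mulSn addnC leq_add2r.
have aWJ : (a * (W * J + 1) <= U ^ 2 * J)%N by rewrite expnS expn1 -mulnA leq_mul.
have BU : (U ^ 3 <= B)%N.
  rewrite -ltnS -(@ltn_exp2r _ _ 4) // -expnM; apply: leq_ltn_trans B2; apply: leq_trans hJ.
  by rewrite leq_pexp2l.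
have B80 : (64 * U <= B)%N.
  by apply: leq_trans BU; rewrite !expnS expn0 muln1; move: U64; clear; nia.
have B0 : (0 < B)%N by lia.
have S2 : (B.+1 ^ 2 <= 4 * B ^ 2)%N by rewrite !expnS !expn0; move: B0; clear; nia.
exists B; split; [split=> //| | |exact: leq_trans JQ|split].
- apply: leq_trans WJ _; rewrite expnMn -expnM.
  by apply: leq_mul; [by rewrite -{1}[U]expn1 leq_pexp2l|exact: ltnW].
- by apply: leq_trans aWJ _; rewrite leq_mul2r leq_pexp2l ?orbT.
- apply: leq_trans B1; apply: (@leq_trans (U * (4 * B ^ 2) * (5 * B))).
    by apply: leq_mul; [rewrite leq_mul2l S2 orbT|lia].
  have -> : (U * (4 * B ^ 2) * (5 * B) = 20 * U * B ^ 3)%N by rewrite !expnS !expn0; ring.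
  by rewrite [(B ^ 4)%N]expnS leq_mul2r; apply/orP; right; lia.
- apply: leq_trans B1; apply: (@leq_trans (B ^ 2 * (5 * B))); first by rewrite leq_mul2l; apply/orP; right; lia.
  have -> : (B ^ 2 * (5 * B) = 5 * B ^ 3)%N by rewrite !expnS !expn0; ring.
  by rewrite [(B ^ 4)%N]expnS leq_mul2r; apply/orP; right; lia.
apply: leq_trans QJ _; apply: (@leq_trans (U ^ 2 * (B.+1 ^ 2) ^ 2)); first by rewrite leq_mul2l -expnM B2 orbT.
apply: (@leq_trans (U ^ 2 * (4 * B ^ 2) ^ 2)); first by rewrite leq_mul2l leq_exp2r // S2 orbT.
have -> : (U ^ 2 * (4 * B ^ 2) ^ 2 = (4 * U) ^ 2 * B ^ 4)%N by rewrite !expnS !expn0; ring.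
rewrite (_ : B ^ 6 = B ^ 2 * B ^ 4)%N; last by rewrite -expnD.
by rewrite leq_mul2r leq_exp2r //; apply/orP; right; lia.
Qed.

Section Final.
Variable R : realType.

Lemma harm_le_ln m : (0 < m)%N -> harm R m <= 1 + ln m%:R.
Proof.
case: m => // m _; elim: m => [|m IH]; first by rewrite /harm big_nat1 invr1 ln1 addr0.
rewrite /harm big_nat_recr //= -/(harm R m.+1).
have a0 : 0 < m.+1%:R :> R by rewrite ltr0n.
have b0 : 0 < m.+2%:R :> R by rewrite ltr0n.
have := ln_concave_step a0 b0.
rewrite (_ : m.+2%:R - m.+1%:R = 1 :> R); last by rewrite -natrB // subSnn.
rewrite mul1r => h; apply: le_trans (lerD IH h) _; lra.
Qed.

Lemma harm_le_root (B J : nat) : (0 < J)%N -> (J < B.+1 ^ 4)%N -> harm R J <= (4 * B + 1)%N%:R.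
Proof.
move=> J0 h; apply: le_trans (harm_le_ln J0) _.
have b0 : 0 < B.+1%:R :> R by rewrite ltr0n.
have : ln (J%:R : R) <= 4 * ln B.+1%:R.
  rewrite mulr_natl -lnXn // -natrX ler_ln ?posrE ?ltr0n ?expn_gt0 //.
  by rewrite ler_nat ltnW.
have : ln (B.+1%:R : R) <= B%:R.
  have := @ln_sub_le R B.+1%:R 1 b0 ltr01; rewrite ln1 subr0 divr1 -natr1 addrK; exact: id.
rewrite natrD natrM; lra.
Qed.

(** z is the floor of the square root of ln Q / (16 c). The bound with 16 will give U ^ 16 <= Q; the
    bound with 64 = 4 * 16, lost in rounding down, makes ln (z ^ 2) equal to ln ln Q up to a
    constant. *)
Lemma sqrt_choice (c Q : R) (m : nat) : 0 < c -> (0 < m)%N -> expR (16 * c * (m ^ 2)%:R) <= Q ->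
  exists z : nat, [/\ (m <= z)%N, 16 * c * (z ^ 2)%:R <= ln Q & ln Q <= 64 * c * (z ^ 2)%:R].
Proof.
move=> c0 m0 hQ.
have Q0 : 0 < Q := lt_le_trans (expR_gt0 _) hQ.
have lQ : 16 * c * (m ^ 2)%:R <= ln Q by rewrite -ler_expR lnK.
have c16 : 0 < 16 * c by rewrite mulr_gt0.
pose t := Num.sqrt (ln Q / (16 * c)); pose z := Num.truncn t.
have t0 : 0 <= t := sqrtr_ge0 _.
have l0 : 0 <= ln Q by apply: le_trans lQ; rewrite mulr_ge0 // ltW.
have tt : 16 * c * (t * t) = ln Q.
  rewrite -expr2 sqr_sqrtr; last by rewrite divr_ge0 // ltW.
  by rewrite mulrC divfK // gt_eqF.
have mt : m%:R <= t.
  rewrite -(@ler_pXn2r R 2) ?nnegrE ?ler0n // -natrX expr2 -(ler_pM2l c16) tt; exact: lQ.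
have /andP[z1 z2] := truncn_itv t0; rewrite -/z in z1 z2.
have mz : (m <= z)%N by rewrite -ltnS -(ltr_nat R) (le_lt_trans mt).
have z1' : 1 <= z%:R :> R by rewrite ler1n (leq_trans m0).
exists z; split=> //; rewrite -tt natrX expr2.
  by apply: (ler_wpM2l (ltW c16)); apply: ler_pM.
have -> : 64 * c * (z%:R * z%:R) = 16 * c * ((2 * z%:R) * (2 * z%:R)) by ring.
have tz : t <= 2 * z%:R by apply: ltW; apply: lt_le_trans z2 _; rewrite -natr1; lra.
by apply: (ler_wpM2l (ltW c16)); apply: ler_pM.
Qed.

(** B ^ 2 is the cube root of B ^ 6 > Q. The summand 0 is the value of the error function supplied
    in the theorem. *)
Lemma cube_root_le (Q : R) (Qn B : nat) : 0 <= Q -> Q < Qn.+1%:R -> (Qn < B ^ 6)%N ->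
  Q `^ (3^-1 + 0) <= (B ^ 2)%N%:R.
Proof.
move=> Q0 hQ hB; rewrite addr0.
have B0 : 0 <= (B ^ 2)%N%:R :> R by rewrite ler0n.
have -> : (B ^ 2)%N%:R = ((B ^ 6)%N%:R : R) `^ 3^-1.
  rewrite (_ : (B ^ 6 = (B ^ 2) ^ 3)%N); last by rewrite -expnM.
  by move: (B ^ 2)%N B0 => b b0; rewrite natrX -powR_mulrn // -powRrM divff // powRr1.
apply: ge0_ler_powR; rewrite ?nnegrE ?invr_ge0 ?ler0n //.
by apply: ltW; apply: lt_le_trans hQ _; rewrite ler_nat.
Qed.

Lemma ln_ln_le (c Q : R) (y : nat) : 0 < c -> (0 < y)%N -> 0 < ln Q -> ln Q <= 64 * c * y%:R ->
  ln (ln Q) <= ln y%:R + ln (64 * c).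
Proof.
move=> c0 y0 lQ h; have c64 : 0 < 64 * c by rewrite mulr_gt0.
rewrite addrC -lnM ?posrE ?ltr0n // ler_ln ?posrE // mulr_gt0 ?ltr0n //.
Qed.

Lemma natr_expn_le_ln (D y m : nat) (Q : R) : (0 < D)%N -> 0 < Q ->
  m%:R * ln D%:R * y%:R <= ln Q -> ((D ^ y) ^ m)%N%:R <= Q.
Proof.
move=> D0 Q0 h; have D0R : 0 < D%:R :> R by rewrite ltr0n.
rewrite -expnM natrX -ler_ln ?posrE ?exprn_gt0 // lnXn //; apply: le_trans h.
rewrite -[leLHS]mulr_natr natrM; rewrite le_eqVlt; apply/orP; left; apply/eqP; ring.
Qed.

Lemma harm_div_le (c Q : R) (y J : nat) : (0 < y)%N -> (0 < J)%N -> J%:R <= Q ->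
  ln Q <= c * y%:R -> y%:R^-1 * harm R J <= 1 + c.
Proof.
move=> y0 J0 JQ hQ; have J0R : 0 < J%:R :> R by rewrite ltr0n.
have lJ : ln (J%:R : R) <= ln Q by rewrite ler_ln // posrE // (lt_le_trans J0R).
have y1 : 1 <= y%:R :> R by rewrite ler1n.
rewrite mulrC ler_pdivrMr ?ltr0n // mulrDl mul1r.
apply: le_trans (harm_le_ln J0) _; apply: lerD => //.
exact: le_trans hQ.
Qed.

End Final.

Theorem theorem1p5 (R : realType) (k : nat) (hk2 : (2 <= k)%N)
    (hkeven : ~~ odd k) (l : nat) :
  exists C : R,
    forall (delta : int) (xi : int -> R[i]),
      delta = 1 \/ delta = -1 ->
      primitive_char l xi -> real_char xi ->
      exists e : R -> R,
        e Q @[Q --> +oo] --> 0 /\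
        \forall Q \near +oo,
          exists N : nat,
            Q `^ (3^-1 + e Q) <= N%:R /\
            [set: 'I_N] #<=
              large_L1_chars k delta xi Q
                ((totient l)%:R / l%:R * expR (euler_gamma R) * ln (ln Q) - C).
Proof.
(* There is no character modulo 0. *)
have [->|l0] := posnP l; first by exists 0 => delta xi _ [[]].
(* E is fixed before delta, xi and Q, so that C is too. *)
have [E E0 hE] := agreeing_characters R l hk2.
(* D ^ y has to exceed W, at most (8 * E ^ 2 * 4) ^ y, as well as l q1 q2 and 64. *)
pose D := (64 * E ^ 2 * l.+1)%N; pose c : R := ln D%:R.
have D64 : (64 <= D)%N by rewrite /D -mulnA leq_pmulr // muln_gt0 expn_gt0 E0.
have D0 : (0 < D)%N by apply: leq_trans D64.
have c0 : 0 < c by rewrite ln_gt0 // ltr1n (leq_trans _ D64).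
pose A : R := (totient l)%:R / l%:R * expR (euler_gamma R).
have A0 : 0 < A.
  by rewrite mulr_gt0 ?expR_gt0 // divr_gt0 // ltr0n // totient_gt0.
(* ln (64 c) converts ln y into ln ln Q, and 11 comes from [main_term]. The rest is 8 from
   [Xj_large], 2, and twice the bound 1 + 64 c for harm J / y. *)
pose C := A * (ln (64 * c) + 11) + 12 + 128 * c.
exists C => delta xi hd hxi rxi; exists (fun=> 0); split; first exact: cvg_cst.
near=> Q.
(* This makes the claimed lower bound nonnegative, which gives 1 <= [Bd] below. *)
have Q1 : expR (expR (C / A)) <= Q by near: Q; exact: nbhs_pinfty_ge.
have Q2 : expR (16 * c * (l.+2 ^ 2)%:R) <= Q by near: Q; exact: nbhs_pinfty_ge.
have Q0 : 0 < Q := lt_le_trans (expR_gt0 _) Q1.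
have lQ1 : expR (C / A) <= ln Q by rewrite -ler_expR lnK.
have lQ0 : 0 < ln Q := lt_le_trans (expR_gt0 _) lQ1.
have llQ : C <= A * ln (ln Q) by rewrite mulrC -ler_pdivrMr // -ler_expR lnK.
have [z [mz z1 z2]] := sqrt_choice c0 (ltn0Sn l.+1) Q2.
pose y := (z ^ 2)%N; pose U := (D ^ y)%N; pose Qn := Num.truncn Q.
have z2' : (2 <= z)%N by apply: leq_trans mz.
have zy : (z <= y)%N by rewrite /y expnS expn1 leq_pmulr // (leq_trans _ z2').
have ly : (l <= y)%N by apply: leq_trans zy; apply: leq_trans mz; rewrite ltnW // ltnW.
have y2 : (2 <= y)%N := leq_trans z2' zy.
have y0 : (0 < y)%N := ltnW y2.
have [q1 [q2 [chi1 [chi2 [[pq1 pq2 q12] [yq1 yq2 _ _] [qE1 qE2] [ok1 ok2] agree]]]]] := hE y y0.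
have q12E : (q1 * q2 <= (E ^ 2) ^ y)%N by rewrite expnAC expnS expn1 leq_mul.
have y_pow m : (m <= m ^ y)%N by rewrite -{1}[m]expn1; case: m => // m; rewrite leq_pexp2l.
have WU : (8 * (q1 * q2) * primorial y < U)%N.
  apply: (@leq_ltn_trans ((8 * E ^ 2 * 4) ^ y)); last by rewrite ltn_exp2r // /D; move: E0; clear; nia.
  by rewrite !expnMn !leq_mul // primorial_le.
have aU : (l * (q1 * q2) <= U)%N.
  apply: (@leq_trans ((l * E ^ 2) ^ y)); last by rewrite leq_exp2r // /D; move: E0 l0; clear; nia.
  by rewrite expnMn leq_mul.
have U64 : (64 <= U)%N := leq_trans D64 (y_pow D).
have U0 : (0 < U)%N := @leq_trans 64 1 _ isT U64.
have /andP[Qn1 Qn2] := truncn_itv (ltW Q0); rewrite -/Qn in Qn1 Qn2.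
have UQ : (U ^ 16 <= Qn)%N.
  rewrite -ltnS -(ltr_nat R); apply: le_lt_trans Qn2.
  exact: natr_expn_le_ln D0 Q0 z1.
have [B] := nat_params U64 UQ aU WU.
set J := (Qn %/ U ^ 2)%N; set P := (U * B.+1 ^ 2)%N.
move=> [[UJ BJ JB] hP hHJ hQJ [PJ nJ QB]].
have J0 : (0 < J)%N by apply: leq_trans UJ; rewrite expn_gt0 U0.
have hB := harm_le_root R J0 JB.
exists (B ^ 2)%N; split; first exact: cube_root_le (ltW Q0) Qn2 QB.
have mt : (4 ^ (2 * z ^ 2) <= J)%N.
  apply: leq_trans UJ; rewrite -/y expnM; apply: (@leq_trans U); last by rewrite -{1}[U]expn1 leq_pexp2l.
  by rewrite leq_exp2r // (leq_trans _ D64).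
have := main_term R l0 ly z2' mt; rewrite -/y -/A => hS.
pose h := y%:R^-1 * harm R J.
pose Bd := A * (ln y%:R - 11) - 2 - 2 * h.
have JQ : J%:R <= Q by apply: le_trans Qn1; rewrite ler_nat leq_div.
have hle : h <= 1 + 64 * c := harm_div_le y0 J0 JQ z2.
have hL := ln_ln_le c0 y0 lQ0 z2.
have AL := ler_wpM2l (ltW A0) hL.
have BdC : A * ln (ln Q) - C <= Bd - 8.
  rewrite /Bd /C; move: AL hle; rewrite !mulrDr.
  by move: (A * ln (64 * c)) (A * ln y%:R) (A * ln (ln Q)) (h); clear => *; lra.
apply: (@card_le_trans _ _ _ (large_L1_chars k delta xi Q (Bd - 8))); last first.
  apply: subset_card_le => chi [q [q0 pr od par [L hL1 hL2]]]; exists q; split=> //.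
  by exists L => //; apply: le_trans hL2; rewrite lecR.
apply: (many_large_L1 hk2 hkeven hxi rxi hd y2 ly pq1 pq2 q12 yq1 yq2 ok1 ok2 agree J0 (H := (U ^ 4)%N) (P := P)).
- by rewrite expn_gt0 U0.
- apply: leq_trans UJ; apply: (@leq_trans (U * U ^ 4)); last by rewrite -expnS leq_pexp2l.
  by rewrite leq_mul2r (leq_trans _ aU) ?orbT // leq_pmulr // muln_gt0 !prime_gt0.
- exact: hP.
- by rewrite mulnA.
- by rewrite mulnA; apply: le_trans Qn1; rewrite ler_nat.
- move: BdC llQ; clear; lra.
- by apply: le_trans (ler_wpM2l (ler0n R P) hB) _; rewrite -natrM ler_nat.
- by apply: le_trans (ler_wpM2l (ler0n R _) hB) _; rewrite -natrM ler_nat.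
rewrite -/h (_ : Bd + 2 + 2 * h = A * (ln y%:R - 11)) //.
by rewrite /Bd; ring.
Unshelve. all: by end_near.
Qed.
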